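(* Let $v_1,v_2$ and the kernels $\omega_\eta$, $\eta>0$, satisfy the hypotheses in the context, and let $\rho_0\in L^1(\mathbb R)\cap \mathrm{BV}(\mathbb R)$ with $\rho_0(x)\in[0,\rho^{\max}_1]$ for a.e. $x<0$ and $\rho_0(x)\in[0,\rho^{\max}_2]$ for a.e. $x>0$. For $\eta>0$ let $\rho^\eta$ be the (unique) entropy weak solution of the nonlocal 1-to-1 junction model $$\partial_t\rho+\partial_x\big(\rho\,V_1^\eta(t,x)+\min\{\rho,\rho^{\max}_2\}\,V_2^\eta(t,x)\big)=0,\qquad \rho(0,x)=\rho_0(x),\qquad x\in\mathbb R,\ t>0.$$ Then, as $\eta\to\infty$, $\rho^\eta$ converges in $L^1_{\mathrm{loc}}$ to the unique entropy solution of the local problem $$\partial_t\rho+\partial_x\big(\min\{\rho\,v_2(0),\ \rho^{\max}_2 v_2(0)\}\big)=0,\qquad \rho(0,x)=\rho_0(x).$$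
   Context: There is one incoming road $(-\infty,0)$ (index $1$) and one outgoing road $(0,\infty)$ (index $2$), with maximum densities $\rho^{\max}_1,\rho^{\max}_2>0$. The density on the whole line is $\rho(t,x)=\rho_1(t,x)$ for $x<0$ and $\rho(t,x)=\rho_2(t,x)$ for $x>0$. Hypotheses ($\mathbb R^+=[0,\infty)$): $v_e\in C^2([0,\rho^{\max}_e];\mathbb R^+)$, $v_e'\le 0$, $v_e(\rho^{\max}_e)=0$ for $e=1,2$; for each $\eta>0$, $\omega_\eta\in C^1([0,\eta];\mathbb R^+)$, $\omega_\eta'\le 0$, $\int_0^\eta\omega_\eta(x)\,dx=1$; and $\lim_{\eta\to\infty}\omega_\eta(0)=0$. Nonlocal velocities (for all $x\in\mathbb R$): $$V_1^\eta(t,x)=\int_{\min\{x,0\}}^{\min\{x+\eta,0\}}v_1(\rho(t,y))\,\omega_\eta(y-x)\,dy,\qquad V_2^\eta(t,x)=\int_{\max\{x,0\}}^{\max\{x+\eta,0\}}v_2(\rho(t,y))\,\omega_\eta(y-x)\,dy.$$ Entropy weak solution of the nonlocal model: a function $\rho$ with values in $[0,\rho^{\max}_1]$ for $x<0$ and in $[0,\rho^{\max}_2]$ for $x>0$ (and of bounded variation) such that, with $\tilde g(\rho)=\min\{\rho,\rho^{\max}_2\}$, for all $\kappa\in\mathbb R$ and all $\phi\in C_0^1([0,\infty)\times\mathbb R;\mathbb R^+)$, $$0\le\int_0^\infty\!\!\int_{-\infty}^\infty\Big(|\rho-\kappa|\phi_t+|\rho-\kappa|V_1^\eta\phi_x+\operatorname{sgn}(\rho-\kappa)(\tilde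 g(\rho)-\tilde g(\kappa))V_2^\eta\phi_x-\operatorname{sgn}(\rho-\kappa)\,\kappa\,\partial_xV_1^\eta\,\phi-\operatorname{sgn}(\rho-\kappa)\,\tilde g(\kappa)\,\partial_xV_2^\eta\,\phi\Big)dx\,dt+\int_{-\infty}^\infty|\rho_0-\kappa|\,\phi(0,x)\,dx.$$ Existence and uniqueness of this solution for each $\eta>0$ under the hypotheses above is known. Entropy solution of the local problem: the standard Kruzhkov notion, i.e. for all $\kappa\in\mathbb R$ and $\phi\in C_0^1([0,\infty)\times\mathbb R;\mathbb R^+)$, $$0\le\int_0^\infty\!\!\int_{-\infty}^\infty\Big(|\rho-\kappa|\phi_t+\operatorname{sgn}(\rho-\kappa)(\tilde g(\rho)-\tilde g(\kappa))\,v_2(0)\,\phi_x\Big)dx\,dt+\int_{-\infty}^\infty|\rho_0-\kappa|\,\phi(0,x)\,dx.$$ *)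

(* Defs.v *)
From HB Require Import structures.
From mathcomp Require Import all_boot all_order all_algebra.
From mathcomp Require Import all_classical all_reals all_analysis.
Set Implicit Arguments.
Unset Strict Implicit.
Unset Printing Implicit Defensive.
Import Order.TTheory GRing.Theory Num.Theory.
Import numFieldNormedType.Exports.
Local Open Scope classical_set_scope.
Local Open Scope ring_scope.

Section Regularity.
Context {R : realType}.
Implicit Types (a b : R) (f g : R -> R).

(* [f] is C^1 on the closed interval [a, b], and [f'] is its derivative there:
   [f] is differentiable inside, and its derivative extends continuously to the
   endpoints as [f'].  The values of [f] outside [a, b] are irrelevant. *)
Definition C1_itv a b f f' : Prop :=
  [/\ derivable_oo_LRcontinuous f a b,
      {in `]a, b[, derive1 f =1 f'} &
      {within `[a, b], continuous f'}].

Definition C2_itv a b f f' f'' : Prop := C1_itv a b f f' /\ C1_itv a b f' f''.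

(* [f] has bounded variation on the whole line, as an element of L^1_loc: some
   a.e. representative has finite total variation. *)
Definition BV_line f : Prop :=
  exists2 g, {ae lebesgue_measure, forall x : R, f x = g x} &
    exists M : R, forall a b, a <= b -> (total_variation a b g <= M%:E)%E.

(* C^1_0([0, oo) x R; R^+), as restrictions to [0, oo) x R of functions that are
   C^1 with compact support on the plane; they may be nonzero at t = 0, and only
   their values for t >= 0 matter, so the sign is imposed there only. *)
Definition test_function (phi : R -> R -> R) : Prop :=
  [/\ (forall t x, derivable (phi^~ x) t 1 /\ derivable (phi t) x 1),
      continuous (fun z : R * R => derive1 (phi^~ z.2) z.1),
      continuous (fun z : R * R => derive1 (phi z.1) z.2),
      compact (closure [set z : R * R | phi z.1 z.2 != 0]) &
      forall t x, 0 <= t -> 0 <= phi t x].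

End Regularity.

Section Model.
Context {R : realType}.
Local Notation mu := (@lebesgue_measure R).
Implicit Types (rho : R -> R -> R) (v w : R -> R).

Definition admissible_velocity (rhomax : R) v : Prop :=
  exists v' v'' : R -> R,
  [/\ C2_itv 0 rhomax v v' v'',
      {in `[0, rhomax], forall r, 0 <= v r},
      {in `[0, rhomax], forall r, v' r <= 0} &
      v rhomax = 0].

Definition admissible_kernel (eta : R) w : Prop :=
  exists w' : R -> R,
  [/\ C1_itv 0 eta w w',
      {in `[0, eta], forall x, 0 <= w x},
      {in `[0, eta], forall x, w' x <= 0} &
      \int[mu]_(x in `[0, eta]) w x = 1].

Definition V1 (eta : R) v1 w rho (t x : R) : R :=
  \int[mu]_(y in `[Num.min x 0, Num.min (x + eta) 0])
    (v1 (rho t y) * w (y - x)).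

Definition V2 (eta : R) v2 w rho (t x : R) : R :=
  \int[mu]_(y in `[Num.max x 0, Num.max (x + eta) 0])
    (v2 (rho t y) * w (y - x)).

Definition trunc (rhomax2 r : R) : R := Num.min r rhomax2.

Definition half_plane : set (R * R) := [set z | 0 <= z.1].

(* The velocities are Lipschitz in x, hence differentiable a.e.: the values of
   [derive1] at the remaining points do not affect the integral. *)
Definition nonlocal_entropy_inequality (rhomax2 eta : R) v1 v2 w (rho0 : R -> R) rho
    (kappa : R) (phi : R -> R -> R) : Prop :=
  let g := trunc rhomax2 in
  let W1 := V1 eta v1 w rho in
  let W2 := V2 eta v2 w rho in
  (0 <= (\int[mu]_(t in `[0%R, +oo[) \int[mu]_x
          (`|rho t x - kappa| * derive1 (phi^~ x) t
           + `|rho t x - kappa| * W1 t x * derive1 (phi t) x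
           + Num.sg (rho t x - kappa) * (g (rho t x) - g kappa)
               * W2 t x * derive1 (phi t) x
           - Num.sg (rho t x - kappa) * kappa * derive1 (W1 t) x * phi t x
           - Num.sg (rho t x - kappa) * g kappa * derive1 (W2 t) x * phi t x)%R%:E)
       + \int[mu]_x (`|rho0 x - kappa| * phi 0 x)%R%:E)%E.

Definition nonlocal_entropy_solution (rhomax1 rhomax2 eta : R) v1 v2 w (rho0 : R -> R) rho
    : Prop :=
  [/\ measurable_fun half_plane (fun z : R * R => rho z.1 z.2),
      {ae (mu \x mu)%E, forall z : R * R, 0 <= z.1 ->
         (z.2 < 0 -> 0 <= rho z.1 z.2 <= rhomax1) /\
         (0 < z.2 -> 0 <= rho z.1 z.2 <= rhomax2)},
      {ae mu, forall t, 0 < t -> BV_line (rho t)} &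
      forall kappa phi, test_function phi ->
        nonlocal_entropy_inequality rhomax2 eta v1 v2 w rho0 rho kappa phi].

Definition local_entropy_inequality (rhomax2 : R) v2 (rho0 : R -> R) rho
    (kappa : R) (phi : R -> R -> R) : Prop :=
  let g := trunc rhomax2 in
  (0 <= (\int[mu]_(t in `[0%R, +oo[) \int[mu]_x
          (`|rho t x - kappa| * derive1 (phi^~ x) t
           + Num.sg (rho t x - kappa) * (g (rho t x) - g kappa)
               * v2 0 * derive1 (phi t) x)%R%:E)
       + \int[mu]_x (`|rho0 x - kappa| * phi 0 x)%R%:E)%E.

(* Kruzhkov's class: bounded measurable functions. *)
Definition local_entropy_solution (rhomax2 : R) v2 (rho0 : R -> R) rho : Prop :=
  [/\ measurable_fun half_plane (fun z : R * R => rho z.1 z.2),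
      exists M : R,
        {ae (mu \x mu)%E, forall z : R * R, 0 <= z.1 -> `|rho z.1 z.2| <= M} &
      forall kappa phi, test_function phi ->
        local_entropy_inequality rhomax2 v2 rho0 rho kappa phi].

(* Convergence in L^1_loc([0, oo) x R) as eta -> +oo. *)
Definition L1loc_cvg (rhoeta : R -> R -> R -> R) rho : Prop :=
  forall K : set (R * R), compact K -> K `<=` half_plane ->
    (\int[(mu \x mu)%E]_(z in K)
        `|rhoeta eta z.1 z.2 - rho z.1 z.2|%:E)%E @[eta --> +oo] --> 0%E.

End Model.

(* Main.v *)
(* Idea.  The kernel has unit mass and is bounded by omega_eta(0), so on a
   bounded region, for eta large, V_1, d_x V_1 and d_x V_2 are O(omega_eta(0)),
   while |V_2 - v_2(0)| is O(omega_eta(0)) times one plus the mass of rho over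
   a window.  That mass is bounded uniformly in eta, by taking kappa = 0 in the
   entropy inequality.  Hence rho^eta satisfies the Kruzhkov inequalities of the
   local problem up to an error O(omega_eta(0)).  Kruzhkov's doubling of
   variables compares two such approximate entropy solutions and makes them
   L^1-close on every bounded region.  Applied to the family itself it gives the
   Cauchy property, hence a limit, which is an exact entropy solution; applied
   to exact solutions it gives uniqueness; applied to the limit and rho^eta it
   gives convergence. *)

(* The doubling is carried out at fixed scales, [a] in time and [b] in space, which are not sent to
   0 for given solutions. Instead |u(z) - v(z)| <= |u(z) - v(w)| + |v(w) - v(z)| is averaged over w
   near z, and both terms are doubled quantities, for the pairs (u, v) and (v, v). So no modulus of
   continuity of a solution enters, and the tolerated error is the same for all approximate
   solutions with a given datum and bound; this uniformity turns the O(omega_eta(0)) defect into a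
   Cauchy estimate. The obstacle is the initial time, where the datum is attained only through the
   weak inequality. With a one-sided time kernel only u meets the datum directly; the distance from
   v to the datum at times of order [a] costs a flux term O(a) for fixed [b], plus the L^1
   oscillation of rho0 at scale [b]. Hence the order of choices: [b] from rho0, then [a], then the
   class of test functions, then the error. *)
Require Import Defs.
From HB Require Import structures.
From mathcomp Require Import all_boot all_order all_algebra.
From mathcomp Require Import all_classical all_reals all_analysis.
From mathcomp Require Import measurable_realfun ring lra.
Set Implicit Arguments.
Unset Strict Implicit.
Unset Printing Implicit Defensive.
Import Order.TTheory GRing.Theory Num.Theory.
Import numFieldNormedType.Exports.
Local Open Scope classical_set_scope.
Local Open Scope ring_scope.

(** * Integration *)

Section integral_without_measurability.
Local Open Scope ereal_scope.
Context d (T : measurableType d) (R : realType).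
Variable mu : {measure set T -> \bar R}.
Import HBNNSimple.

(* The integral is a supremum over simple functions below, so monotonicity
   needs no measurability. *)
Lemma ge0_ae_le_integral_nomeas (f g : T -> \bar R) :
  (forall x, 0 <= f x) -> (forall x, 0 <= g x) ->
  {ae mu, forall x, f x <= g x} -> \int[mu]_x f x <= \int[mu]_x g x.
Proof.
move=> f0 g0 [N [mN N0 fgN]]; rewrite !ge0_integralTE//.
apply: ge_ereal_sup => _ [h /= hf <-].
have mNC : measurable (~` N) by exact: measurableC.
(* Cutting [h] off on the null set [N] keeps its integral and puts it below [g] everywhere. *)
pose h' := proj_nnsfun h mNC.
have h'E x : h' x = (h x * \1_(~` N) x)%R by rewrite /h' /= .
have -> : sintegral mu h = sintegral mu h'.
  rewrite -[LHS]integralT_nnsfun -[RHS]integralT_nnsfun.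
  apply: ge0_ae_eq_integral => //.
  - by apply/measurable_EFinP.
  - by apply/measurable_EFinP.
  - by move=> x _; rewrite lee_fin fun_ge0.
  - by move=> x _; rewrite lee_fin fun_ge0.
  exists N; split=> // x /= hx; apply: contrapT => Nx; apply: hx => _.
  by congr EFin; apply/esym/(etrans (h'E x)); rewrite indicE mem_set ?mulr1.
apply: ereal_sup_ubound; exists h' => //= x.
suff : (h x * \1_(~` N) x)%:E <= g x by [].
rewrite indicE.
case: (boolP (x \in ~` N)); rewrite ?mulr0// mulr1 inE => Nx.
rewrite (le_trans (hf x))//; move: Nx; apply: contra_notP => fg.
exact: fgN.
Qed.

(** Positive parts are ordered one way and negative parts the other, so the nonnegative case applies
    to each. The entropy integrand contains [derive1] of the nonlocal velocities, whose
    measurability is never established: this is the form in which such integrals are compared. *)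
Lemma ae_le_integral_nomeas (D : set T) (f g : T -> \bar R) :
  {ae mu, forall x, D x -> f x <= g x} ->
  \int[mu]_(x in D) f x <= \int[mu]_(x in D) g x.
Proof.
move=> [N [mN N0 fgN]]; rewrite integral_mkcond [leRHS]integral_mkcond.
have fg x : ~ N x -> (f \_ D) x <= (g \_ D) x.
  move=> Nx; rewrite !patchE; case: ifPn => //; rewrite inE => Dx.
  move: Nx; apply: contra_notP => fg; apply: fgN => /=.
  by move=> /(_ Dx).
rewrite integralE [leRHS]integralE.
apply: leeB => /=.
- apply: ge0_ae_le_integral_nomeas => //.
  exists N; split=> // x /=; apply: contra_notP => /fg fgx.
  by rewrite !funeposE ge_max !le_max fgx lexx orbT.
- apply: ge0_ae_le_integral_nomeas => //.
  exists N; split=> // x /=; apply: contra_notP => /fg fgx.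
  by rewrite !funenegE ge_max !le_max leeN2 fgx lexx orbT.
Qed.

Lemma ae_eq_integral_nomeas (D : set T) (f g : T -> \bar R) :
  {ae mu, forall x, D x -> f x = g x} ->
  \int[mu]_(x in D) f x = \int[mu]_(x in D) g x.
Proof.
move=> fg; apply/eqP; rewrite eq_le !ae_le_integral_nomeas//.
- by apply: filterS fg => x h /h ->.
- by apply: filterS fg => x h /h ->.
Qed.

Lemma bounded_supp_integrable (f : T -> R) (E : set T) (C : R) :
  measurable E -> mu E < +oo -> measurable_fun setT f ->
  (forall x, `|f x| <= C)%R -> (forall x, ~ E x -> f x = 0)%R ->
  mu.-integrable setT (EFin \o f).
Proof.
move=> mE muE mf fC f0.
apply: (@le_integrable _ _ _ mu setT measurableT _
  (fun x => (C * \1_E x)%:E)).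
- exact/measurable_EFinP.
- move=> x _ /=; rewrite lee_fin indicE.
  case: (boolP (x \in E)); rewrite ?(inE, notin_setE) => Ex.
    by rewrite mulr1 (le_trans (fC x))// ler_norm.
  by rewrite f0// normr0.
- under eq_fun do rewrite EFinM.
  apply: integrableZl => //; apply/integrableP; split.
    exact/measurable_EFinP/measurable_indic.
  under eq_integral do rewrite gee0_abs ?lee_fin//.
  by rewrite integral_indic// setIT.
Qed.

Lemma integral_le_cst_supp (f : T -> R) (E : set T) (C : R) :
  measurable E ->
  (forall x, E x -> f x <= C)%R -> (forall x, ~ E x -> f x <= 0)%R ->
  \int[mu]_x (f x)%:E <= C%:E * mu E.
Proof.
move=> mE fC f0.
have -> : C%:E * mu E = \int[mu]_(x in E) (cst C%:E) x by rewrite integral_cst.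
rewrite [leRHS]integral_mkcond; apply: ae_le_integral_nomeas.
apply: aeW => x _; rewrite patchE; case: ifPn => [|].
  by rewrite inE => /fC; rewrite lee_fin.
by rewrite notin_setE => /f0; rewrite lee_fin.
Qed.

End integral_without_measurability.

Section product_sections.
Local Open Scope ereal_scope.
Context d1 d2 (T1 : measurableType d1) (T2 : measurableType d2) (R : realType).
Variable m1 : {sigma_finite_measure set T1 -> \bar R}.
Variable m2 : {sigma_finite_measure set T2 -> \bar R}.

(** The measure of the exceptional set is the integral of the measures of its sections; a
    nonnegative function with zero integral vanishes almost everywhere. *)
Lemma ae_xsection (P : T1 * T2 -> Prop) :
  {ae m1 \x m2, forall z, P z} ->
  {ae m1, forall x, {ae m2, forall y, P (x, y)}}.
Proof.
move=> [N [mN N0 PN]].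
have : ae_eq m1 setT (fun x => m2 (xsection N x)) (cst 0).
  have mf := measurable_fun_xsection m2 mN.
  apply: (ae_eq_integral_abs m1 measurableT mf).1.
  rewrite -[RHS]N0; apply: eq_integral => x _.
  by rewrite gee0_abs.
apply: filterS => x /(_ I) /= Nx.
exists (xsection N x); split=> //; first exact: measurable_xsection.
by move=> y Py; rewrite /xsection /= inE; exact: PN.
Qed.

End product_sections.

Section translation.
Context (R : realType).
Local Notation mu := (@lebesgue_measure R).
Local Open Scope ereal_scope.

Lemma lebesgue_measure_shift (a : R) (A : set R) : measurable A ->
  pushforward mu (fun x => x - a : measurableTypeR R)%R A = mu A.
Proof.
have mphi : measurable_fun setT (fun x : R => x - a : measurableTypeR R)%R.
  exact: measurable_funB.
pose mphi_mixin := isMeasurableFun.Build _ _ _ _ _ mphi.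
pose phi : {mfun _ >-> _} := HB.pack (fun x : R => x - a : measurableTypeR R)%R mphi_mixin.
move=> mA; apply/esym/(@lebesgue_measure_unique R (pushforward mu phi)) => //= X.
move=> [[b c]] _ <-; rewrite /pushforward.
rewrite (_ : _ @^-1` _ = `](b + a)%R, (c + a)%R]%classic).
  by rewrite !lebesgue_measure_itv/= !lte_fin ltrD2r -!EFinB opprD addrACA subrr addr0.
by apply/seteqP; split => x /=; rewrite !in_itv/= ltrBrDr lerBlDr.
Qed.

Lemma ge0_integral_shift (f : R -> \bar R) (a : R) :
  measurable_fun setT f -> (forall x, 0 <= f x) ->
  \int[mu]_x f (x - a)%R = \int[mu]_x f x.
Proof.
move=> mf f0.
have mphi : measurable_fun setT (fun x : R => x - a : measurableTypeR R)%R.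
  exact: measurable_funB.
transitivity (\int[pushforward mu (fun x => x - a : measurableTypeR R)%R]_x f x).
  by rewrite ge0_integral_pushforward.
by apply: eq_measure_integral => A mA _; exact: lebesgue_measure_shift.
Qed.

End translation.

Section plane.
Context (R : realType).

(** The plane carries the product sigma-algebra, so open sets have to be written as countable unions
    of rectangles: those with rational corners that lie inside [U]. *)
Lemma open_measurable_plane (U : set (R * R)) : open U -> measurable U.
Proof.
move=> oU.
pose box (p q : rat * rat) : set (R * R) :=
  `]ratr p.1, ratr p.2[%classic `*` `]ratr q.1, ratr q.2[%classic.
pose I := [set pq : (rat * rat) * (rat * rat) | box pq.1 pq.2 `<=` U].
rewrite (_ : U = \bigcup_(pq in I) box pq.1 pq.2); last first.
  apply/seteqP; split => [[x y] Uxy|z [pq Ipq]]; last exact: Ipq.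
  have : nbhs (x, y) U by rewrite nbhsE /=; exists U.
  move=> [[A B] /= [Ax By] ABU].
  move: Ax By; rewrite -!nbhs_ballE => -[e /= e0 eA] [e' /= e'0 eB].
  have /rat_in_itvoo[p1] : x - e < x by lra.
  rewrite in_itv/= => /andP[p1l p1r].
  have /rat_in_itvoo[p2] : x < x + e by lra.
  rewrite in_itv/= => /andP[p2l p2r].
  have /rat_in_itvoo[q1] : y - e' < y by lra.
  rewrite in_itv/= => /andP[q1l q1r].
  have /rat_in_itvoo[q2] : y < y + e' by lra.
  rewrite in_itv/= => /andP[q2l q2r].
  exists ((p1, p2), (q1, q2)).
    move=> [x' y'] [/=]; rewrite !in_itv/= => /andP[h1 h2] /andP[h3 h4].
    apply: ABU; split => /=.
      by apply: eA; rewrite /ball/= ltr_norml; apply/andP; split; lra.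
    by apply: eB; rewrite /ball/= ltr_norml; apply/andP; split; lra.
  by split => /=; rewrite in_itv/=; apply/andP.
rewrite bigcup_mkcond; apply: countable_bigcupT_measurable => // pq.
by case: ifPn => // _; apply: measurableX; exact: measurable_itv.
Qed.

Lemma continuous_measurable_plane (f : R * R -> R) :
  continuous f -> measurable_fun setT f.
Proof.
move=> /continuousP cf; apply: (measurability _ (@RGenOpens.measurableE R)).
move=> _ [_ [a [b ->] <-]]; rewrite setTI.
have /cf/open_measurable_plane : open (`]a, b[%classic : set R).
  exact: interval_open.
by [].
Qed.

End plane.

(** * Test functions *)

Section calculus.
Context {R : realType}.
Implicit Types (f g a b : R -> R) (phi : R -> R -> R).

(** Turns differentiability into a polynomial inequality, which can be checked case by case on signs
    even where a function changes its formula, as [possq] does at 0. *)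
Lemma is_derive_quadratic_remainder f (r d C : R) :
  (forall h, `|f (r + h) - f r - d * h| <= C * h ^+ 2) -> is_derive r 1 f d.
Proof.
move=> fh.
have fd : h^-1 *: (f (h *: 1 + r) - f r) @[h --> 0^'] --> d.
  apply/cvgrPdist_le => e e0.
  exists (e / (`|C| + 1)) => /=; first by rewrite divr_gt0// ltr_wpDl.
  move=> h /=; rewrite sub0r normrN => he h0.
  rewrite [h *: 1]mulr1 -[_ *: _]/(_ * _) (addrC h).
  rewrite (_ : d - _ = - (h^-1 * (f (r + h) - f r - d * h))); last first.
    by rewrite [in RHS]mulrBr (mulrC d) mulKf// opprB.
  rewrite normrN normrM normfV ler_pdivrMl ?normr_gt0//.
  rewrite (le_trans (fh h))// -real_normK ?num_real// expr2.
  rewrite mulrCA ler_wpM2l//.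
  rewrite (@le_trans _ _ ((`|C| + 1) * `|h|))//.
    by rewrite ler_wpM2r// (le_trans (ler_norm C))// lerDl.
  by rewrite mulrC -ler_pdivlMr ?ltW// ltr_wpDl.
by apply: DeriveDef; [apply/cvg_ex; exists d | exact: cvg_lim].
Qed.

(** Squared positive part: C^1 but not C^2, which suffices because test functions are only C^1.
    Every explicit test function below is built from it. *)
Definition possq (r : R) : R := Num.max r 0 ^+ 2.

Lemma possq_ge0 r : 0 <= possq r. Proof. exact: sqr_ge0. Qed.

Lemma possq0 r : r <= 0 -> possq r = 0.
Proof. by move=> r0; rewrite /possq max_r// expr0n. Qed.

Lemma is_derive_possq (r : R) : is_derive r 1 possq (2 * Num.max r 0).
Proof.
apply: (@is_derive_quadratic_remainder _ _ _ 1) => h; rewrite /possq.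
rewrite ler_norml mul1r; apply/andP; split;
by case: (leP (r + h) 0) => ?; case: (leP r 0) => ?; rewrite ?expr0n/=; nra.
Qed.

(** Supported in [-1, 1] and not normalised: only an upper bound, a lower bound on [-1/2, 1/2] and a
    bound on the derivative are used. *)
Definition bump (r : R) : R := possq (1 - r ^+ 2).
Definition dbump (r : R) : R := - 4 * r * Num.max (1 - r ^+ 2) 0.

Definition C1fun f f' := (forall t : R, is_derive t 1 f (f' t)) /\ continuous f'.

Lemma C1fun_continuous f f' : C1fun f f' -> continuous f.
Proof.
move=> [df _] t; apply/differentiable_continuous/derivable1_diffP.
exact: (@ex_derive _ _ _ _ _ _ _ (df t)).
Qed.

Lemma continuous_maxr0 (T : topologicalType) (f : T -> R) :
  continuous f -> continuous (fun z => Num.max (f z) 0).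
Proof. by move=> cf z; apply: continuous_max; [exact: cf|exact: cvg_cst]. Qed.

Lemma continuous_possq : continuous possq.
Proof.
move=> t; apply/differentiable_continuous/derivable1_diffP.
by have ? := is_derive_possq t; exact: ex_derive.
Qed.

Lemma C1fun_bump : C1fun bump dbump.
Proof.
split=> [t|].
  have h : is_derive t 1 (fun r : R => 1 - r ^+ 2) (- 2 * t).
    by apply: is_derive_eq; rewrite /GRing.scale/=; ring.
  have h2 := @is_derive1_comp _ possq (fun r : R => 1 - r ^+ 2) t _ _ (is_derive_possq _) h.
  apply: (is_derive_eq h2).
  by rewrite /dbump /GRing.scale/=; ring.
move=> t; apply: cvgM; first by apply: cvgM; [exact: cvg_cst|exact: cvg_id].
apply: (continuous_maxr0 (f := fun t : R => 1 - t ^+ 2)) => {}t.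
by apply: cvgB; [exact: cvg_cst|exact: exprn_continuous].
Qed.

Lemma bump_ge0 r : 0 <= bump r. Proof. exact: possq_ge0. Qed.

Lemma bump_le1 r : bump r <= 1.
Proof.
rewrite /bump /possq; have := sqr_ge0 r; move: (r ^+ 2) => s s0.
by case: (leP (1 - s) 0) => ?; rewrite ?expr0n/=; nra.
Qed.

Lemma bump_out r : 1 <= `|r| -> bump r = 0.
Proof.
move=> r1; apply: possq0; rewrite subr_le0 -real_normK ?num_real//.
by rewrite exprn_ege1.
Qed.

Lemma bump_half r : `|r| <= 2^-1 -> 2^-1 <= bump r.
Proof.
move=> r1; have : r ^+ 2 <= 4^-1.
  rewrite -real_normK ?num_real//.
  by have := normr_ge0 r; nra.
rewrite /bump /possq; move: (r ^+ 2) => s s0.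
by case: (leP (1 - s) 0) => ?; rewrite ?expr0n/=; nra.
Qed.

Lemma dbump_le4 r : `|dbump r| <= 4.
Proof.
have [r1|r1] := leP 1 `|r|.
  rewrite /dbump max_r ?mulr0 ?normr0//.
  by rewrite subr_le0 -real_normK ?num_real// exprn_ege1.
have r2 : r ^+ 2 <= 1 by rewrite -real_normK ?num_real// exprn_ile1 ?normr_ge0 ?(ltW r1).
rewrite /dbump max_l ?subr_ge0// !normrM normrN normr_nat.
rewrite (@ger0_norm _ (1 - _)) ?subr_ge0//.
have := sqr_ge0 r; have := normr_ge0 r; move: (r ^+ 2) r2 => s; nra.
Qed.

Lemma C1fun_affine f f' (k m : R) : C1fun f f' ->
  C1fun (fun t => f (k * t + m)) (fun t => k * f' (k * t + m)).
Proof.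
move=> [df cf]; split=> [t|t].
  have h : is_derive t 1 (fun t : R => k * t + m) k.
    by apply: is_derive_eq; rewrite /GRing.scale/=; ring.
  have h2 := @is_derive1_comp _ f (fun t : R => k * t + m) t _ _ (df _) h.
  apply: (is_derive_eq h2).
  by rewrite mulrC.
apply: cvgM; first exact: cvg_cst.
apply: (@continuous_comp _ _ _ (fun t : R => k * t + m) f'); last exact: cf.
by apply: cvgD; [apply: cvgM; [exact: cvg_cst|exact: cvg_id]|exact: cvg_cst].
Qed.

Lemma C1funZ f f' (k : R) : C1fun f f' ->
  C1fun (fun t => k * f t) (fun t => k * f' t).
Proof.
move=> [df cf]; split=> [t|t].
  by apply: is_derive_eq; rewrite /GRing.scale/= ?mulr0 ?addr0.
by apply: cvgM; [exact: cvg_cst|exact: cf].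
Qed.

Definition C1plane phi pt px :=
  [/\ forall t x : R, is_derive t 1 (phi^~ x) (pt t x),
      forall t x : R, is_derive x 1 (phi t) (px t x),
      continuous (fun z : R * R => phi z.1 z.2),
      continuous (fun z : R * R => pt z.1 z.2) &
      continuous (fun z : R * R => px z.1 z.2)].

Definition box_supported (B : R) phi :=
  forall t x, B < `|t| \/ B < `|x| -> phi t x = 0.

Lemma continuous_fst_comp f : continuous f ->
  continuous (fun z : R * R => f z.1).
Proof.
by move=> cf z; apply: (@continuous_comp _ _ _ fst f); [exact: cvg_fst|exact: cf].
Qed.

Lemma continuous_snd_comp f : continuous f ->
  continuous (fun z : R * R => f z.2).
Proof.
by move=> cf z; apply: (@continuous_comp _ _ _ snd f); [exact: cvg_snd|exact: cf].
Qed.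

Lemma C1planeM phi pt px a a' b b' :
  C1plane phi pt px -> C1fun a a' -> C1fun b b' ->
  C1plane (fun t x => phi t x * (a t * b x))
    (fun t x => pt t x * (a t * b x) + phi t x * (a' t * b x))
    (fun t x => px t x * (a t * b x) + phi t x * (a t * b' x)).
Proof.
move=> [dt dx c ct cx] aa bb.
have ca := continuous_fst_comp (C1fun_continuous aa).
have cb := continuous_snd_comp (C1fun_continuous bb).
case: aa bb => da ca' [db cb'].
have {}ca' := continuous_fst_comp ca'.
have {}cb' := continuous_snd_comp cb'.
split.
- move=> t x; have ? := dt t x; have ? := da t.
  rewrite (_ : (fun _ => _) = (phi^~ x) * (a * cst (b x)))//.
  by apply: is_derive_eq; rewrite !fctE /GRing.scale/=; ring.
- move=> t x; have ? := dx t x; have ? := db x.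
  rewrite (_ : (fun _ => _) = (phi t) * (cst (a t) * b))//.
  by apply: is_derive_eq; rewrite !fctE /GRing.scale/=; ring.
- by move=> z; apply: cvgM; [exact: c|apply: cvgM; [exact: ca|exact: cb]].
- move=> z; apply: cvgD; apply: cvgM; first exact: ct.
  + by apply: cvgM; [exact: ca|exact: cb].
  + exact: c.
  + by apply: cvgM; [exact: ca'|exact: cb].
- move=> z; apply: cvgD; apply: cvgM; first exact: cx.
  + by apply: cvgM; [exact: ca|exact: cb].
  + exact: c.
  + by apply: cvgM; [exact: ca|exact: cb'].
Qed.

Lemma C1plane_cst (k : R) : C1plane (fun _ _ => k) (fun _ _ => 0) (fun _ _ => 0).
Proof.
split=> [t x|t x|z|z|z]; first exact: is_derive_cst; first exact: is_derive_cst.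
all: exact: cvg_cst.
Qed.

Lemma bounded_box_compact (B : R) :
  compact (`[- B, B]%classic `*` `[- B, B]%classic : set (R * R)).
Proof. by apply: compact_setX; exact: segment_compact. Qed.

Lemma box_supported_compact (B : R) phi : box_supported B phi ->
  compact (closure [set z : R * R | phi z.1 z.2 != 0]).
Proof.
move=> sB; apply: (subclosed_compact (@closed_closure _ _) (@bounded_box_compact B)).
have cl : closed (`[- B, B]%classic `*` `[- B, B]%classic : set (R * R)).
  by apply: compact_closed; [exact: norm_hausdorff|exact: bounded_box_compact].
rewrite closureE => z; apply; split=> // -[t x] /= /eqP p0.
by rewrite !in_itv/= -!ler_norml; split; rewrite leNgt; apply/negP => h;
  apply: p0; apply: sB; [left|right].
Qed.

Lemma C1plane_test_function phi pt px (B : R) : C1plane phi pt px ->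
  box_supported B phi -> (forall t x, 0 <= t -> 0 <= phi t x) ->
  [/\ test_function phi,
      forall t x, derive1 (phi^~ x) t = pt t x &
      forall t x, derive1 (phi t) x = px t x].
Proof.
move=> [dt dx c ct cx] sB p0.
have et t x : derive1 (phi^~ x) t = pt t x by rewrite derive1E; have ? := dt t x; rewrite derive_val.
have ex t x : derive1 (phi t) x = px t x by rewrite derive1E; have ? := dx t x; rewrite derive_val.
split=> //; split=> //.
- by rewrite (_ : (fun _ => _) = (fun z => pt z.1 z.2))//; apply/funext => z; rewrite et.
- by rewrite (_ : (fun _ => _) = (fun z => px z.1 z.2))//; apply/funext => z; rewrite ex.
- exact: box_supported_compact sB.
Qed.

Lemma is_derive_derive1 f (t : R) : derivable f t 1 -> is_derive t 1 f (derive1 f t).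
Proof. by rewrite derive1E => /derivableP. Qed.

(** If the variable of differentiation is the one outside the box, the strict inequality persists
    nearby; if it is the other one, the function vanishes on the whole line. *)
Lemma box_supported_derive1 B phi : box_supported B phi ->
  box_supported B (fun t x => derive1 (phi^~ x) t) /\
  box_supported B (fun t x => derive1 (phi t) x).
Proof.
move=> sB; split=> t x.
  case=> h; last first.
    rewrite (_ : phi^~ x = cst 0) ?derive1_cst//.
    by apply/funext => s; rewrite sB//; right.
  rewrite derive1E (@near_eq_derive _ _ _ _ (cst 0)) ?derive_cst//.
  near=> s; rewrite sB//; left; near: s.
  by apply: (@cvgr_gt _ _ _ _ _ `|t|) => //; exact: norm_continuous.
case=> h.
  rewrite (_ : phi t = cst 0) ?derive1_cst//.
  by apply/funext => s; rewrite sB//; left.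
rewrite derive1E (@near_eq_derive _ _ _ _ (cst 0)) ?derive_cst//.
near=> s; rewrite sB//; right; near: s.
by apply: (@cvgr_gt _ _ _ _ _ `|x|) => //; exact: norm_continuous.
Unshelve. all: by end_near. Qed.

(** The definition assumes only continuous partial derivatives. Being continuous with compact
    support they are bounded, so by the mean value theorem [phi] is Lipschitz in each variable,
    hence jointly continuous and bounded. A single [B] serves for the support and for all the
    bounds. *)
Lemma test_function_box phi : test_function phi ->
  exists B : R, [/\ 0 <= B, box_supported B phi,
     (forall t x, `|phi t x| <= B /\ `|derive1 (phi^~ x) t| <= B /\ `|derive1 (phi t) x| <= B),
     box_supported B (fun t x => derive1 (phi^~ x) t) /\
     box_supported B (fun t x => derive1 (phi t) x) &
     continuous (fun z : R * R => phi z.1 z.2)].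
Proof.
move=> [dphi ct cx K p0].
have /compact_bounded[M [_ MK]] := K.
pose B0 := `|M| + 1.
have sB0 : box_supported B0 phi.
  move=> t x tx; apply: contrapT => /eqP ptx.
  have : closure [set z : R * R | phi z.1 z.2 != 0] (t, x) by exact: subset_closure.
  have MB0 : M < B0 by rewrite (le_lt_trans (ler_norm M))// ltrDl.
  move=> /(MK _ MB0) h; have : Num.max `|t| `|x| <= B0 by exact: h.
  by rewrite ge_max => /andP[]; case: tx; rewrite ltNge => /negP.
have [dt_out dx_out] := box_supported_derive1 sB0.
have bnd (f : R * R -> R) : continuous f -> (forall t x, B0 < `|t| \/ B0 < `|x| -> f (t, x) = 0) ->
    exists C : R, 0 <= C /\ forall t x, `|f (t, x)| <= C.
  move=> cf f0.
  have : compact (f @` (`[- B0, B0]%classic `*` `[- B0, B0]%classic)).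
    apply: continuous_compact; last exact: bounded_box_compact.
    exact: continuous_subspaceT.
  move=> /compact_bounded[C [_ fC]].
  have CC : C < `|C| + 1 by rewrite (le_lt_trans (ler_norm C))// ltrDl.
  exists (`|C| + 1); split=> [|t x]; first by rewrite addr_ge0.
  have [tB|tB] := leP `|t| B0; last by rewrite f0 ?normr0 ?addr_ge0//; left.
  have [xB|xB] := leP `|x| B0; last by rewrite f0 ?normr0 ?addr_ge0//; right.
  apply: fC => //; exists (t, x) => //=.
  by rewrite !in_itv/= -!ler_norml.
have [Ct [Ct0 CtP]] := bnd _ ct (fun t x => dt_out t x).
have [Cx [Cx0 CxP]] := bnd _ cx (fun t x => dx_out t x).
have lipt t t' x : `|phi t' x - phi t x| <= Ct * `|t' - t|.
  wlog tt' : t t' / t <= t'.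
    by move=> W; have [/W//|/ltW/W] := leP t t'; rewrite distrC (distrC t).
  have cf : {within `[t, t'], continuous (phi^~ x)}.
    by apply: continuous_subspaceT => s; exact/differentiable_continuous/derivable1_diffP/(dphi s x).1.
  have [c _ ->] := @MVT_segment _ (phi^~ x) (derive1 (phi^~ x)) t t' tt'
    (fun s _ => is_derive_derive1 (dphi s x).1) cf.
  by rewrite normrM ler_wpM2r//; exact: (CtP c x).
have lipx t x x' : `|phi t x' - phi t x| <= Cx * `|x' - x|.
  wlog xx' : x x' / x <= x'.
    by move=> W; have [/W//|/ltW/W] := leP x x'; rewrite distrC (distrC x).
  have cf : {within `[x, x'], continuous (phi t)}.
    by apply: continuous_subspaceT => s; exact/differentiable_continuous/derivable1_diffP/(dphi t s).2.
  have [c _ ->] := @MVT_segment _ (phi t) (derive1 (phi t)) x x' xx'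
    (fun s _ => is_derive_derive1 (dphi t s).2) cf.
  by rewrite normrM ler_wpM2r//; exact: (CxP t c).
have cphi : continuous (fun z : R * R => phi z.1 z.2).
  move=> [t x]; apply/cvgrPdist_le => e e0.
  have d0 : 0 < e / (Ct + Cx + 1) by rewrite divr_gt0// ltr_wpDl// addr_ge0.
  have : nbhs (t, x) (ball (t, x) (e / (Ct + Cx + 1))) by exact: nbhsx_ballx.
  apply: filterS => -[t' x'] [/=]; rewrite /ball/= => ht hx.
  rewrite (_ : phi t x - phi t' x' = (phi t x - phi t' x) + (phi t' x - phi t' x')); last by ring.
  rewrite (le_trans (ler_normD _ _))//.
  rewrite (@le_trans _ _ (Ct * (e / (Ct + Cx + 1)) + Cx * (e / (Ct + Cx + 1))))//.
    by rewrite lerD// (le_trans (lipt _ _ _), le_trans (lipx _ _ _))// ler_wpM2l// ltW.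
  rewrite -mulrDl mulrCA ler_piMr ?(ltW e0)// ler_pdivrMr ?mul1r ?lerDl//.
  by rewrite ltr_wpDl// addr_ge0.
have [C [C0 CP]] := bnd _ cphi (fun t x => sB0 t x).
have B00 : 0 <= B0 by rewrite addr_ge0.
pose B := B0 + Ct + Cx + C.
have BB0 : B0 <= B by rewrite /B; lra.
have wid t x : B < `|t| \/ B < `|x| -> B0 < `|t| \/ B0 < `|x|.
  by move=> [h|h]; [left|right]; exact: le_lt_trans h.
exists B; split=> //.
- by rewrite (le_trans B00).
- by move=> t x /wid /sB0.
- move=> t x; split; [|split].
  + by rewrite (le_trans (CP t x))// /B; lra.
  + by rewrite (le_trans (CtP t x))// /B; lra.
  + by rewrite (le_trans (CxP t x))// /B; lra.
- by split=> t x /wid h; [exact: dt_out|exact: dx_out].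
Unshelve. all: by end_near. Qed.

(* The backward paraboloid, on which finite speed of propagation is tested. *)
Definition parab (L A l t x : R) : R := L - A * (t + 1) ^+ 2 - (l * x) ^+ 2.

Lemma C1plane_parab L A l :
  C1plane (fun t x => possq (parab L A l t x))
    (fun t x => - 4 * A * (t + 1) * Num.max (parab L A l t x) 0)
    (fun t x => - 4 * l * (l * x) * Num.max (parab L A l t x) 0).
Proof.
have cp : continuous (fun z : R * R => parab L A l z.1 z.2).
  move=> z; apply: cvgB; first apply: cvgB; first exact: cvg_cst.
    apply: (continuous_fst_comp (f := fun t => A * (t + 1) ^+ 2)) => {}z.
    apply: cvgM; first exact: cvg_cst.
    apply: (@continuous_comp _ _ _ (fun t : R => t + 1) (fun t => t ^+ 2)); last exact: exprn_continuous.
    by apply: cvgD; [exact: cvg_id|exact: cvg_cst].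
  apply: (continuous_snd_comp (f := fun t => (l * t) ^+ 2)) => {}z.
  apply: (@continuous_comp _ _ _ (fun t : R => l * t) (fun t => t ^+ 2)); last exact: exprn_continuous.
  by apply: cvgM; [exact: cvg_cst|exact: cvg_id].
split.
- move=> t x.
  have h : is_derive t 1 (fun t => parab L A l t x) (- 2 * A * (t + 1)).
    by apply: is_derive_eq; rewrite /GRing.scale/=; ring.
  have h2 := @is_derive1_comp _ possq (fun t => parab L A l t x) t _ _ (is_derive_possq _) h.
  apply: (is_derive_eq h2).
  by ring.
- move=> t x.
  have h : is_derive x 1 (parab L A l t) (- 2 * l * (l * x)).
    by apply: is_derive_eq; rewrite /GRing.scale/=; ring.
  have h2 := @is_derive1_comp _ possq (parab L A l t) x _ _ (is_derive_possq _) h.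
  apply: (is_derive_eq h2).
  by ring.
- move=> z; apply: (@continuous_comp _ _ _ (fun z : R * R => parab L A l z.1 z.2) possq).
    exact: cp.
  exact: continuous_possq.
- move=> z; apply: cvgM; last exact: (continuous_maxr0 cp).
  apply: (continuous_fst_comp (f := fun t => - 4 * A * (t + 1))) => {}z.
  by apply: cvgM; [exact: cvg_cst|apply: cvgD; [exact: cvg_id|exact: cvg_cst]].
- move=> z; apply: cvgM; last exact: (continuous_maxr0 cp).
  apply: (continuous_snd_comp (f := fun t => - 4 * l * (l * t))) => {}z.
  by apply: cvgM; [exact: cvg_cst|apply: cvgM; [exact: cvg_cst|exact: cvg_id]].
Qed.

End calculus.

(** * Approximate entropy solutions *)

Section bounded_measurable.
Context d (T : measurableType d) (R : realType).
Implicit Types f g : T -> R.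

(** Bounds hold everywhere, not almost everywhere. The class is stable under sums and products, and
    a bounded support then gives integrability and Fubini at once. *)
Definition bmeas f := measurable_fun setT f /\ exists C : R, forall z, `|f z| <= C.

Lemma bmeas_cst (k : R) : bmeas (fun _ => k).
Proof. by split; [exact: measurable_cst|exists `|k|]. Qed.

Lemma bmeasD f g : bmeas f -> bmeas g -> bmeas (fun z => f z + g z).
Proof.
move=> [mf [C fC]] [mg [D gD]]; split; first exact: measurable_funD.
by exists (C + D) => z; rewrite (le_trans (ler_normD _ _))// lerD.
Qed.

Lemma bmeasM f g : bmeas f -> bmeas g -> bmeas (fun z => f z * g z).
Proof.
move=> [mf [C fC]] [mg [D gD]]; split; first exact: measurable_funM.
by exists (C * D) => z; rewrite normrM ler_pM.
Qed.

Lemma bmeasN f : bmeas f -> bmeas (fun z => - f z).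
Proof.
move=> [mf [C fC]]; split; first exact: measurable_funN.
by exists C => z; rewrite normrN.
Qed.

Lemma bmeasB f g : bmeas f -> bmeas g -> bmeas (fun z => f z - g z).
Proof. by move=> hf hg; apply: bmeasD => //; exact: bmeasN. Qed.

Lemma bmeas_norm f : bmeas f -> bmeas (fun z => `|f z|).
Proof.
move=> [mf [C fC]]; split; first exact: measurableT_comp.
by exists C => z; rewrite normr_id.
Qed.

Lemma bmeas_min f (k : R) : bmeas f -> bmeas (fun z => Num.min (f z) k).
Proof.
move=> [mf [C fC]]; split; first exact: measurable_minr.
exists (C + `|k|) => z; have := fC z; have := normr_ge0 (f z); have := normr_ge0 k.
by case: (leP (f z) k) => _; lra.
Qed.

Lemma bmeas_integrable (mu : {measure set T -> \bar R}) f (E : set T) :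
  measurable E -> (mu E < +oo)%E -> bmeas f -> (forall z, ~ E z -> f z = 0) ->
  mu.-integrable setT (EFin \o f).
Proof. by move=> mE muE [mf [C fC]] f0; exact: (bounded_supp_integrable mE muE mf fC). Qed.

End bounded_measurable.

Lemma bmeas_comp d d' (T : measurableType d) (S : measurableType d') (R : realType)
  (f : S -> R) (h : T -> S) : measurable_fun setT h -> bmeas f -> bmeas (f \o h).
Proof.
move=> mh [mf [C fC]]; split; first exact: measurableT_comp.
by exists C => z; exact: fC.
Qed.

(* A name for [mu \x mu]: canonical-structure inference does not find the
   sigma-finite structure of a product that is itself a factor of a product. *)
Definition lebesgue_plane (R : realType) : set (measurableTypeR R * measurableTypeR R) -> \bar R :=
  (@lebesgue_measure R \x @lebesgue_measure R)%E.

HB.instance Definition _ (R : realType) :=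
  Measure.copy (@lebesgue_plane R) (@lebesgue_measure R \x @lebesgue_measure R)%E.

Lemma lebesgue_plane_sigma_finite (R : realType) : sigma_finite setT (@lebesgue_plane R).
Proof.
have /sigma_finiteP[F [TF ndF Foo]] := sigma_finiteT (@lebesgue_measure R).
exists (fun n => F n `*` F n).
  rewrite -setXTT TF predeqE => -[x y]; split => [[/= [n _ Fx] [k _ Fy]]|].
    exists (maxn n k) => //; split.
    - by move: x Fx; exact/subsetPset/ndF/leq_maxl.
    - by move: y Fy; exact/subsetPset/ndF/leq_maxr.
  by move=> [n _ []/= ? ?]; split; exists n.
move=> k; have [mF Fk] := Foo k; split; first exact: measurableX.
rewrite [X in (X < _)%E](_ : _ = (@lebesgue_measure R (F k) * @lebesgue_measure R (F k))%E).
  by rewrite lte_mul_pinfty// ge0_fin_numE.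
by rewrite -product_measure1E.
Qed.

HB.instance Definition _ (R : realType) := Measure_isSigmaFinite.Build _ _ _
  (@lebesgue_plane R) (@lebesgue_plane_sigma_finite R).

Section half_plane_integrals.
Context {R : realType}.
Local Notation mu := (@lebesgue_measure R).
Local Notation pi := (@lebesgue_plane R).

Definition hline : set R := `[0, +oo[%classic.
Definition box (B : R) : set (R * R) := `[- B, B]%classic `*` `[- B, B]%classic.

Lemma measurable_box B : measurable (box B).
Proof. by apply: measurableX; exact: measurable_itv. Qed.

Lemma box_measure (B : R) : 0 <= B -> pi (box B) = ((2 * B) ^+ 2)%:E.
Proof.
move=> B0.
have -> : (pi (box B) = mu `[(- B)%R, B] * mu `[(- B)%R, B])%E.
  by rewrite -product_measure1E//; exact: measurable_itv.
rewrite lebesgue_measure_itv/= lte_fin.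
case: ltP => [_|h]; first by rewrite -EFinB -EFinM; congr (_%:E); ring.
by have -> : B = 0 by [lra]; rewrite mule0 mulr0 expr0n.
Qed.

Lemma box_fin (B : R) : (pi (box B) < +oo)%E.
Proof.
have [B0|B0] := leP 0 B; first by rewrite box_measure// ltry.
rewrite (_ : box B = set0) ?measure0//; apply/seteqP; split => // -[t x] [/=].
by rewrite !in_itv/=; lra.
Qed.

Lemma boxP (B t x : R) : box B (t, x) <-> `|t| <= B /\ `|x| <= B.
Proof. by rewrite /box/= !in_itv/= -!ler_norml; split. Qed.

Lemma not_boxP (B t x : R) : ~ box B (t, x) -> B < `|t| \/ B < `|x|.
Proof.
move=> h; have [tB|] := leP `|t| B; last by left.
by have [xB|] := leP `|x| B; [exfalso; apply: h; apply/boxP|right].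
Qed.

Lemma bmeas_hline : bmeas (\1_hline : R -> R).
Proof.
split; first by apply: measurable_indic; exact: measurable_itv.
by exists 1 => z; rewrite indicE normr_nat lern1 leq_b1.
Qed.

Lemma hline1 (t : R) : 0 <= t -> \1_hline t = 1 :> R.
Proof. by move=> t0; rewrite indicE mem_set// /hline/= in_itv/= t0. Qed.

Lemma hline0 (t : R) : t < 0 -> \1_hline t = 0 :> R.
Proof. by move=> t0; rewrite indicE memNset// /hline/= in_itv/= andbT; apply/negP; rewrite -ltNge. Qed.

(** The restriction to t >= 0 moves into the integrand as an indicator, so that Fubini is only
    needed on the whole plane. *)
Lemma iterated_half_plane (B : R) (F : R * R -> R) :
  bmeas F -> (forall z, ~ box B z -> F z = 0) ->
  (\int[mu]_(t in `[0%R, +oo[) \int[mu]_x (F (t, x))%:E =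
   \int[pi]_z (\1_hline z.1 * F z)%:E)%E.
Proof.
move=> bF F0.
have bHF : bmeas (fun z : R * R => \1_hline z.1 * F z).
  by apply: bmeasM => //; apply: (bmeas_comp (h := fst)) => //; exact: bmeas_hline.
have iHF : pi.-integrable setT (EFin \o (fun z : R * R => \1_hline z.1 * F z)).
  apply: (@bmeas_integrable _ _ _ pi _ _ (measurable_box B) (box_fin B) bHF) => z.
  by move=> /F0 ->; rewrite mulr0.
rewrite -[RHS](integral12_prod_meas1 iHF).
rewrite integral_mkcond; apply: eq_integral => t _; rewrite patchE.
case: ifPn => [|].
  rewrite inE/= in_itv/= andbT => t0.
  by apply: eq_integral => x _ /=; rewrite hline1// mul1r.
rewrite notin_setE/= in_itv/= andbT => /negP; rewrite -ltNge => t0.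
by apply/esym/integral0_eq => x _ /=; rewrite hline0// mul0r.
Qed.

End half_plane_integrals.

Section approximate_entropy_solutions.
Context {R : realType}.
Local Notation mu := (@lebesgue_measure R).
Local Notation pi := (@lebesgue_plane R).
Variables (c m : R).
Hypothesis c0 : 0 <= c.

(** The Kruzhkov entropy flux of [c * trunc m]: the truncation is nondecreasing, so the sign factor
    turns the difference into an absolute value. *)
Definition fluxdist (r k : R) : R := c * `|trunc m r - trunc m k|.

(** The error [eps] is uniform over a class of tests, with one [B] bounding the constants kappa, the
    support, the test function and its x-derivative. The t-derivative is left free because the
    nonlocal defect multiplies only phi and phi_x. *)
Definition approx_entropy (B eps : R) (rho0 : R -> R) (u : R -> R -> R) : Prop :=
  forall kappa phi, `|kappa| <= B -> test_function phi -> box_supported B phi ->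
    (forall t x, 0 <= t -> `|phi t x| <= B /\ `|derive1 (phi t) x| <= B) ->
  (0 <= (\int[mu]_(t in `[0%R, +oo[) \int[mu]_x
          (`|u t x - kappa| * derive1 (phi^~ x) t
           + fluxdist (u t x) kappa * derive1 (phi t) x)%R%:E)
       + \int[mu]_x (`|rho0 x - kappa| * phi 0 x)%R%:E + eps%:E)%E.

Lemma trunc_lip (r k : R) : `|trunc m r - trunc m k| <= `|r - k|.
Proof.
rewrite /trunc; wlog rk : r k / r <= k.
  by move=> W; have [/W//|/ltW/W] := leP r k; rewrite distrC (distrC r).
rewrite distrC (distrC r) !ger0_norm ?subr_ge0//; last first.
  by rewrite le_min !ge_min rk lexx orbT.
by case: (leP r m) => ?; case: (leP k m) => ?; lra.
Qed.

Lemma sg_trunc (r k : R) :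
  Num.sg (r - k) * (trunc m r - trunc m k) = `|trunc m r - trunc m k|.
Proof.
rewrite /trunc; have [rk|rk|->] := ltrgtP r k; last by rewrite !subrr mulr0 normr0.
  rewrite ltr0_sg ?subr_lt0// mulN1r ler0_norm//.
  by case: (leP r m) => ?; case: (leP k m) => ?; lra.
rewrite gtr0_sg ?subr_gt0// mul1r ger0_norm//.
by case: (leP r m) => ?; case: (leP k m) => ?; lra.
Qed.

Lemma fluxdist_ge0 r k : 0 <= fluxdist r k.
Proof. by rewrite mulr_ge0. Qed.

Lemma fluxdist_le r k : fluxdist r k <= c * `|r - k|.
Proof. by rewrite ler_wpM2l// trunc_lip. Qed.

Lemma fluxdistC r k : fluxdist r k = fluxdist k r.
Proof. by rewrite /fluxdist distrC. Qed.

Lemma approx_entropy_plane (B eps : R) rho0 (u : R -> R -> R) kappa phi pt px :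
  bmeas (fun z : R * R => u z.1 z.2) ->
  approx_entropy B eps rho0 u -> `|kappa| <= B ->
  C1plane phi pt px -> box_supported B phi ->
  (forall t x, 0 <= t -> 0 <= phi t x) ->
  (forall t x, 0 <= t -> `|phi t x| <= B /\ `|px t x| <= B) ->
  (0 <= \int[pi]_z (\1_hline z.1 * (`|u z.1 z.2 - kappa| * pt z.1 z.2
           + fluxdist (u z.1 z.2) kappa * px z.1 z.2))%R%:E
       + \int[mu]_x (`|rho0 x - kappa| * phi 0 x)%R%:E + eps%:E)%E.
Proof.
move=> bu au kB C1 sB p0 pB.
have [tphi et ex] := C1plane_test_function C1 sB p0.
have [B' [B'0 _ bnd [st sx] _]] := test_function_box tphi.
have bpt : bmeas (fun z : R * R => pt z.1 z.2).
  split; first by case: C1 => _ _ _ + _; exact: continuous_measurable_plane.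
  by exists B' => z; rewrite -et; exact: (bnd z.1 z.2).2.1.
have bpx : bmeas (fun z : R * R => px z.1 z.2).
  split; first by case: C1 => _ _ _ _; exact: continuous_measurable_plane.
  by exists B' => z; rewrite -ex; exact: (bnd z.1 z.2).2.2.
have bound' t x : 0 <= t -> `|phi t x| <= B /\ `|derive1 (phi t) x| <= B.
  by rewrite ex; exact: pB.
have := au _ _ kB tphi sB bound'.
under eq_integral => t _ do under eq_integral => x _ do rewrite et ex.
rewrite (@iterated_half_plane _ B' (fun z => `|u z.1 z.2 - kappa| * pt z.1 z.2
  + fluxdist (u z.1 z.2) kappa * px z.1 z.2))//.
  apply: bmeasD; apply: bmeasM => //.
    by apply: bmeas_norm; apply: bmeasB => //; exact: bmeas_cst.
  apply: bmeasM; first exact: bmeas_cst.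
  by apply: bmeas_norm; apply: bmeasB; [exact: bmeas_min|exact: bmeas_cst].
by move=> [t x] /not_boxP h /=; rewrite -et -ex st// sx// !mulr0 addr0.
Qed.

End approximate_entropy_solutions.

(** * Doubling of variables *)

Section fubini_bounded.
Local Open Scope ereal_scope.
Context d1 d2 (T1 : measurableType d1) (T2 : measurableType d2) (R : realType).
Variable m1 : {sigma_finite_measure set T1 -> \bar R}.
Variable m2 : {sigma_finite_measure set T2 -> \bar R}.

Lemma bmeas_fubini (f : T1 * T2 -> R) (E1 : set T1) (E2 : set T2) :
  measurable E1 -> measurable E2 -> m1 E1 < +oo -> m2 E2 < +oo ->
  bmeas f -> (forall x y, ~ (E1 x /\ E2 y) -> f (x, y) = 0%R) ->
  [/\ (m1 \x m2).-integrable setT (EFin \o f),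
      m1.-integrable setT (fun x => \int[m2]_y (f (x, y))%:E),
      m2.-integrable setT (fun y => \int[m1]_x (f (x, y))%:E),
      \int[m1]_x \int[m2]_y (f (x, y))%:E = \int[m1 \x m2]_z (f z)%:E &
      \int[m2]_y \int[m1]_x (f (x, y))%:E = \int[m1 \x m2]_z (f z)%:E].
Proof.
move=> mE1 mE2 fE1 fE2 bf f0.
have E12 : (m1 \x m2) (E1 `*` E2) < +oo.
  by rewrite product_measure1E// lte_mul_pinfty// ge0_fin_numE.
have intf : (m1 \x m2).-integrable setT (EFin \o f).
  apply: (@bmeas_integrable _ _ _ (m1 \x m2) _ _ (measurableX mE1 mE2) E12 bf).
  by move=> [x y] xy; exact: f0.
have sw : measurable_fun setT (fun p : T2 * T1 => (p.2, p.1)).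
  by apply: measurable_fun_pair.
have bf' : bmeas (f \o (fun p : T2 * T1 => (p.2, p.1))) by exact: bmeas_comp.
have E21 : (m2 \x m1) (E2 `*` E1) < +oo.
  by rewrite product_measure1E// lte_mul_pinfty// ge0_fin_numE.
have intf' : (m2 \x m1).-integrable setT (EFin \o (f \o (fun p : T2 * T1 => (p.2, p.1)))).
  apply: (@bmeas_integrable _ _ _ (m2 \x m1) _ _ (measurableX mE2 mE1) E21 bf').
  by move=> [x y] xy; apply: f0 => -[h1 h2]; apply: xy.
split=> //.
- exact: (integrable_fubini_F intf).
- exact: (integrable_fubini_F intf').
- exact: (integral12_prod_meas1 intf).
- exact: (integral21_prod_meas1 intf).
Qed.

End fubini_bounded.

Lemma bmeas_fst d1 d2 (T1 : measurableType d1) (T2 : measurableType d2) (R : realType)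
  (f : T1 -> R) : bmeas f -> bmeas (fun z : T1 * T2 => f z.1).
Proof. by move=> bf; apply: (bmeas_comp (h := fst)) => //. Qed.

Lemma bmeas_snd d1 d2 (T1 : measurableType d1) (T2 : measurableType d2) (R : realType)
  (f : T2 -> R) : bmeas f -> bmeas (fun z : T1 * T2 => f z.2).
Proof. by move=> bf; apply: (bmeas_comp (h := snd)) => //. Qed.

Arguments bmeas_fst {d1 d2 T1 T2 R f} _.
Arguments bmeas_snd {d1 d2 T1 T2 R f} _.

Section fubini_boxes.
Context {R : realType}.
Local Notation mu := (@lebesgue_measure R).
Local Notation pi := (@lebesgue_plane R).

Lemma itv_fin (B : R) : (mu `[(- B)%R, B]%classic < +oo)%E.
Proof. by rewrite lebesgue_measure_itv/=; case: ifP => // _; rewrite -EFinB ltry. Qed.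

Lemma bmeas_integrable_box (B : R) (f : R * R -> R) : bmeas f ->
  (forall z, ~ box B z -> f z = 0) -> pi.-integrable setT (EFin \o f).
Proof.
move=> bf f0.
exact: (@bmeas_integrable _ _ _ pi _ _ (measurable_box B) (box_fin B) bf f0).
Qed.

Lemma bmeas_fubini2 (B : R) (f : R * R -> R) : bmeas f ->
  (forall x y, ~ (`[- B, B]%classic x /\ `[- B, B]%classic y) -> f (x, y) = 0) ->
  [/\ pi.-integrable setT (EFin \o f),
      mu.-integrable setT (fun x => \int[mu]_y (f (x, y))%:E)%E,
      mu.-integrable setT (fun y => \int[mu]_x (f (x, y))%:E)%E,
      (\int[mu]_x \int[mu]_y (f (x, y))%:E = \int[pi]_z (f z)%:E)%E &
      (\int[mu]_y \int[mu]_x (f (x, y))%:E = \int[pi]_z (f z)%:E)%E].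
Proof.
by move=> bf f0; apply: (bmeas_fubini _ _ (itv_fin B) (itv_fin B) bf f0);
  exact: measurable_itv.
Qed.

Lemma bmeas_fubini3 (B : R) (f : R * (R * R) -> R) : bmeas f ->
  (forall x w, ~ (`[- B, B]%classic x /\ box B w) -> f (x, w) = 0) ->
  [/\ (mu \x pi)%E.-integrable setT (EFin \o f),
      mu.-integrable setT (fun x => \int[pi]_w (f (x, w))%:E)%E,
      pi.-integrable setT (fun w => \int[mu]_x (f (x, w))%:E)%E,
      (\int[mu]_x \int[pi]_w (f (x, w))%:E = \int[mu \x pi]_z (f z)%:E)%E &
      (\int[pi]_w \int[mu]_x (f (x, w))%:E = \int[mu \x pi]_z (f z)%:E)%E].
Proof.
move=> bf f0; have := (@bmeas_fubini _ _ (measurableTypeR R) (measurableTypeR R * measurableTypeR R)%type R (@lebesgue_measure R) (@lebesgue_plane R) f `[(- B)%R, B]%classic (box B)).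
apply.
- exact: measurable_itv.
- exact: measurable_box.
- exact: itv_fin.
- exact: box_fin.
- exact: bf.
- exact: f0.
Qed.

Lemma bmeas_fubini4 (B : R) (f : (R * R) * (R * R) -> R) : bmeas f ->
  (forall z w, ~ (box B z /\ box B w) -> f (z, w) = 0) ->
  [/\ (pi \x pi)%E.-integrable setT (EFin \o f),
      pi.-integrable setT (fun z => \int[pi]_w (f (z, w))%:E)%E,
      pi.-integrable setT (fun w => \int[pi]_z (f (z, w))%:E)%E,
      (\int[pi]_z \int[pi]_w (f (z, w))%:E = \int[pi \x pi]_p (f p)%:E)%E &
      (\int[pi]_w \int[pi]_z (f (z, w))%:E = \int[pi \x pi]_p (f p)%:E)%E].
Proof.
move=> bf f0; have := (@bmeas_fubini _ _ (measurableTypeR R * measurableTypeR R)%type (measurableTypeR R * measurableTypeR R)%type R (@lebesgue_plane R) (@lebesgue_plane R) f (box B) (box B)).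
apply.
- exact: measurable_box.
- exact: measurable_box.
- exact: box_fin.
- exact: box_fin.
- exact: bf.
- exact: f0.
Qed.

End fubini_boxes.

Section doubling.
Context {R : realType}.
Local Notation mu := (@lebesgue_measure R).
Local Notation pi := (@lebesgue_plane R).
Variables (c m M a b L P : R) (rho0 : R -> R).
(* [al] is a one-sided time kernel: with its support in [-3a, -a], the time of
   [v] lies after that of [u], so that only the inequality for [u] contributes an
   initial term. *)
Variables (al al' be be' : R -> R) (psi psit psix : R -> R -> R).
Hypotheses (c0 : 0 <= c) (a0 : 0 < a) (b0 : 0 < b).
Hypotheses (brho0 : bmeas rho0) (rho0M : forall x, `|rho0 x| <= M).
Hypotheses (alC1 : C1fun al al') (beC1 : C1fun be be').
Hypotheses (bal : bmeas al) (bal' : bmeas al') (bbe : bmeas be) (bbe' : bmeas be').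
Hypotheses (al0 : forall r, 0 <= al r) (be0 : forall r, 0 <= be r).
Hypothesis al_supp : forall r, r < - (3 * a) \/ - a < r -> al r = 0.
Hypothesis al'_supp : forall r, r < - (3 * a) \/ - a < r -> al' r = 0.
Hypothesis be_supp : forall r, b < `|r| -> be r = 0.
Hypothesis be'_supp : forall r, b < `|r| -> be' r = 0.
Hypothesis alM : forall r, al r <= a^-1.
Hypothesis psiC1 : C1plane psi psit psix.
Hypothesis psi_supp : box_supported L psi.
Hypothesis psit_supp : box_supported L psit.
Hypothesis psix_supp : box_supported L psix.
Hypothesis psi0 : forall t x, 0 <= psi t x.
Hypothesis psiP : forall x, psi 0 x <= P.
Hypothesis bpsi : bmeas (fun z : R * R => psi z.1 z.2).
Hypothesis bpsit : bmeas (fun z : R * R => psit z.1 z.2).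
Hypothesis bpsix : bmeas (fun z : R * R => psix z.1 z.2).
Hypothesis psi_cone : forall t x, 0 <= t -> c * `|psix t x| <= - psit t x.

Let ker (z w : R * R) := al (z.1 - w.1) * be (z.2 - w.2).
Let kert (z w : R * R) := al' (z.1 - w.1) * be (z.2 - w.2).
Let kerx (z w : R * R) := al (z.1 - w.1) * be' (z.2 - w.2).
Let G (z : R * R) := - psit z.1 z.2 - c * `|psix z.1 z.2|.

(** [G] is a lower bound for the rate at which the weight [psi] decreases along any path of speed at
    most [c]. As the kernels concentrate this becomes, up to their mass, the integral of G |u -
    v|. *)
Definition dissipation (u v : R -> R -> R) : \bar R :=
  (\int[pi \x pi]_p (\1_hline p.1.1 * (\1_hline p.2.1 *
    (`|u p.1.1 p.1.2 - v p.2.1 p.2.2| * (G p.1 * ker p.1 p.2))))%:E)%E.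

(** The L^1 oscillation of the datum at the scale of [be], weighted by [psi] at time 0. The factor
    10 is the one of the time cut-off in [trace_le]. *)
Definition modulus0 : \bar R :=
  (\int[mu]_x \int[mu]_y (10 * (psi 0 x * (`|rho0 y - rho0 x| * be (x - y))))%:E)%E.

Lemma diff_measurable (i j : R * R -> R) : measurable_fun setT i -> measurable_fun setT j ->
  measurable_fun setT (fun p : (R * R) * (R * R) => i p.1 - j p.2).
Proof. by move=> mi mj; apply: measurable_funB; apply: measurableT_comp. Qed.

Lemma bmeas_kernel (f g : R -> R) : bmeas f -> bmeas g ->
  bmeas (fun p : (R * R) * (R * R) => f (p.1.1 - p.2.1) * g (p.1.2 - p.2.2)).
Proof.
move=> bf bg; apply: bmeasM.
- by apply: (bmeas_comp (h := fun p : (R * R) * (R * R) => p.1.1 - p.2.1) _ bf); exact: (@diff_measurable fst fst).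
- by apply: (bmeas_comp (h := fun p : (R * R) * (R * R) => p.1.2 - p.2.2) _ bg); exact: (@diff_measurable snd snd).
Qed.

Lemma C1fun_shift f f' (s : R) : C1fun f f' ->
  C1fun (fun t => f (t - s)) (fun t => f' (t - s)).
Proof.
move=> /(C1fun_affine 1 (- s)).
rewrite (_ : (fun _ => f _) = (fun t => f (t - s))); last first.
  by apply/funext => t; rewrite mul1r.
rewrite (_ : (fun _ => 1 * _) = (fun t => f' (t - s)))//.
by apply/funext => t; rewrite !mul1r.
Qed.

Lemma C1fun_reflect f f' (t : R) : C1fun f f' ->
  C1fun (fun s => f (t - s)) (fun s => - f' (t - s)).
Proof.
move=> /(C1fun_affine (- 1) t).
rewrite (_ : (fun _ => f _) = (fun s => f (t - s))); last first.
  by apply/funext => s; rewrite mulN1r addrC.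
rewrite (_ : (fun _ => - 1 * _) = (fun s => - f' (t - s)))//.
by apply/funext => s; rewrite !mulN1r addrC.
Qed.

(** The inequality of [u] at z, with kappa = v(w) and test function psi(z) ker(z, w). In [F2] below
    it is the inequality of [v] at w, with kappa = u(z): there [psi] is a constant and the
    derivatives of the kernel change sign. [I0] is the initial term of the first one. *)
Let F1 (u v : R -> R -> R) (p : (R * R) * (R * R)) : R :=
  \1_hline p.2.1 * (\1_hline p.1.1 * (`|u p.1.1 p.1.2 - v p.2.1 p.2.2| *
      (psit p.1.1 p.1.2 * ker p.1 p.2 + psi p.1.1 p.1.2 * kert p.1 p.2)
    + fluxdist c m (u p.1.1 p.1.2) (v p.2.1 p.2.2) *
      (psix p.1.1 p.1.2 * ker p.1 p.2 + psi p.1.1 p.1.2 * kerx p.1 p.2))).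

Let F2 (u v : R -> R -> R) (p : (R * R) * (R * R)) : R :=
  \1_hline p.1.1 * (\1_hline p.2.1 * (`|v p.2.1 p.2.2 - u p.1.1 p.1.2| *
      (- (psi p.1.1 p.1.2 * kert p.1 p.2))
    + fluxdist c m (v p.2.1 p.2.2) (u p.1.1 p.1.2) *
      (- (psi p.1.1 p.1.2 * kerx p.1 p.2)))).

Let I0 (v : R -> R -> R) (p : R * (R * R)) : R :=
  \1_hline p.2.1 * (`|rho0 p.1 - v p.2.1 p.2.2| *
    (psi 0 p.1 * (al (0 - p.2.1) * be (p.1 - p.2.2)))).

Let psi_far (t x : R) : ~ box L (t, x) ->
  [/\ psi t x = 0, psit t x = 0 & psix t x = 0].
Proof.
by move=> /not_boxP h; split; [exact: psi_supp|exact: psit_supp|exact: psix_supp].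
Qed.

Variable B : R.
Hypothesis BL : L + 3 * a + b <= B.
Hypothesis BM : M <= B.
Hypothesis L0 : 0 <= L.
Hypothesis B1 : forall z w : R * R, `|psi z.1 z.2 * ker z w| <= B /\
  `|psix z.1 z.2 * ker z w + psi z.1 z.2 * kerx z w| <= B.
Hypothesis B2 : forall z w : R * R, `|psi z.1 z.2 * kerx z w| <= B.

Let BL' : L <= B. Proof. by have := a0; have := b0; have := BL; lra. Qed.

(** [psi] confines z to the box of size L, and the kernels confine w to within 3a of z in time and b
    in space; [BL] leaves room for both. *)
Let ker_far (z w : R * R) : ~ box B w ->
  [/\ psi z.1 z.2 * ker z w = 0, psit z.1 z.2 * ker z w = 0,
     psix z.1 z.2 * ker z w = 0, psi z.1 z.2 * kert z w = 0 &
     psi z.1 z.2 * kerx z w = 0].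
Proof.
case: z w => t x [s y] /= /not_boxP wB.
have [zL|zL] := pselect (box L (t, x)); last first.
  by have [-> -> ->] := psi_far zL; rewrite !mul0r.
move: zL => /boxP[tL xL]; rewrite /ker /kert /kerx /=.
case: wB => [sB|yB].
  have h : t - s < - (3 * a) \/ - a < t - s.
    have [s0|s0] := leP 0 s.
      by left; move: sB; rewrite ger0_norm// => sB; have := ler_norm t;
        have := BL; have := b0; lra.
    right; move: sB; rewrite ltr0_norm// => sB; have := ler_norm (- t); rewrite normrN.
    by have := BL; have := b0; have := a0; lra.
  by rewrite al_supp// al'_supp// !mul0r !mulr0.
have h : b < `|x - y|.
  have := ler_distD x y 0; rewrite !subr0 (distrC y).
  by have := BL; have := a0; lra.
by rewrite be_supp// be'_supp// !mulr0.
Qed.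

Lemma bmeas_fluxdist d (T : measurableType d) (f g : T -> R) : bmeas f -> bmeas g ->
  bmeas (fun z => fluxdist c m (f z) (g z)).
Proof.
move=> bf bg; apply: bmeasM; first exact: bmeas_cst.
by apply: bmeas_norm; apply: bmeasB; exact: bmeas_min.
Qed.

(** A bump centred at -a with radius 5a: it decreases on [0, 4a], vanishes afterwards, and is steep
    on [a, 3a], where al(0 - s) lives. *)
Let theta (s : R) : R := bump ((5 * a)^-1 * s + 5^-1).
Let theta' (s : R) : R := (5 * a)^-1 * dbump ((5 * a)^-1 * s + 5^-1).
Hypothesis B3 : forall x s y, `|10 * psi 0 x * (theta s * be (x - y))| <= B /\
  `|10 * psi 0 x * (theta s * be' (x - y))| <= B.
Hypothesis B6 : 6 * a <= B.
Variable Nb : R.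
Hypothesis be'N : forall r, `|be' r| <= Nb.

Let theta_far s : s < - (6 * a) \/ 4 * a < s -> theta s = 0.
Proof.
have ha := a0; move=> h; apply: bump_out.
rewrite [X in `|X|](_ : _ = (5 * a)^-1 * (s + a)); last by field; lra.
rewrite normrM gtr0_norm ?invr_gt0; last by lra.
rewrite ler_pdivlMl ?mulr1; last by lra.
by rewrite ler_normr; case: h => h; apply/orP; [right|left]; lra.
Qed.

Let theta_ge0 s : 0 <= theta s. Proof. exact: bump_ge0. Qed.
Let theta_le1 s : theta s <= 1. Proof. exact: bump_le1. Qed.

(** With r = s / a, the right side is (8/5) (r + 1) (1 - ((r + 1)/5)^2)_+ / a. Outside 1 <= r <= 3
    the left side vanishes; inside, it is at most 1/a and the right side is at least (8/5) 2 (9/25)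
    / a = (144/125) / a. This is where the factor 10 comes from. *)
Let theta'_le s : 0 <= s -> al (0 - s) <= - (10 * theta' s).
Proof.
move=> s0; rewrite /theta' /dbump.
have ai : 0 < a^-1 by rewrite invr_gt0.
have ea : (5 * a)^-1 * s + 5^-1 = (a^-1 * s + 1) / 5.
  by have := a0 => ?; field; lra.
rewrite ea; have asq : 0 <= a^-1 * s by rewrite mulr_ge0// ltW.
have -> : (5 * a)^-1 = a^-1 / 5 by rewrite invfM mulrC.
set r := a^-1 * s in asq *.
have mx : 0 <= Num.max (1 - ((r + 1) / 5) ^+ 2) 0 by rewrite le_max lexx orbT.
have [r1|r1] := ltP r 1.
  rewrite al_supp; last first.
    by right; move: r1; rewrite /r ltr_pdivrMl// mulr1 sub0r ltrN2.
    rewrite [X in 0 <= X](_ : _ = (8 / 5) * (a^-1 * (r + 1) * Num.max (1 - ((r + 1) / 5) ^+ 2) 0)).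
    by rewrite !mulr_ge0// ?ltW//; lra.
  by field; rewrite gt_eqF.
have [r3|r3] := ltP 3 r.
  rewrite al_supp; last first.
    by left; move: r3; rewrite /r ltr_pdivlMl// sub0r ltrN2 mulrC.
  rewrite [X in 0 <= X](_ : _ = (8 / 5) * (a^-1 * (r + 1) * Num.max (1 - ((r + 1) / 5) ^+ 2) 0)).
    by rewrite !mulr_ge0// ?ltW//; lra.
  by field; rewrite gt_eqF.
rewrite (le_trans (alM _))//.
have m2 : 9 / 25 <= Num.max (1 - ((r + 1) / 5) ^+ 2) 0.
  by rewrite le_max; apply/orP; left; nra.
rewrite [leRHS](_ : _ = a^-1 * ((8 / 5) * (r + 1) * Num.max (1 - ((r + 1) / 5) ^+ 2) 0)); last by field; rewrite gt_eqF.
rewrite -[leLHS]mulr1 ler_pM2l//.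
rewrite (@le_trans _ _ ((8 / 5) * 2 * (9 / 25)))//; first by lra.
by rewrite ler_pM//; lra.
Qed.

Section pair.
Variables (u v : R -> R -> R) (eps : R).
Hypotheses (bu : bmeas (fun z : R * R => u z.1 z.2)) (bv : bmeas (fun z : R * R => v z.1 z.2)).
Hypotheses (uM : forall t x, `|u t x| <= M) (vM : forall t x, `|v t x| <= M).
Hypotheses (au : approx_entropy c m B eps rho0 u) (av : approx_entropy c m B eps rho0 v).
Hypothesis eps0 : 0 <= eps.

Let bu4 : bmeas (fun p : (R * R) * (R * R) => u p.1.1 p.1.2).
Proof. exact: (bmeas_fst bu). Qed.
Let bv4 : bmeas (fun p : (R * R) * (R * R) => v p.2.1 p.2.2).
Proof. exact: (bmeas_snd bv). Qed.
Let bh1 : bmeas (fun p : (R * R) * (R * R) => \1_hline p.1.1 : R).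
Proof. exact: (bmeas_fst (bmeas_fst bmeas_hline)). Qed.
Let bh2 : bmeas (fun p : (R * R) * (R * R) => \1_hline p.2.1 : R).
Proof. exact: (bmeas_snd (bmeas_fst bmeas_hline)). Qed.
Let bker : bmeas (fun p : (R * R) * (R * R) => ker p.1 p.2).
Proof. exact: bmeas_kernel. Qed.
Let bkert : bmeas (fun p : (R * R) * (R * R) => kert p.1 p.2).
Proof. exact: bmeas_kernel. Qed.
Let bkerx : bmeas (fun p : (R * R) * (R * R) => kerx p.1 p.2).
Proof. exact: bmeas_kernel. Qed.
Let bp := bmeas_fst (T2 := (R * R)%type) bpsi.
Let bpt := bmeas_fst (T2 := (R * R)%type) bpsit.
Let bpx := bmeas_fst (T2 := (R * R)%type) bpsix.

Let bF1 : bmeas (F1 u v).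
Proof.
do 2 (apply: bmeasM => //); apply: bmeasD; apply: bmeasM.
- by apply: bmeas_norm; exact: bmeasB.
- by apply: bmeasD; apply: bmeasM.
- exact: bmeas_fluxdist.
- by apply: bmeasD; apply: bmeasM.
Qed.

Let bF2 : bmeas (F2 u v).
Proof.
do 2 (apply: bmeasM => //); apply: bmeasD; apply: bmeasM.
- by apply: bmeas_norm; exact: bmeasB.
- by apply: bmeasN; apply: bmeasM.
- exact: bmeas_fluxdist.
- by apply: bmeasN; apply: bmeasM.
Qed.

Let bI0 : bmeas (I0 v).
Proof.
apply: bmeasM; first exact: (bmeas_snd (bmeas_fst bmeas_hline)).
apply: bmeasM.
  by apply: bmeas_norm; apply: bmeasB; [exact: (bmeas_fst brho0)|exact: (bmeas_snd bv)].
apply: bmeasM.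
  have m0 : measurable_fun setT (fun x : R => (0 : R, x)) by exact: measurable_fun_pair.
  exact: (bmeas_fst (f := psi 0) (bmeas_comp m0 bpsi)).
apply: bmeasM.
  apply: (bmeas_comp (h := fun p : R * (R * R) => 0 - p.2.1) _ bal).
  by apply: measurable_funB => //; apply: measurableT_comp.
apply: (bmeas_comp (h := fun p : R * (R * R) => p.1 - p.2.2) _ bbe).
by apply: measurable_funB => //; apply: measurableT_comp.
Qed.

Let F1_supp z w : ~ (box B z /\ box B w) -> F1 u v (z, w) = 0.
Proof.
move=> /not_andP[zB|wB]; rewrite /F1/=.
  have [p1 p2 p3] : [/\ psi z.1 z.2 = 0, psit z.1 z.2 = 0 & psix z.1 z.2 = 0].
    apply: psi_far; case: z zB => t x /= /not_boxP h /boxP[h1 h2].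
    by have := BL'; case: h; lra.
  by rewrite p1 p2 p3 !mul0r !addr0 !mulr0 addr0 !mulr0.
by have [_ -> -> -> ->] := ker_far z wB; rewrite !addr0 !mulr0 addr0 !mulr0.
Qed.

Let F2_supp z w : ~ (box B z /\ box B w) -> F2 u v (z, w) = 0.
Proof.
move=> /not_andP[zB|wB]; rewrite /F2/=.
  have [p1 p2 p3] : [/\ psi z.1 z.2 = 0, psit z.1 z.2 = 0 & psix z.1 z.2 = 0].
    apply: psi_far; case: z zB => t x /= /not_boxP h /boxP[h1 h2].
    by have := BL'; case: h; lra.
  by rewrite p1 !mul0r !oppr0 !mulr0 addr0 !mulr0.
by have [_ _ _ -> ->] := ker_far z wB; rewrite !oppr0 !mulr0 addr0 !mulr0.
Qed.

Let I0_supp x w : ~ (`[- B, B]%classic x /\ box B w) -> I0 v (x, w) = 0.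
Proof.
move=> /not_andP[xB|wB]; rewrite /I0/=.
  rewrite psi_supp ?mul0r ?mulr0//; right; move: xB => /=.
  by rewrite in_itv/= -ler_norml => /negP; rewrite -ltNge; have := BL'; lra.
have [h _ _ _ _] := ker_far (0, x) wB; move: h; rewrite /ker/= => ->.
by rewrite !mulr0.
Qed.

Let B0 : 0 <= B. Proof. by have := BL'; have := L0; lra. Qed.

(** For w outside the box, or at a negative time, every term vanishes. Hence the error can be
    charged on the box only, which keeps it integrable in w. *)
Let step1 w : (0 <= \int[pi]_z (F1 u v (z, w))%:E + \int[mu]_x (I0 v (x, w))%:E
  + (eps * \1_(box B) w)%:E)%E.
Proof.
have zero : (forall z, F1 u v (z, w) = 0) -> (forall x, I0 v (x, w) = 0) ->
    (0 <= \int[pi]_z (F1 u v (z, w))%:E + \int[mu]_x (I0 v (x, w))%:E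
    + (eps * \1_(box B) w)%:E)%E.
  move=> h1 h2; rewrite integral0_eq; last by move=> z _; rewrite h1.
  rewrite integral0_eq; last by move=> z _; rewrite h2.
  by rewrite !add0e lee_fin mulr_ge0.
have [wB|wB] := pselect (box B w); last first.
  by apply: zero => [z|x]; [apply: F1_supp|apply: I0_supp] => -[].
have [s0|s0] := ltP w.1 0.
  by apply: zero => [z|x]; rewrite ?/F1 ?/I0/= hline0// mul0r.
rewrite indicE mem_set// mulr1.
have vB : `|v w.1 w.2| <= B by rewrite (le_trans (vM _ _)).
have C1 := C1planeM psiC1 (C1fun_shift w.1 alC1) (C1fun_shift w.2 beC1).
have sB : box_supported B (fun t x => psi t x * (al (t - w.1) * be (x - w.2))).
  move=> t x tx; rewrite psi_supp ?mul0r//.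
  by have := BL'; case: tx => h; [left|right]; lra.
have p0 (t x : R) : 0 <= t -> 0 <= psi t x * (al (t - w.1) * be (x - w.2)).
  by move=> _; rewrite !mulr_ge0.
have := approx_entropy_plane bu au vB C1 sB p0 (fun t x _ => B1 (t, x) w).
congr (_ <= _ + _ + _)%E; apply: eq_integral => z _.
  by rewrite /F1/= (hline1 s0) mul1r.
by rewrite /I0/= (hline1 s0) mul1r.
Qed.

Let step2 z : (0 <= \int[pi]_w (F2 u v (z, w))%:E + (eps * \1_(box B) z)%:E)%E.
Proof.
have zero : (forall w, F2 u v (z, w) = 0) ->
    (0 <= \int[pi]_w (F2 u v (z, w))%:E + (eps * \1_(box B) z)%:E)%E.
  move=> h1; rewrite integral0_eq; last by move=> w _; rewrite h1.
  by rewrite !add0e lee_fin mulr_ge0.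
have [zB|zB] := pselect (box B z); last first.
  by apply: zero => w; apply: F2_supp => -[].
have [t0|t0] := ltP z.1 0.
  by apply: zero => w; rewrite /F2/= hline0// mul0r.
rewrite indicE mem_set// mulr1.
have uB : `|u z.1 z.2| <= B by rewrite (le_trans (uM _ _)).
have C1 := C1planeM (C1plane_cst (psi z.1 z.2)) (C1fun_reflect z.1 alC1) (C1fun_reflect z.2 beC1).
have sB : box_supported B (fun s y => psi z.1 z.2 * (al (z.1 - s) * be (z.2 - y))).
  move=> s y tx; have wB : ~ box B (s, y) by move=> /boxP[]; case: tx; lra.
  by have [h _ _ _ _] := @ker_far z (s, y) wB.
have p0 (s y : R) : 0 <= s -> 0 <= psi z.1 z.2 * (al (z.1 - s) * be (z.2 - y)).
  by move=> _; rewrite !mulr_ge0.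
have bnd (s y : R) : 0 <= s -> `|psi z.1 z.2 * (al (z.1 - s) * be (z.2 - y))| <= B /\
    `|0 * (al (z.1 - s) * be (z.2 - y)) + psi z.1 z.2 * (al (z.1 - s) * - be' (z.2 - y))| <= B.
  move=> _; split; first exact: (B1 z (s, y)).1.
  by rewrite mul0r add0r !mulrN normrN; exact: (B2 z (s, y)).
have := approx_entropy_plane bv av uB C1 sB p0 bnd.
(* No initial term here: [al] vanishes to the right of -a, in particular at z.1 - 0 >= 0. *)
rewrite [X in (_ + X + _)%E]integral0_eq ?adde0; last first.
  move=> y _; rewrite al_supp ?mul0r ?mulr0//; right.
  by have := a0; lra.
congr (_ <= _ + _)%E; apply: eq_integral => w _.
by rewrite /F2/= (hline1 t0) mul1r !mul0r !add0r mulNr !mulrN.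
Qed.

Let ibox : pi.-integrable setT (fun z => (eps * \1_(box B) z)%:E).
Proof.
apply: (@bmeas_integrable _ _ _ pi _ _ (measurable_box B) (box_fin B)).
  apply: bmeasM; first exact: bmeas_cst.
  split; first exact: measurable_indic (measurable_box B).
  by exists 1 => z; rewrite indicE normr_nat lern1 leq_b1.
by move=> z zB; rewrite indicE memNset// mulr0.
Qed.

Let ibox_val : (\int[pi]_z (eps * \1_(box B) z)%:E = (eps * (2 * B) ^+ 2)%:E)%E.
Proof.
under eq_integral do rewrite EFinM.
have mI : measurable_fun setT (fun z => (\1_(box B) z : R)%:E).
  by apply/measurable_EFinP; exact: measurable_indic (measurable_box B).
rewrite ge0_integralZl ?lee_fin//.
have mB := measurable_box B.
by rewrite integral_indic// setIT EFinM; congr (_ * _)%E; exact: box_measure.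
Qed.

(** In the sum of the two inequalities the derivatives of the kernels cancel, since they depend on z
    - w only and |u - v| and [fluxdist] are symmetric. What is left carries derivatives of [psi],
    and [fluxdist] is at most c |u - v|. Each inequality contributes [eps] times the area (2B)^2 of
    the box. *)
Lemma dissipation_le_trace :
  (dissipation u v <= \int[mu]_x \int[pi]_w (I0 v (x, w))%:E
    + (2 * (eps * (2 * B) ^+ 2))%:E)%E.
Proof.
have [i1 _ j1 _ e1] := bmeas_fubini4 bF1 F1_supp.
have [i2 j2 _ e2 _] := bmeas_fubini4 bF2 F2_supp.
have [i0 _ j0 e0 e0'] := bmeas_fubini3 bI0 I0_supp.
have h1 : (0 <= \int[pi \x pi]_p (F1 u v p)%:E + \int[mu \x pi]_p (I0 v p)%:E
    + (eps * (2 * B) ^+ 2)%:E)%E.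
  rewrite -e1 -e0' -ibox_val -integralD// -integralD//; last exact: integrableD.
  by apply: integral_ge0 => w _; exact: step1.
have h2 : (0 <= \int[pi \x pi]_p (F2 u v p)%:E + (eps * (2 * B) ^+ 2)%:E)%E.
  rewrite -e2 -ibox_val -integralD//.
  by apply: integral_ge0 => w _; exact: step2.
have h3 : (dissipation u v <= - (\int[pi \x pi]_p (F1 u v p)%:E
    + \int[pi \x pi]_p (F2 u v p)%:E))%E.
  rewrite -integralD// -integralN/=; last first.
    exact: (integrable_add_def measurableT (integrableD measurableT i1 i2)).
  apply: ae_le_integral_nomeas; apply: aeW => -[[t x] [s y]] _ /=.
  rewrite lee_fin /F1 /F2 /G /=.
  have [t0|t0] := ltP t 0; first by rewrite !(hline0 t0); lra.
  have [s0|s0] := ltP s 0; first by rewrite !(hline0 s0); lra.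
  rewrite !hline1// !mul1r (fluxdistC c m (v s y)) (distrC (v s y)).
  have k0 : 0 <= al (t - s) * be (x - y) by rewrite mulr_ge0.
  have qle := fluxdist_le m c0 (u t x) (v s y).
  have q0 := fluxdist_ge0 m c0 (u t x) (v s y).
  have : fluxdist c m (u t x) (v s y) * psix t x <= c * `|u t x - v s y| * `|psix t x|.
    by rewrite (le_trans (ler_norm _))// normrM (ger0_norm q0) ler_wpM2r.
  move=> hq; have {}hq := mulr_ge0 k0 (etrans (subr_ge0 _ _) hq); rewrite -subr_ge0.
  rewrite /ker /kert /kerx /=; move: hq; congr (_ <= _); ring.
move: h1 h2 h3; rewrite e0.
have f1 := integrable_fin_num measurableT i1.
have f2 := integrable_fin_num measurableT i2.
have f0 := integrable_fin_num measurableT i0.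
rewrite -(fineK f1) -(fineK f2) -(fineK f0).
move: (dissipation u v) => D; rewrite -!EFinD !lee_fin => h1 h2 h3.
rewrite (le_trans h3)// -EFinN lee_fin; lra.
Qed.


(** Largest flux times the largest x-derivative of the cut-off test function times the area of
    [0, 4a] x [x - b, x + b]. For fixed [b] it is O(a). *)
Let C2 : R := c * (2 * M) * (10 * P * Nb) * (8 * a * b).

(* [v] need not have a trace at time 0: its inequality for [kappa = rho0 x] is
   tested instead against a time cut-off whose decay dominates [al]. *)
Lemma trace_le x : (\int[pi]_w (I0 v (x, w))%:E <=
  ((C2 + eps) * \1_(`[(- L)%R, L]%classic) x)%:E +
  \int[mu]_y (10 * (psi 0 x * (`|rho0 y - rho0 x| * be (x - y))))%:E)%E.
Proof.
have M0 : 0 <= M by rewrite (le_trans _ (rho0M 0)).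
have [xL|xL] := pselect (`[(- L)%R, L]%classic x); last first.
  have px : psi 0 x = 0.
    apply: psi_supp; right; move: xL => /=.
    by rewrite in_itv/= -ler_norml => /negP; rewrite -ltNge.
  rewrite integral0_eq; last by move=> w _; rewrite /I0/= px mul0r !mulr0.
  by rewrite indicE memNset// mulr0 add0e integral_ge0// => y _; rewrite px mul0r mulr0.
have {}xL : `|x| <= L by move: xL; rewrite /= in_itv/= -ler_norml.
rewrite indicE mem_set ?mulr1; last by rewrite /= in_itv/= -ler_norml.
have kB : `|rho0 x| <= B by rewrite (le_trans (rho0M _)).
(* The test function is 10 psi(0, x) theta(s) be(x - y), in the variables (s, y). *)
have C1 := C1planeM (C1plane_cst (10 * psi 0 x)) (C1fun_affine (5 * a)^-1 5^-1 C1fun_bump) (C1fun_reflect x beC1).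
have sB : box_supported B (fun s y => 10 * psi 0 x * (theta s * be (x - y))).
  move=> s y [sB|yB].
    rewrite theta_far ?mul0r ?mulr0//; move: sB; rewrite lter_normr => /orP[h|h]; have := B6; have := a0; [right|left]; lra.
  rewrite be_supp ?mulr0//; have := ler_distD x y 0; rewrite !subr0 (distrC y).
  by have := BL; have := a0; lra.
have p0 (s y : R) : 0 <= s -> 0 <= 10 * psi 0 x * (theta s * be (x - y)).
  by move=> _; apply: mulr_ge0; apply: mulr_ge0.
have bnd (s y : R) : 0 <= s -> `|10 * psi 0 x * (theta s * be (x - y))| <= B /\
    `|0 * (theta s * be (x - y)) + 10 * psi 0 x * (theta s * - be' (x - y))| <= B.
  move=> _; split; first exact: (B3 x s y).1.
  by rewrite mul0r add0r !mulrN normrN; exact: (B3 x s y).2.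
have := approx_entropy_plane bv av kB C1 sB p0 bnd.
set K := fun w : R * R => \1_hline w.1 * (`|v w.1 w.2 - rho0 x| *
   (0 * (theta w.1 * be (x - w.2)) + 10 * psi 0 x * (theta' w.1 * be (x - w.2)))
   + fluxdist c m (v w.1 w.2) (rho0 x) *
   (0 * (theta w.1 * be (x - w.2)) + 10 * psi 0 x * (theta w.1 * - be' (x - w.2)))).
move=> hK.
have bK : bmeas K.
  have bth (f : R -> R) : bmeas f -> bmeas (fun w : R * R => f w.1) by exact: bmeas_fst.
  have bbx (f : R -> R) : bmeas f -> bmeas (fun w : R * R => f (x - w.2)).
    move=> bf; apply: (bmeas_comp (h := fun w : R * R => x - w.2) _ bf).
    by apply: measurable_funB.
  have Ctheta : C1fun theta theta' := C1fun_affine (5 * a)^-1 5^-1 C1fun_bump.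
  have btheta : bmeas theta.
    split; first exact: continuous_measurable_fun (C1fun_continuous Ctheta).
    by exists 1 => r; rewrite ger0_norm.
  have btheta' : bmeas theta'.
    split; first exact: continuous_measurable_fun Ctheta.2.
    by exists (`|(5 * a)^-1| * 4) => r; rewrite normrM ler_wpM2l// dbump_le4.
  apply: bmeasM; first exact: (bmeas_fst bmeas_hline).
  apply: bmeasD; apply: bmeasM.
  - by apply: bmeas_norm; apply: bmeasB => //; exact: bmeas_cst.
  - apply: bmeasD; apply: bmeasM; try exact: bmeas_cst.
    + by apply: bmeasM; [exact: bth|exact: bbx].
    + by apply: bmeasM; [exact: bth|exact: bbx].
  - by apply: bmeas_fluxdist => //; exact: bmeas_cst.
  - apply: bmeasD; apply: bmeasM; try exact: bmeas_cst.
    + by apply: bmeasM; [exact: bth|exact: bbx].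
    + by apply: bmeasM; [exact: bth|apply: bmeasN; exact: bbx].
have K_supp w : ~ box B w -> K w = 0.
  case: w => s y wB; have /not_boxP[sfar|yfar] := wB; rewrite /K/=.
    have [s0|s0] := ltP s 0; first by rewrite hline0// mul0r.
    have sf : 1 <= `|(5 * a)^-1 * s + 5^-1|.
      have ha := a0; rewrite [X in `|X|](_ : _ = (5 * a)^-1 * (s + a)); last by field; lra.
      rewrite normrM gtr0_norm ?invr_gt0; last by lra.
      rewrite ler_pdivlMl ?mulr1; last by lra.
      by rewrite ler_normr; move: sfar; rewrite ger0_norm// => sfar; apply/orP; left; have := B6; lra.
    have -> : theta s = 0 by exact: bump_out.
    have -> : theta' s = 0.
      rewrite /theta' /dbump max_r ?mulr0//.
      by rewrite subr_le0 -real_normK ?num_real// exprn_ege1.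
    by rewrite !mul0r !mulr0 !addr0 !mulr0 addr0 mulr0.
  have h : b < `|x - y|.
    have := ler_distD x y 0; rewrite !subr0 (distrC y).
    by have := BL; have := a0; lra.
  by rewrite be_supp// be'_supp// oppr0 !mulr0 !addr0 !mulr0 addr0 mulr0.
have iK := bmeas_integrable_box bK K_supp.
have bI : bmeas (fun w => I0 v (x, w)) .
  have mx : measurable_fun setT (fun w : R * R => (x, w)) by exact: measurable_fun_pair.
  exact: (bmeas_comp mx bI0).
have iI := bmeas_integrable_box bI
  (fun w wB => I0_supp (fun h => wB h.2)).
pose E : set (R * R) := `[0, 4 * a]%classic `*` `[x - b, x + b]%classic.
have mE : measurable E by apply: measurableX; exact: measurable_itv.
have muE : pi E = (8 * a * b)%:E.
  have -> : (pi E = mu `[0%R, (4 * a)%R] * mu `[(x - b)%R, (x + b)%R])%E.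
    by rewrite -product_measure1E//; exact: measurable_itv.
  rewrite !lebesgue_measure_itv/= !lte_fin ifT; last by have := a0; lra.
  rewrite ifT; last by have := b0; lra.
  by rewrite -!EFinB -EFinM; congr (_%:E); ring.
have P0 : 0 <= P by rewrite (le_trans (psi0 0 0)).
have Nb0 : 0 <= Nb by rewrite (le_trans _ (be'N 0)).
have hIK : (\int[pi]_w (I0 v (x, w))%:E + \int[pi]_w (K w)%:E <= C2%:E)%E.
  rewrite -integralD//= (@le_trans _ _ ((c * (2 * M) * (10 * P * Nb))%:E * pi E)%E)//; last first.
    by rewrite muE -EFinM.
  (* By [theta'_le] the time derivative in [K] outweighs [I0], so only the flux part of [K]
     survives. *)
  have key s y : 0 <= s -> I0 v (x, (s, y)) + K (s, y) <=
      fluxdist c m (v s y) (rho0 x) * (10 * psi 0 x * (theta s * `|be' (x - y)|)).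
    move=> s0; rewrite /I0 /K/= hline1// !mul1r !mul0r !add0r distrC.
    have h1 : `|v s y - rho0 x| * (psi 0 x * (be (x - y) * (al (0 - s) + 10 * theta' s))) <= 0.
      rewrite mulr_ge0_le0// mulr_ge0_le0// mulr_ge0_le0//.
      by have := theta'_le s0; lra.
    have h2 : fluxdist c m (v s y) (rho0 x) * (10 * psi 0 x * (theta s * - be' (x - y))) <=
        fluxdist c m (v s y) (rho0 x) * (10 * psi 0 x * (theta s * `|be' (x - y)|)).
      rewrite ler_wpM2l ?fluxdist_ge0// ler_wpM2l ?mulr_ge0// ler_wpM2l//.
      by rewrite (le_trans (ler_norm _))// normrN.
    by move: h1 h2; rewrite !sub0r; lra.
  have neg s y : s < 0 -> I0 v (x, (s, y)) + K (s, y) = 0.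
    by move=> s0; rewrite /I0 /K/= hline0// !mul0r addr0.
  have bd0 : 0 <= c * (2 * M) * (10 * P * Nb) by rewrite !mulr_ge0.
  under eq_integral => w _ do rewrite -EFinD.
  apply: (@integral_le_cst_supp _ _ _ pi (fun w => I0 v (x, w) + K w)) => // -[s y].
    move=> _; have [s0|s0] := ltP s 0; first by rewrite neg.
    have q1 : fluxdist c m (v s y) (rho0 x) <= c * (2 * M).
      rewrite (le_trans (fluxdist_le m c0 _ _))// ler_wpM2l//.
      rewrite (le_trans (ler_normB _ _))//.
      by have := vM s y; have := rho0M x; lra.
    have q2 : 10 * psi 0 x * (theta s * `|be' (x - y)|) <= 10 * P * Nb.
      apply: ler_pM; [exact: mulr_ge0|exact: mulr_ge0|exact: ler_wpM2l|].
      by rewrite -[leRHS]mul1r; apply: ler_pM.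
    rewrite (le_trans (key _ _ s0))//; apply: ler_pM => //.
      exact: fluxdist_ge0.
    by apply: mulr_ge0; apply: mulr_ge0.
  have [s0|s0] := ltP s 0; first by rewrite neg.
  move=> wE; rewrite (le_trans (key _ _ s0))//.
  have [sa|sa] := ltP (4 * a) s; first by rewrite theta_far ?mul0r ?mulr0//; right.
  have [xy|xy] := ltP b `|x - y|; first by rewrite be'_supp// normr0 !mulr0.
  exfalso; apply: wE; split => /=; rewrite in_itv/= ?s0 ?sa//.
  by move: xy; rewrite ler_norml => /andP[? ?]; apply/andP; split; lra.
(* The initial term of the cut-off inequality is the oscillation of the datum, because the cut-off
   is at most 1 at time 0. *)
have hR : (\int[mu]_y (`|rho0 y - rho0 x| * (10 * psi 0 x * (bump ((5 * a)^-1 * 0 + 5^-1) * be (x - y))))%:E <=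
    \int[mu]_y (10 * (psi 0 x * (`|rho0 y - rho0 x| * be (x - y))))%:E)%E.
  apply: ae_le_integral_nomeas; apply: aeW => y _; rewrite lee_fin.
  rewrite [leRHS](_ : _ = `|rho0 y - rho0 x| * (10 * psi 0 x * (1 * be (x - y)))); last by ring.
  by rewrite ler_wpM2l// ler_wpM2l ?mulr_ge0// ler_wpM2r// bump_le1.
have fI := integrable_fin_num measurableT iI.
have fK := integrable_fin_num measurableT iK.
move: hK hIK hR; rewrite -/(integral _ _ _) => hK hIK hR.
have {}hK : (0 <= \int[pi]_w (K w)%:E + \int[mu]_y (`|rho0 y - rho0 x| *
    (10 * psi 0 x * (bump ((5 * a)^-1 * 0 + 5^-1) * be (x - y))))%:E + eps%:E)%E := hK.
move: hK hIK hR; rewrite -(fineK fI) -(fineK fK).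
move: (fine (\int[pi]_x0 (EFin \o (fun w => I0 v (x, w))) x0)%E) => i.
move: (fine (\int[pi]_x0 (EFin \o K) x0)%E) => k.
move: (\int[mu]_y _)%E => J; move: (\int[mu]_y _)%E => J'.
case: J => [j| |]; case: J' => [j'| |] //=; rewrite -?EFinD ?lee_fin ?addey ?leey//; lra.
Qed.



Lemma dissipation_le : (dissipation u v <=
  ((C2 + eps) * (2 * L) + 2 * (eps * (2 * B) ^+ 2))%:E + modulus0)%E.
Proof.
suff tr : (\int[mu]_x \int[pi]_w (I0 v (x, w))%:E <= ((C2 + eps) * (2 * L))%:E + modulus0)%E.
  by rewrite EFinD addeAC; apply: (le_trans dissipation_le_trace); exact: leeD tr _.
have M0 : 0 <= M by rewrite (le_trans _ (rho0M 0)).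
have P0 : 0 <= P by rewrite (le_trans (psi0 0 0)).
have Nb0 : 0 <= Nb by rewrite (le_trans _ (be'N 0)).
have C20 : 0 <= C2 + eps.
  by rewrite addr_ge0// !mulr_ge0// ?(ltW a0)// (ltW b0).
apply: (@le_trans _ _ (\int[mu]_x (((C2 + eps) * \1_(`[(- L)%R, L]%classic) x)%:E +
  \int[mu]_y (10 * (psi 0 x * (`|rho0 y - rho0 x| * be (x - y))))%:E))%E).
  by apply: ae_le_integral_nomeas; apply: aeW => x _; exact: trace_le.
have mI : measurable_fun setT (fun z : R => (\1_(`[(- L)%R, L]%classic) z : R)%:E).
  by apply/measurable_EFinP; apply: measurable_indic; exact: measurable_itv.
have nn (x y : R) : (0 <= (10 * (psi 0 x * (`|rho0 y - rho0 x| * be (x - y))))%:E)%E.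
  by rewrite lee_fin; do 3 (apply: mulr_ge0 => //).
rewrite ge0_integralD//=; last 4 first.
- by move=> x _; rewrite lee_fin mulr_ge0.
- under eq_fun do rewrite EFinM.
  by apply: measurable_funeM.
- by move=> x _; apply: integral_ge0 => y _; exact: nn.
- have bf : bmeas (fun p : R * R => 10 * (psi 0 p.1 * (`|rho0 p.2 - rho0 p.1| * be (p.1 - p.2)))).
    apply: bmeasM; first exact: bmeas_cst.
    apply: bmeasM.
      have m0 : measurable_fun setT (fun x : R => (0 : R, x)) by exact: measurable_fun_pair.
      exact: (bmeas_fst (f := psi 0) (bmeas_comp m0 bpsi)).
    apply: bmeasM.
      by apply: bmeas_norm; apply: bmeasB; [exact: (bmeas_snd brho0)|exact: (bmeas_fst brho0)].
    apply: (bmeas_comp (h := fun p : R * R => p.1 - p.2) _ bbe).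
    by apply: measurable_funB.
  have fsupp (x y : R) : ~ (`[- B, B]%classic x /\ `[- B, B]%classic y) ->
      10 * (psi 0 x * (`|rho0 y - rho0 x| * be (x - y))) = 0.
    move=> xy; have [xL|xL] := leP `|x| L; last first.
      by rewrite psi_supp ?mul0r ?mulr0//; right.
    rewrite be_supp ?mulr0// ltNge; apply/negP => xyb; apply: xy.
    rewrite /= !in_itv/= -!ler_norml; have := ler_distD x y 0; rewrite !subr0 (distrC y).
    by have := BL; have := a0; have := b0; split; lra.
  by have [_ iM _ _ _] := bmeas_fubini2 bf fsupp; exact: measurable_int iM.
apply: leeD => //.
under eq_integral do rewrite EFinM.
rewrite ge0_integralZl ?lee_fin//.
have mIL : measurable (`[(- L)%R, L]%classic : set R) by exact: measurable_itv.
have muL : (mu `[(- L)%R, L]%classic = (2 * L)%:E)%E.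
  rewrite lebesgue_measure_itv/= lte_fin; case: ltP => h.
    by rewrite -EFinB; congr (_%:E); ring.
  by congr (_%:E); have := L0; lra.
rewrite integral_indic// setIT [leRHS]EFinM.
by rewrite le_eqVlt; apply/orP; left; apply/eqP; congr (_ * _)%E; exact: muL.
Qed.

End pair.

Hypothesis al_low : forall r, `|r + 2 * a| <= a / 2 -> (2 * a)^-1 <= al r.
Hypothesis be_low : forall r, `|r| <= b / 2 -> (2 * b)^-1 <= be r.

Let D4 (u v : R -> R -> R) (p : (R * R) * (R * R)) : R :=
  \1_hline p.1.1 * (\1_hline p.2.1 *
    (`|u p.1.1 p.1.2 - v p.2.1 p.2.2| * (G p.1 * ker p.1 p.2))).


Let G_ge0 z : 0 <= z.1 -> 0 <= G z.
Proof. by move=> /(psi_cone z.2); rewrite /G; lra. Qed.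

Let D4_ge0 u v p : 0 <= D4 u v p.
Proof.
case: p => [[t x] w]; rewrite /D4/=.
have [t0|t0] := ltP t 0; first by rewrite hline0// mul0r.
rewrite mulr_ge0// mulr_ge0// mulr_ge0// mulr_ge0//; first exact: G_ge0.
by rewrite mulr_ge0.
Qed.

Let bG : bmeas G.
Proof.
apply: bmeasB; first exact: bmeasN.
by apply: bmeasM; [exact: bmeas_cst|exact: bmeas_norm].
Qed.

Let bD4 u v : bmeas (fun z : R * R => u z.1 z.2) -> bmeas (fun z : R * R => v z.1 z.2) ->
  bmeas (D4 u v).
Proof.
move=> bu bv.
apply: bmeasM; first exact: (bmeas_fst (bmeas_fst bmeas_hline)).
apply: bmeasM; first exact: (bmeas_snd (bmeas_fst bmeas_hline)).
apply: bmeasM; last first.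
  by apply: bmeasM; [exact: (bmeas_fst bG)|exact: bmeas_kernel].
by apply: bmeas_norm; apply: bmeasB; [exact: (bmeas_fst bu)|exact: (bmeas_snd bv)].
Qed.

Let D4_supp u v z w : ~ (box B z /\ box B w) -> D4 u v (z, w) = 0.
Proof.
move=> h; have -> : D4 u v (z, w) = \1_hline z.1 * (\1_hline w.1 * (`|u z.1 z.2 - v w.1 w.2| *
    (- (psit z.1 z.2 * ker z w) - c * (`|psix z.1 z.2| * ker z w)))).
  by rewrite /D4 /G/=; ring.
move: h => /not_andP[zB|wB].
  have [p1 p2 p3] : [/\ psi z.1 z.2 = 0, psit z.1 z.2 = 0 & psix z.1 z.2 = 0].
    apply: psi_far; case: z zB => t x /= /not_boxP h /boxP[h1 h2].
    by have := BL'; case: h; lra.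
  by rewrite p2 p3 normr0 !mul0r oppr0 mulr0 subr0 !mulr0.
have [_ -> kx _ _] := ker_far z wB.
have k0 : 0 <= ker z w by rewrite mulr_ge0.
have -> : `|psix z.1 z.2| * ker z w = 0.
  by rewrite -(ger0_norm k0) -normrM kx normr0.
by rewrite oppr0 mulr0 subr0 !mulr0.
Qed.

(** The triangle inequality through v(w), averaged over w in a rectangle of area ab on which the
    kernel is at least 1/(4ab). The lower bound 4 on [G] absorbs the factor 1/4, so no limit in the
    scales is taken. *)
Lemma L1_le_dissipation (u v : R -> R -> R) (D : set (R * R)) :
  bmeas (fun z : R * R => u z.1 z.2) -> bmeas (fun z : R * R => v z.1 z.2) ->
  measurable D -> D `<=` [set z | 0 <= z.1 /\ 4 <= G z] ->
  (\int[pi]_(z in D) `|u z.1 z.2 - v z.1 z.2|%:E <= dissipation u v + dissipation v v)%E.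
Proof.
move=> bu bv mD DG.
have [i1 j1 _ e1 _] := bmeas_fubini4 (bD4 bu bv) (@D4_supp u v).
have [i2 j2 _ e2 _] := bmeas_fubini4 (bD4 bv bv) (@D4_supp v v).
rewrite /dissipation -/(D4 u v) -e1 -e2 -integralD// [leLHS]integral_mkcond.
apply: ae_le_integral_nomeas; apply: aeW => -[t x] _; rewrite patchE.
have nn (f g : R -> R -> R) (w : R * R) : (0 <= (D4 f g ((t, x), w))%:E)%E.
  by rewrite lee_fin.
have mD4 (f g : R -> R -> R) : bmeas (fun z : R * R => f z.1 z.2) -> bmeas (fun z : R * R => g z.1 z.2) ->
    measurable_fun setT (fun w => (D4 f g ((t, x), w))%:E).
  move=> bf bg; apply/measurable_EFinP.
  have mz : measurable_fun setT (fun w : R * R => ((t, x), w)) by exact: measurable_fun_pair.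
  exact: (bmeas_comp mz (bD4 bf bg)).1.
case: ifPn => [|_]; last by rewrite adde_ge0// integral_ge0.
rewrite inE => /DG[/= t0 G4].
rewrite -ge0_integralD//; [|exact: mD4|exact: mD4].
(* Centred at (t + 2a, x) because the time kernel is centred at -2a; all its times are nonnegative
   when t is. *)
pose E : set (R * R) := `[t + 3 * a / 2, t + 5 * a / 2]%classic `*` `[x - b / 2, x + b / 2]%classic.
have mE : measurable E by apply: measurableX; exact: measurable_itv.
have muE : pi E = (a * b)%:E.
  have -> : (pi E = mu `[(t + 3 * a / 2)%R, (t + 5 * a / 2)%R] * mu `[(x - b / 2)%R, (x + b / 2)%R])%E.
    by rewrite -product_measure1E//; exact: measurable_itv.
  rewrite !lebesgue_measure_itv/= !lte_fin ifT; last by have := a0; lra.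
  rewrite ifT; last by have := b0; lra.
  by rewrite -!EFinB -EFinM; congr (_%:E); lra.
have ab0 : 0 < a * b by rewrite mulr_gt0.
have -> : `|u t x - v t x|%:E = (\int[pi]_(w in E) (cst (`|u t x - v t x| / (a * b))%:E) w)%E.
  transitivity ((`|u t x - v t x| / (a * b))%:E * pi E)%E; last by rewrite integral_cst.
  by rewrite muE -EFinM divfK ?lt0r_neq0.
rewrite [leLHS]integral_mkcond; apply: ae_le_integral_nomeas; apply: aeW => -[s y] _; rewrite patchE.
case: ifPn => [|_]; last by rewrite adde_ge0.
rewrite inE => -[/=]; rewrite !in_itv/= => /andP[s1 s2] /andP[y1 y2].
rewrite -EFinD lee_fin /D4/= !hline1//; last by have := a0; lra.
rewrite !mul1r -mulrDl.
have kge : 4^-1 / (a * b) <= ker (t, x) (s, y).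
  rewrite /ker /= (_ : 4^-1 / (a * b) = (2 * a)^-1 * (2 * b)^-1); last first.
    by field; rewrite !lt0r_neq0.
  apply: ler_pM; rewrite ?invr_ge0 ?mulr_ge0 ?(ltW a0) ?(ltW b0)//.
    by apply: al_low; rewrite ler_norml; apply/andP; split; lra.
  by apply: be_low; rewrite ler_norml; apply/andP; split; lra.
have Gk : (a * b)^-1 <= G (t, x) * ker (t, x) (s, y).
  rewrite (_ : (a * b)^-1 = 4 * (4^-1 / (a * b))); last by field; rewrite !lt0r_neq0.
  by apply: ler_pM => //; rewrite mulr_ge0// invr_ge0 ltW.
apply: ler_pM => //; first by rewrite invr_ge0 ltW.
by rewrite (distrC (v t x)) ler_distD.
Qed.

End doubling.

Lemma ae_mono d (T : measurableType d) (R : realType) (mu : set T -> \bar R) (P Q : T -> Prop) :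
  (forall x, P x -> Q x) -> {ae mu, forall x, P x} -> {ae mu, forall x, Q x}.
Proof.
move=> PQ [N [mN N0 PN]]; exists N; split=> // x nQ; apply: PN => Px.
exact/nQ/PQ.
Qed.

Lemma ae_and d (T : measurableType d) (R : realType) (mu : {measure set T -> \bar R}) (P Q : T -> Prop) :
  {ae mu, forall x, P x} -> {ae mu, forall x, Q x} -> {ae mu, forall x, P x /\ Q x}.
Proof. exact: filterI. Qed.

Lemma cvge_eventually_lt (R : realType) (u : (\bar R)^nat) (l y : \bar R) :
  u @ \oo --> l -> (l < y)%E -> \forall n \near \oo, (u n < y)%E.
Proof. by move=> ul ly; exact: (ul _ (open_ereal_lt' ly)). Qed.

(** * Concrete doubling kernels and the oscillation of the initial datum *)

Section kernels.
Context {R : realType}.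
Local Notation mu := (@lebesgue_measure R).
Local Notation pi := (@lebesgue_plane R).
Implicit Types a b r : R.

Definition space_kernel b r : R := b^-1 * bump (b^-1 * r + 0).
Definition dspace_kernel b r : R := b^-1 * (b^-1 * dbump (b^-1 * r + 0)).
(** The shift by 2 centres the bump at -2a with radius a, so that the support is [-3a, -a]. *)
Definition time_kernel a r : R := a^-1 * bump (a^-1 * r + 2).
Definition dtime_kernel a r : R := a^-1 * (a^-1 * dbump (a^-1 * r + 2)).

Lemma C1fun_bmeas (f f' : R -> R) (C : R) : C1fun f f' -> (forall r, `|f r| <= C) -> bmeas f.
Proof.
move=> h fC; split; last by exists C.
exact: continuous_measurable_fun (C1fun_continuous h).
Qed.

Lemma C1fun_bmeas' (f f' : R -> R) (C : R) : C1fun f f' -> (forall r, `|f' r| <= C) -> bmeas f'.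
Proof.
by move=> h fC; split; [exact: continuous_measurable_fun h.2|exists C].
Qed.

Lemma C1fun_space_kernel b : C1fun (space_kernel b) (dspace_kernel b).
Proof. exact: (C1funZ b^-1 (C1fun_affine b^-1 0 C1fun_bump)). Qed.

Lemma C1fun_time_kernel a : C1fun (time_kernel a) (dtime_kernel a).
Proof. exact: (C1funZ a^-1 (C1fun_affine a^-1 2 C1fun_bump)). Qed.

Lemma dbump_out r : 1 <= `|r| -> dbump r = 0.
Proof.
move=> r1; rewrite /dbump max_r ?mulr0//.
by rewrite subr_le0 -real_normK ?num_real// exprn_ege1.
Qed.

Section positive.
Variables (a b : R).
Hypotheses (a0 : 0 < a) (b0 : 0 < b).

Lemma space_kernel_ge0 r : 0 <= space_kernel b r.
Proof. by rewrite mulr_ge0 ?bump_ge0// invr_ge0 ltW. Qed.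

Lemma space_kernel_le r : space_kernel b r <= b^-1.
Proof. by rewrite ler_piMr ?bump_le1// invr_ge0 ltW. Qed.

Lemma time_kernel_ge0 r : 0 <= time_kernel a r.
Proof. by rewrite mulr_ge0 ?bump_ge0// invr_ge0 ltW. Qed.

Lemma time_kernel_le r : time_kernel a r <= a^-1.
Proof. by rewrite ler_piMr ?bump_le1// invr_ge0 ltW. Qed.

Lemma dspace_kernel_le r : `|dspace_kernel b r| <= b^-1 * (b^-1 * 4).
Proof.
have bi : 0 <= b^-1 by rewrite invr_ge0 ltW.
by rewrite /dspace_kernel 2!normrM (ger0_norm bi) ler_wpM2l// ler_wpM2l// dbump_le4.
Qed.

Lemma dtime_kernel_le r : `|dtime_kernel a r| <= a^-1 * (a^-1 * 4).
Proof.
have ai : 0 <= a^-1 by rewrite invr_ge0 ltW.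
by rewrite /dtime_kernel 2!normrM (ger0_norm ai) ler_wpM2l// ler_wpM2l// dbump_le4.
Qed.

Let space_out r : b < `|r| -> 1 <= `|b^-1 * r + 0|.
Proof.
move=> h; rewrite addr0 normrM gtr0_norm ?invr_gt0//.
by rewrite ler_pdivlMl// mulr1 ltW.
Qed.

Let time_out r : r < - (3 * a) \/ - a < r -> 1 <= `|a^-1 * r + 2|.
Proof.
move=> h; have ha := a0; rewrite [X in `|X|](_ : _ = a^-1 * (r + 2 * a)); last by field; lra.
rewrite normrM gtr0_norm ?invr_gt0// ler_pdivlMl// mulr1 ler_normr.
by case: h => h; apply/orP; [right|left]; lra.
Qed.

Lemma space_kernel_supp r : b < `|r| -> space_kernel b r = 0.
Proof. by move=> /space_out h; rewrite /space_kernel bump_out// mulr0. Qed.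

Lemma dspace_kernel_supp r : b < `|r| -> dspace_kernel b r = 0.
Proof. by move=> /space_out h; rewrite /dspace_kernel dbump_out// !mulr0. Qed.

Lemma time_kernel_supp r : r < - (3 * a) \/ - a < r -> time_kernel a r = 0.
Proof. by move=> /time_out h; rewrite /time_kernel bump_out// mulr0. Qed.

Lemma dtime_kernel_supp r : r < - (3 * a) \/ - a < r -> dtime_kernel a r = 0.
Proof. by move=> /time_out h; rewrite /dtime_kernel dbump_out// !mulr0. Qed.

Lemma space_kernel_low r : `|r| <= b / 2 -> (2 * b)^-1 <= space_kernel b r.
Proof.
move=> h; rewrite /space_kernel (_ : (2 * b)^-1 = b^-1 * 2^-1); last by rewrite invfM mulrC.
rewrite ler_pM2l ?invr_gt0// bump_half// addr0 normrM gtr0_norm ?invr_gt0//.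
by rewrite ler_pdivrMl.
Qed.

Lemma time_kernel_low r : `|r + 2 * a| <= a / 2 -> (2 * a)^-1 <= time_kernel a r.
Proof.
move=> h; rewrite /time_kernel (_ : (2 * a)^-1 = a^-1 * 2^-1); last by rewrite invfM mulrC.
rewrite ler_pM2l ?invr_gt0// bump_half//.
have ha := a0; rewrite [X in `|X|](_ : _ = a^-1 * (r + 2 * a)); last by field; lra.
by rewrite normrM gtr0_norm ?invr_gt0// ler_pdivrMl.
Qed.

Lemma bmeas_space_kernel : bmeas (space_kernel b).
Proof.
apply: (C1fun_bmeas (C := b^-1) (C1fun_space_kernel b)) => r.
by rewrite ger0_norm ?space_kernel_ge0 ?space_kernel_le.
Qed.

Lemma bmeas_time_kernel : bmeas (time_kernel a).
Proof.
apply: (C1fun_bmeas (C := a^-1) (C1fun_time_kernel a)) => r.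
by rewrite ger0_norm ?time_kernel_ge0 ?time_kernel_le.
Qed.

Lemma bmeas_dspace_kernel : bmeas (dspace_kernel b).
Proof. exact: C1fun_bmeas' (C1fun_space_kernel b) dspace_kernel_le. Qed.

Lemma bmeas_dtime_kernel : bmeas (dtime_kernel a).
Proof. exact: C1fun_bmeas' (C1fun_time_kernel a) dtime_kernel_le. Qed.

End positive.

Lemma locally_integrable_bmeas (f : R -> R) : bmeas f -> locally_integrable [set: R] f.
Proof.
move=> [mf [C fC]]; split => //; first exact: openT.
move=> K _ cK; have mK : measurable K by exact: compact_measurable.
have muK : (mu K < +oo)%E by exact: compact_finite_measure.
have C0 : 0 <= C by rewrite (le_trans _ (fC 0)).
apply: (@le_lt_trans _ _ (\int[mu]_(x in K) (cst C%:E) x)%E); last first.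
  by rewrite integral_cst// lte_mul_pinfty.
by apply: ae_le_integral_nomeas; apply: aeW => x _; rewrite lee_fin.
Qed.

(* Lebesgue's differentiation theorem gives the L^1 continuity of the initial
   datum under the mollification at scale [b]. *)
Lemma modulus0_small (M L P : R) (rho0 f : R -> R) (tol : R) :
  bmeas rho0 -> (forall x, `|rho0 x| <= M) -> bmeas f ->
  (forall x, 0 <= f x) -> (forall x, f x <= P) -> (forall x, L < `|x| -> f x = 0) ->
  0 < tol -> exists2 b, 0 < b <= 1 &
    (\int[mu]_x \int[mu]_y (10 * (f x * (`|rho0 y - rho0 x| * space_kernel b (x - y))))%:E
     <= tol%:E)%E.
Proof.
move=> brho rhoM bf f0 fP fL tol0.
pose bn (n : nat) : R := n.+1%:R^-1.
have bn0 n : 0 < bn n by rewrite invr_gt0 ltr0n.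
have bn1 n : bn n <= 1 by rewrite invf_le1 ?ltr0n// ler1n.
have P0 : 0 <= P by rewrite (le_trans (f0 0)).
have M0 : 0 <= M by rewrite (le_trans _ (rhoM 0)).
pose h n (p : R * R) := 10 * (f p.1 * (`|rho0 p.2 - rho0 p.1| * space_kernel (bn n) (p.1 - p.2))).
have bh n : bmeas (h n).
  apply: bmeasM; first exact: bmeas_cst.
  apply: bmeasM; first exact: (bmeas_fst bf).
  apply: bmeasM.
    by apply: bmeas_norm; apply: bmeasB; [exact: (bmeas_snd brho)|exact: (bmeas_fst brho)].
  apply: (bmeas_comp (h := fun p : R * R => p.1 - p.2) _ (bmeas_space_kernel (bn0 n))).
  by apply: measurable_funB.
have h0 n x y : 0 <= h n (x, y).
  rewrite /h/=; do 3 (apply: mulr_ge0 => //); exact: space_kernel_ge0.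
pose B := `|L| + 1.
have LB : L <= B by rewrite /B (le_trans (ler_norm L))// lerDl.
pose F n x := (\int[mu]_y (h n (x, y))%:E)%E.
have mF n : measurable_fun setT (F n).
  have supp x y : ~ (`[- (B + 1), B + 1]%classic x /\ `[- (B + 1), B + 1]%classic y) -> h n (x, y) = 0.
    move=> xy; have [xL|xL] := leP `|x| L; last by rewrite /h/= fL// mul0r mulr0.
    rewrite /h/= space_kernel_supp ?mulr0// ltNge; apply/negP => xyb; apply: xy.
    rewrite /= !in_itv/= -!ler_norml; have := ler_distD x y 0; rewrite !subr0 (distrC y).
    by have := bn1 n; split; lra.
  by have [_ iM _ _ _] := bmeas_fubini2 (bh n) supp; exact: measurable_int iM.
have F0 n x : (0 <= F n x)%E by apply: integral_ge0 => y _; rewrite lee_fin.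
(* The kernel is at most 1/b_n and lives in the ball of radius 2 b_n, whose measure is 4 b_n: hence
   40 = 10 * 4. The doubled radius makes the open ball contain the closed support. *)
have bound1 n x : (F n x <= (40 * P)%:E * davg rho0 x (2 * bn n))%E.
  have b2 : 0 <= 2 * bn n by rewrite mulr_ge0// ltW.
  apply: (@le_trans _ _ ((10 * (P * (bn n)^-1))%:E *
      \int[mu]_(y in ball x (2 * bn n)) `|(rho0 y - rho0 x)%:E|)%E).
    have mball : measurable (ball x (2 * bn n)) by exact: measurable_ball.
    have mr : measurable_fun (ball x (2 * bn n)) (fun y => `|(rho0 y - rho0 x)%:E|)%E.
      apply: measurableT_comp => //; apply/measurable_EFinP; apply: measurable_funB => //.
      by apply: measurable_funS brho.1.
    rewrite -ge0_integralZl//; last by rewrite lee_fin !mulr_ge0// invr_ge0 ltW.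
    rewrite [leRHS]integral_mkcond; apply: ae_le_integral_nomeas; apply: aeW => y _; rewrite patchE.
    case: ifPn => [_|].
      rewrite -EFinM lee_fin /h/= -mulrA; apply: ler_pM => //.
        by do 2 (apply: mulr_ge0 => //); exact: space_kernel_ge0.
      rewrite -mulrA; apply: ler_pM => //.
        by apply: mulr_ge0 => //; exact: space_kernel_ge0.
      by rewrite mulrC ler_wpM2r// space_kernel_le.
    rewrite notin_setE /ball/= => /negP; rewrite -leNgt => xy.
    rewrite lee_fin /h/= space_kernel_supp ?mulr0//.
    by rewrite (lt_le_trans _ xy)// ltr_pMl// ltr1n.
  rewrite /davg /iavg lebesgue_measure_ball// inver ifF; last first.
    by rewrite mulrn_eq0/= mulf_eq0 pnatr_eq0/= gt_eqF.
  rewrite muleA -EFinM; apply: lee_pmul => //.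
  - by rewrite lee_fin !mulr_ge0// invr_ge0 ltW.
  - exact: integral_ge0.
  rewrite lee_fin -subr_ge0.
  rewrite [X in 0 <= X](_ : _ = 0)//.
  by rewrite -mulr_natl; have := bn0 n => ?; field; rewrite gt_eqF.
(* Domination uniform in n: oscillation at most 2M, kernel at most 1/b_n, on an interval of length 2
   b_n. *)
have bound2 n x : (F n x <= (40 * (P * M) * \1_(`[(- L)%R, L]%classic) x)%:E)%E.
  have [xL|xL] := leP `|x| L; last first.
    rewrite /F integral0_eq; first by rewrite lee_fin !mulr_ge0.
    by move=> y _; rewrite /h/= fL// mul0r mulr0.
  rewrite indicE mem_set ?mulr1; last by rewrite /= in_itv/= -ler_norml.
  have mE : measurable (`[x - bn n, x + bn n]%classic : set R) by exact: measurable_itv.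
  apply: (@le_trans _ _ ((10 * (P * (2 * M * (bn n)^-1)))%:E * mu `[(x - bn n)%R, (x + bn n)%R]%classic)%E).
    apply: integral_le_cst_supp => // y.
      move=> _; rewrite /h/=; apply: ler_pM => //.
        by do 2 (apply: mulr_ge0 => //); exact: space_kernel_ge0.
      apply: ler_pM => //; first by apply: mulr_ge0 => //; exact: space_kernel_ge0.
      apply: ler_pM => //; [exact: space_kernel_ge0| |exact: space_kernel_le].
      by rewrite (le_trans (ler_normB _ _))//; have := rhoM x; have := rhoM y; lra.
    move=> xy; rewrite /h/= space_kernel_supp ?mulr0//.
    rewrite ltNge; apply/negP; rewrite ler_norml => /andP[? ?]; apply: xy.
    by rewrite /= in_itv/=; apply/andP; split; lra.
  rewrite lebesgue_measure_itv/= lte_fin ifT; last by have := bn0 n; lra.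
  rewrite -EFinB -EFinM lee_fin -subr_ge0 [X in 0 <= X](_ : _ = 0)//.
  by have := bn0 n => ?; field; rewrite gt_eqF.
have iG : mu.-integrable setT (fun x => (40 * (P * M) * \1_(`[(- L)%R, L]%classic) x)%:E).
  have mI : measurable (`[(- L)%R, L]%classic : set R) by exact: measurable_itv.
  apply: (@bmeas_integrable _ _ _ mu _ _ mI (itv_fin L)).
    apply: bmeasM; first exact: bmeas_cst.
    split; first exact: measurable_indic.
    by exists 1 => z; rewrite indicE normr_nat lern1 leq_b1.
  by move=> z zL; rewrite indicE memNset// mulr0.
have Fcvg : {ae mu, forall x, setT x -> F ^~ x @ \oo --> 0%E}.
  have := lebesgue_differentiation (locally_integrable_bmeas brho).
  apply: ae_mono => x px _.
  apply: (@squeeze_cvge _ _ _ _ (cst 0%E) _ (fun n => (40 * P)%:E * davg rho0 x (2 * bn n))%E).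
  - by apply: nearW => n; rewrite F0 bound1.
  - exact: cvg_cst.
  - rewrite -[X in _ --> X](mule0 (40 * P)%:E); apply: cvgeZl => //.
    apply: (cvg_comp _ _ _ px).
    move=> A [e /= e0 eA]; have e2 : 0 < e / 2 by rewrite divr_gt0.
    near=> n; apply: eA => /=; last by rewrite mulr_gt0.
    rewrite /ball/= sub0r normrN gtr0_norm ?mulr_gt0// mulrC -ltr_pdivlMr//.
    by near: n; exact: (near_infty_natSinv_lt (PosNum e2)).
have Fdom : {ae mu, forall x, forall n, setT x -> (`|F n x| <= (40 * (P * M) * \1_(`[(- L)%R, L]%classic) x)%:E)%E}.
  by apply: aeW => x n _; rewrite gee0_abs.
have [_ _ cv] := @dominated_convergence _ _ R mu setT measurableT F (cst 0%E) _
  mF (measurable_cst 0%E) Fcvg iG Fdom.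
rewrite integral0 in cv.
have : \forall n \near \oo, (\int[mu]_x F n x < tol%:E)%E.
  by apply: (cvge_eventually_lt cv); rewrite lte_fin.
move=> [n _ /(_ n (leqnn n)) hn]; exists (bn n); first by rewrite bn0 bn1.
exact: ltW.
Unshelve. all: by end_near. Qed.

End kernels.

(** * Stability of approximate entropy solutions *)

Section cone.
Context {R : realType}.
Variables (c N l : R).
Hypotheses (c0 : 0 <= c) (N0 : 0 <= N) (l0 : 0 < l) (l1 : l <= 1).

(* Chosen so that the paraboloid is at least 1 on [0, N] x [-N/l, N/l] and its
   level sets are crossed outwards by all speeds at most [c]. *)
Definition cone_radius : R := (c + 1) * (N + 1) ^+ 2 + N ^+ 2 + 1.
Let Lam := cone_radius.
Let A := c * Lam + 1.
Definition cone_parab t x : R := parab (Lam ^+ 2) A l t x.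
Definition cone_fun t x : R := possq (cone_parab t x).
Definition cone_dt t x : R := - 4 * A * (t + 1) * Num.max (cone_parab t x) 0.
Definition cone_dx t x : R := - 4 * l * (l * x) * Num.max (cone_parab t x) 0.
Definition cone_width : R := (Lam + 1) / l.

Lemma cone_radius_ge1 : 1 <= Lam.
Proof. by rewrite lerDr addr_ge0 ?sqr_ge0// mulr_ge0 ?sqr_ge0// addr_ge0. Qed.

Let Lam1 := cone_radius_ge1.

Let A1 : 1 <= A. Proof. by rewrite lerDr mulr_ge0// (le_trans _ Lam1). Qed.

Let At0 t : 0 <= A * (t + 1) ^+ 2.
Proof. by rewrite mulr_ge0 ?sqr_ge0// (le_trans _ A1). Qed.

Lemma C1plane_cone : C1plane cone_fun cone_dt cone_dx.
Proof. exact: C1plane_parab. Qed.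

Lemma cone_width_ge0 : 0 < cone_width.
Proof. by rewrite divr_gt0// ltr_wpDl// (le_trans _ Lam1). Qed.

(** The extra 1 in [cone_width] absorbs the shift in (t + 1)^2 when t is negative. *)
Lemma cone_parab_out t x : cone_width < `|t| \/ cone_width < `|x| -> cone_parab t x <= 0.
Proof.
have sq (r : R) : Lam <= `|r| -> Lam ^+ 2 <= r ^+ 2.
  by move=> h; rewrite -(real_normK (num_real r)) lerXn2r// nnegrE// (le_trans _ Lam1).
rewrite /cone_parab /parab; case=> h.
  have hL : Lam + 1 < `|t|.
    rewrite (le_lt_trans _ h)// ler_pdivlMr// ler_piMr// addr_ge0//.
    by rewrite (le_trans _ Lam1).
  have : Lam ^+ 2 <= (t + 1) ^+ 2.
    apply: sq; have := ler_normD (t + 1) (- 1); rewrite addrK normrN normr1.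
    by move: hL; lra.
  have : (t + 1) ^+ 2 <= A * (t + 1) ^+ 2 by rewrite ler_peMl// sqr_ge0.
  by have := sqr_ge0 (l * x); lra.
have : Lam ^+ 2 <= (l * x) ^+ 2.
  apply: sq; rewrite normrM (gtr0_norm l0) mulrC.
  by move: h; rewrite /cone_width ltr_pdivrMr//; lra.
by have := At0 t; lra.
Qed.

Lemma cone_fun_supp : box_supported cone_width cone_fun.
Proof. by move=> t x /cone_parab_out h; rewrite /cone_fun possq0. Qed.

Lemma cone_dt_supp : box_supported cone_width cone_dt.
Proof. by move=> t x /cone_parab_out h; rewrite /cone_dt max_r ?mulr0. Qed.

Lemma cone_dx_supp : box_supported cone_width cone_dx.
Proof. by move=> t x /cone_parab_out h; rewrite /cone_dx max_r ?mulr0. Qed.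

Lemma cone_fun_ge0 t x : 0 <= cone_fun t x. Proof. exact: possq_ge0. Qed.

Lemma cone_fun_le t x : cone_fun t x <= (Lam ^+ 2) ^+ 2.
Proof.
rewrite /cone_fun /possq lerXn2r ?nnegrE ?sqr_ge0// ?le_max ?lexx ?orbT//.
rewrite ge_max sqr_ge0 andbT /cone_parab /parab.
by have := At0 t; have := sqr_ge0 (l * x); lra.
Qed.

(** Where the paraboloid is positive, |l x| <= Lam. The time derivative brings the factor A (t + 1)
    >= A = c Lam + 1, of which c Lam pays for the space derivative and 1 is left. The shift to t + 1
    makes this work from t = 0 on. *)
Lemma cone_dissipation t x : 0 <= t ->
  4 * Num.max (cone_parab t x) 0 <= - cone_dt t x - c * `|cone_dx t x|.
Proof.
move=> t0; have [p0|p0] := leP (cone_parab t x) 0.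
  by rewrite /cone_dt /cone_dx max_r// !mulr0 normr0 mulr0; lra.
rewrite /cone_dt /cone_dx max_l; last exact: ltW.
have xL : `|l * x| <= Lam.
  rewrite -(ler_pXn2r (_ : 0 < 2)%N) ?nnegrE ?(le_trans _ Lam1)// real_normK ?num_real//.
  by move: p0; rewrite /cone_parab /parab; have := At0 t; lra.
have h : 0 <= 4 * cone_parab t x * (A * t + c * (Lam - l * `|l * x|)).
  apply: mulr_ge0; first by rewrite mulr_ge0// ltW.
  rewrite addr_ge0// mulr_ge0// ?(le_trans _ A1)// subr_ge0.
  by rewrite (le_trans _ xL)// ler_piMl.
rewrite 2!normrM (normrM (- 4)) normrN normr_nat (gtr0_norm p0) (gtr0_norm l0).
by move: h; rewrite /A; lra.
Qed.

Lemma cone_speed t x : 0 <= t -> c * `|cone_dx t x| <= - cone_dt t x.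
Proof.
move=> t0; have := cone_dissipation x t0.
have : 0 <= Num.max (cone_parab t x) 0 by rewrite le_max lexx orbT.
by lra.
Qed.

(** Expanding one factor of Lam^2 cancels c Lam (N + 1)^2 and leaves Lam ((N + 1)^2 + N^2 + 1) - (N
    + 1)^2 - N^2, which is at least 1 because Lam >= 1. *)
Lemma cone_dissipation_low t x : 0 <= t -> t <= N -> `|l * x| <= N ->
  4 <= - cone_dt t x - c * `|cone_dx t x|.
Proof.
move=> t0 tN xN; apply: le_trans (cone_dissipation x t0).
rewrite -[leLHS]mulr1 ler_pM2l// le_max; apply/orP; left.
rewrite /cone_parab /parab.
have x2 : (l * x) ^+ 2 <= N ^+ 2 by rewrite -(real_normK (num_real (l * x))) lerXn2r// nnegrE.
have t2 : (t + 1) ^+ 2 <= (N + 1) ^+ 2 by rewrite lerXn2r ?nnegrE ?addr_ge0// lerD2r.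
have At : A * (t + 1) ^+ 2 <= A * (N + 1) ^+ 2 by rewrite ler_wpM2l// (le_trans _ A1).
have : 0 <= (Lam - 1) * ((N + 1) ^+ 2 + N ^+ 2 + 1).
  by rewrite mulr_ge0// ?subr_ge0// !addr_ge0// ?sqr_ge0.
have : Lam ^+ 2 = Lam * (c * (N + 1) ^+ 2) + Lam * ((N + 1) ^+ 2 + N ^+ 2 + 1).
  by rewrite expr2 -mulrDr; congr (_ * _); rewrite /Lam /cone_radius; ring.
by move: At x2; rewrite /A; lra.
Qed.

End cone.

Section stability.
Context {R : realType}.
Local Notation mu := (@lebesgue_measure R).
Local Notation pi := (@lebesgue_plane R).
Variables (c m M N : R) (rho0 : R -> R).
Hypotheses (c0 : 0 <= c) (N0 : 0 <= N).
Hypotheses (brho0 : bmeas rho0) (rho0M : forall x, `|rho0 x| <= M).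

Let psi := cone_fun c N 1.
Let psit := cone_dt c N 1.
Let psix := cone_dx c N 1.
Let L := cone_width c N 1.
Let P := (cone_radius c N ^+ 2) ^+ 2.
Let G (z : R * R) := - psit z.1 z.2 - c * `|psix z.1 z.2|.

Let psiC1 : C1plane psi psit psix. Proof. exact: C1plane_cone. Qed.
Let psi_supp : box_supported L psi. Proof. exact: cone_fun_supp. Qed.
Let psit_supp : box_supported L psit. Proof. exact: cone_dt_supp. Qed.
Let psix_supp : box_supported L psix. Proof. exact: cone_dx_supp. Qed.
Let psi_ge0 t x : 0 <= psi t x. Proof. exact: cone_fun_ge0. Qed.
Let psiP x : psi 0 x <= P. Proof. exact: cone_fun_le. Qed.
Let psi_cone t x : 0 <= t -> c * `|psix t x| <= - psit t x.
Proof. by move=> t0; exact: cone_speed. Qed.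

Let G_box t x : 0 <= t -> t <= N -> `|x| <= N -> 4 <= G (t, x).
Proof. by move=> t0 tN xN; apply: cone_dissipation_low => //; rewrite mul1r. Qed.

(** [B] and [eps] are fixed before [u] and [v]: every constant in the doubling estimate comes from
    the cone, the datum and the bound [M]. This uniformity is what the Cauchy property requires. *)
Lemma approx_entropy_stability (tol : R) : 0 < tol ->
  exists B eps, 0 < eps /\
  forall u v : R -> R -> R,
    bmeas (fun z : R * R => u z.1 z.2) -> bmeas (fun z : R * R => v z.1 z.2) ->
    (forall t x, `|u t x| <= M) -> (forall t x, `|v t x| <= M) ->
    approx_entropy c m B eps rho0 u -> approx_entropy c m B eps rho0 v ->
  (\int[pi]_(z in `[0%R, N]%classic `*` `[(- N)%R, N]%classic)
     `|u z.1 z.2 - v z.1 z.2|%:E <= tol%:E)%E.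
Proof.
move=> tol0.
have M0 : 0 <= M by rewrite (le_trans _ (rho0M 0)).
have [tpsi et ex] := C1plane_test_function psiC1 psi_supp (fun t x _ => psi_ge0 t x).
have [Bp [Bp0 _ bnd _ cpsi]] := test_function_box tpsi.
have bpsi : bmeas (fun z : R * R => psi z.1 z.2).
  split; first exact: continuous_measurable_plane.
  by exists Bp => z; exact: (bnd z.1 z.2).1.
have bpsit : bmeas (fun z : R * R => psit z.1 z.2).
  split; first by case: psiC1 => _ _ _ + _; exact: continuous_measurable_plane.
  by exists Bp => z; rewrite -et; exact: (bnd z.1 z.2).2.1.
have bpsix : bmeas (fun z : R * R => psix z.1 z.2).
  split; first by case: psiC1 => _ _ _ _; exact: continuous_measurable_plane.
  by exists Bp => z; rewrite -ex; exact: (bnd z.1 z.2).2.2.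
have tol8 : 0 < tol / 8 by rewrite divr_gt0.
have bp0 : bmeas (psi 0).
  have m0 : measurable_fun setT (fun x : R => (0 : R, x)) by exact: measurable_fun_pair.
  exact: (bmeas_comp m0 bpsi).
have L1 : 0 < L by exact: cone_width_ge0.
have L0 := ltW L1.
(* The budget of each of the two dissipations is tol/2. The oscillation of the datum takes tol/8,
   the flux near time 0 takes tol/8 through [a], and the entropy errors tol/8 through [eps]. *)
have [b /andP[b0 b1] hb] := @modulus0_small _ M L P rho0 (psi 0) _ brho0 rho0M bp0 (psi_ge0 0)
  psiP (fun x xL => psi_supp (or_intror xL)) tol8.
pose Nb : R := b^-1 * (b^-1 * 4).
have Nb0 : 0 <= Nb by rewrite !mulr_ge0// invr_ge0 ltW.
have P0 : 0 <= P by rewrite (le_trans (psi_ge0 0 0)).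
pose Q := c * (2 * M) * (10 * P * Nb) * (8 * b).
have Q0 : 0 <= Q.
  apply: mulr_ge0; last by rewrite mulr_ge0// ltW.
  by apply: mulr_ge0; rewrite mulr_ge0// mulr_ge0.
pose a := tol / 8 / (2 * L * (Q + 1)).
have Q1 : 0 < 2 * L * (Q + 1).
  by apply: mulr_gt0; [exact: mulr_gt0|rewrite ltr_wpDl].
have a0 : 0 < a by rewrite divr_gt0.
have ai : 0 <= a^-1 by rewrite invr_ge0 ltW.
have bi : 0 <= b^-1 by rewrite invr_ge0 ltW.
(* The first four summands cover supports and constants kappa, the others the size of the test
   functions and of their x-derivatives. *)
pose B := L + 6 * a + b + M + Bp * (a^-1 * b^-1) + Bp * (a^-1 * Nb) + 10 * Bp * b^-1 + 10 * Bp * Nb.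
have p1 : 0 <= Bp * (a^-1 * b^-1) by rewrite !mulr_ge0.
have p2 : 0 <= Bp * (a^-1 * Nb) by rewrite !mulr_ge0.
have p3 : 0 <= 10 * Bp * b^-1 by rewrite !mulr_ge0.
have p4 : 0 <= 10 * Bp * Nb by rewrite !mulr_ge0.
have B0 : 0 <= B by rewrite /B; lra.
pose eps := tol / 8 / (2 * L + 2 * (2 * B) ^+ 2 + 1).
have E1 : 0 < 2 * L + 2 * (2 * B) ^+ 2 + 1.
  by rewrite ltr_wpDl// addr_ge0// mulr_ge0// sqr_ge0.
have eps0 : 0 < eps by rewrite divr_gt0.
exists B, eps; split=> // u v bu bv uM vM au av.
have psib t x : `|psi t x| <= Bp := (bnd t x).1.
have psixb t x : `|psix t x| <= Bp by rewrite -ex; exact: (bnd t x).2.2.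
have alb r : `|time_kernel a r| <= a^-1 by rewrite ger0_norm ?time_kernel_ge0 ?time_kernel_le.
have beb r : `|space_kernel b r| <= b^-1 by rewrite ger0_norm ?space_kernel_ge0 ?space_kernel_le.
have dbeb r : `|dspace_kernel b r| <= Nb by exact: dspace_kernel_le.
have B1 (z w : R * R) :
   `|psi z.1 z.2 * (time_kernel a (z.1 - w.1) * space_kernel b (z.2 - w.2))| <= B /\
   `|psix z.1 z.2 * (time_kernel a (z.1 - w.1) * space_kernel b (z.2 - w.2)) +
     psi z.1 z.2 * (time_kernel a (z.1 - w.1) * dspace_kernel b (z.2 - w.2))| <= B.
  have h1 (f : R -> R -> R) : (forall t x, `|f t x| <= Bp) ->
      `|f z.1 z.2 * (time_kernel a (z.1 - w.1) * space_kernel b (z.2 - w.2))| <= Bp * (a^-1 * b^-1).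
    by move=> fB; rewrite normrM (normrM (time_kernel _ _)); apply: ler_pM => //; exact: ler_pM.
  have h2 : `|psi z.1 z.2 * (time_kernel a (z.1 - w.1) * dspace_kernel b (z.2 - w.2))| <= Bp * (a^-1 * Nb).
    by rewrite normrM (normrM (time_kernel _ _)); apply: ler_pM => //; exact: ler_pM.
  split; first by rewrite (le_trans (h1 _ psib))// /B; lra.
  rewrite (le_trans (ler_normD _ _))// (le_trans (lerD (h1 _ psixb) h2))// /B; lra.
have B2 (z w : R * R) :
     `|psi z.1 z.2 * (time_kernel a (z.1 - w.1) * dspace_kernel b (z.2 - w.2))| <= B.
  apply: (@le_trans _ _ (Bp * (a^-1 * Nb))); last by rewrite /B; lra.
  by rewrite normrM (normrM (time_kernel _ _)); apply: ler_pM => //; exact: ler_pM.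
have B3 (x s y : R) :
    `|10 * psi 0 x * (bump ((5 * a)^-1 * s + 5^-1) * space_kernel b (x - y))| <= B /\
    `|10 * psi 0 x * (bump ((5 * a)^-1 * s + 5^-1) * dspace_kernel b (x - y))| <= B.
  have h r : `|10 * psi 0 x * (bump ((5 * a)^-1 * s + 5^-1) * r)| <= 10 * Bp * `|r|.
    rewrite normrM (normrM 10) (normrM (bump _)) (ger0_norm (bump_ge0 _)) normr_nat; apply: ler_pM => //.
    - by rewrite mulr_ge0// bump_ge0.
    - by rewrite ler_wpM2l.
    - by rewrite ler_piMl// bump_le1.
  have hB : 0 <= 10 * Bp by rewrite mulr_ge0.
  split; apply: (le_trans (h _)).
    by apply: (@le_trans _ _ (10 * Bp * b^-1)); [rewrite ler_wpM2l|rewrite /B; lra].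
  by apply: (@le_trans _ _ (10 * Bp * Nb)); [rewrite ler_wpM2l|rewrite /B; lra].
have BL : L + 3 * a + b <= B by rewrite /B; lra.
have BM : M <= B by rewrite /B; lra.
have B6 : 6 * a <= B by rewrite /B; have := b0; lra.
have key (u' v' : R -> R -> R) :
    bmeas (fun z : R * R => u' z.1 z.2) -> bmeas (fun z : R * R => v' z.1 z.2) ->
    (forall t x, `|u' t x| <= M) -> (forall t x, `|v' t x| <= M) ->
    approx_entropy c m B eps rho0 u' -> approx_entropy c m B eps rho0 v' ->
    (dissipation c (time_kernel a) (space_kernel b) psit psix u' v' <= (tol / 2)%:E)%E.
  move=> bu' bv' uM' vM' au' av'.
  apply: (@le_trans _ _ (((c * (2 * M) * (10 * P * Nb) * (8 * a * b) + eps) * (2 * L)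
     + 2 * (eps * (2 * B) ^+ 2))%:E + modulus0 rho0 (space_kernel b) psi)%E).
    apply: (dissipation_le (m := m) (al' := dtime_kernel a) (be' := dspace_kernel b)) => //.
    - exact: C1fun_time_kernel.
    - exact: C1fun_space_kernel.
    - exact: bmeas_time_kernel.
    - exact: bmeas_dtime_kernel.
    - exact: bmeas_space_kernel.
    - exact: bmeas_dspace_kernel.
    - exact: time_kernel_ge0.
    - exact: space_kernel_ge0.
    - exact: time_kernel_supp.
    - exact: dtime_kernel_supp.
    - exact: space_kernel_supp.
    - exact: dspace_kernel_supp.
    - exact: time_kernel_le.
    - exact: ltW.
  apply: (le_trans (leeD (lexx _) hb)); rewrite -EFinD lee_fin.
  have h1 : c * (2 * M) * (10 * P * Nb) * (8 * a * b) * (2 * L) <= tol / 8.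
    rewrite [leLHS](_ : _ = (tol / 8) * (Q * (2 * L) / (2 * L * (Q + 1)))); last first.
      by rewrite /a /Q; ring.
    rewrite ler_piMr ?(ltW tol8)// ler_pdivrMr// mul1r mulrC ler_wpM2l//.
      by rewrite mulr_ge0.
    by rewrite lerDl.
  have h2 : eps * (2 * L + 2 * (2 * B) ^+ 2) <= tol / 8.
    rewrite /eps -mulrA ler_piMr ?(ltW tol8)// mulrC ler_pdivrMr// mul1r.
    by rewrite lerDl.
  by move: h1 h2; lra.
have Dsub : `[0%R, N]%classic `*` `[(- N)%R, N]%classic `<=` [set z : R * R | 0 <= z.1 /\ 4 <= G z].
  move=> [t x] [/=]; rewrite !in_itv/= => /andP[t0 tN]; rewrite -ler_norml => xN.
  by split => //; exact: G_box.
have mD : measurable (`[0%R, N]%classic `*` `[(- N)%R, N]%classic : set (R * R)).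
  by apply: measurableX; exact: measurable_itv.
apply: (@le_trans _ _ (dissipation c (time_kernel a) (space_kernel b) psit psix u v +
   dissipation c (time_kernel a) (space_kernel b) psit psix v v)%E).
  apply: (L1_le_dissipation (a := a) (b := b) (L := L) (al' := dtime_kernel a) (be' := dspace_kernel b) (psi := psi)) => //.
  - exact: bmeas_time_kernel.
  - exact: bmeas_space_kernel.
  - exact: time_kernel_ge0.
  - exact: space_kernel_ge0.
  - exact: time_kernel_supp.
  - exact: dtime_kernel_supp.
  - exact: space_kernel_supp.
  - exact: dspace_kernel_supp.
  - exact: time_kernel_low.
  - exact: space_kernel_low.
apply: (le_trans (leeD (key _ _ bu bv uM vM au av) (key _ _ bv bv vM vM av av))).
by rewrite -EFinD lee_fin; lra.
Qed.

End stability.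

(** * Bounded representatives on the whole plane *)

Section bounded_representatives.
Context {R : realType}.
Local Notation mu := (@lebesgue_measure R).
Local Notation pi := (@lebesgue_plane R).
Implicit Types (M : R) (rho : R -> R -> R).

Definition clamp M (r : R) : R := Num.min (Num.max r (- M)) M.

Lemma clamp_le M r : 0 <= M -> `|clamp M r| <= M.
Proof.
move=> M0; rewrite /clamp ler_norml le_min ge_min lexx orbT andbT le_max lexx orbT/=.
by lra.
Qed.

Lemma clamp_id M r : `|r| <= M -> clamp M r = r.
Proof.
by rewrite ler_norml => /andP[h1 h2]; rewrite /clamp (max_l h1) (min_l h2).
Qed.

Lemma measurable_clamp d (T : measurableType d) M (f : T -> R) :
  measurable_fun setT f -> measurable_fun setT (fun z => clamp M (f z)).
Proof.
by move=> mf; apply: measurable_minr => //; exact: measurable_maxr.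
Qed.

(* A bounded function, measurable on the whole plane, in place of [rho], which is
   controlled only almost everywhere and only for [t >= 0]. *)
Definition tame M rho (t x : R) : R :=
  clamp M (((fun z : R * R => rho z.1 z.2) \_ half_plane) (t, x)).

Lemma tame_le M rho t x : 0 <= M -> `|tame M rho t x| <= M.
Proof. exact: clamp_le. Qed.

Lemma measurable_half_plane : measurable (@half_plane R).
Proof.
rewrite (_ : half_plane = hline `*` setT).
  by apply: measurableX => //; exact: measurable_itv.
by apply/seteqP; split => z /=; rewrite /hline/= /half_plane/= in_itv/= andbT; tauto.
Qed.

Lemma bmeas_tame M rho : 0 <= M ->
  measurable_fun half_plane (fun z : R * R => rho z.1 z.2) ->
  bmeas (fun z : R * R => tame M rho z.1 z.2).
Proof.
move=> M0 mrho; split; last by exists M => z; exact: tame_le.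
have := (measurable_restrictT _ measurable_half_plane).1 mrho => h.
have := measurable_clamp M h; rewrite /tame.
by under [X in _ -> measurable_fun _ X]eq_fun do rewrite -surjective_pairing.
Qed.

Lemma tameE M rho t x : 0 <= t -> `|rho t x| <= M -> tame M rho t x = rho t x.
Proof.
by move=> t0 h; rewrite /tame patchE mem_set ?clamp_id.
Qed.

Lemma ae_tame M rho :
  {ae pi, forall z : R * R, 0 <= z.1 -> `|rho z.1 z.2| <= M} ->
  {ae mu, forall t, 0 <= t -> {ae mu, forall x, tame M rho t x = rho t x}}.
Proof.
move=> /ae_xsection; apply: ae_mono => t h t0.
by apply: ae_mono h => x /= /(_ t0); exact: tameE.
Qed.

End bounded_representatives.

(** * Exact entropy solutions as approximate ones and as their limits *)

Section entropy_solutions_and_approximation.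
Context {R : realType}.
Local Notation mu := (@lebesgue_measure R).
Local Notation pi := (@lebesgue_plane R).
Variables (m : R) (v2 : R -> R) (rho0 r0 : R -> R).
Hypothesis c0 : 0 <= v2 0.
Hypothesis rho0E : {ae mu, forall x, rho0 x = r0 x}.

Lemma local_fluxE (r k d : R) :
  Num.sg (r - k) * (trunc m r - trunc m k) * v2 0 * d = fluxdist (v2 0) m r k * d.
Proof. by rewrite sg_trunc /fluxdist (mulrC (v2 0)). Qed.

Lemma initE (kappa : R) (phi : R -> R -> R) :
  (\int[mu]_x (`|rho0 x - kappa| * phi 0 x)%:E = \int[mu]_x (`|r0 x - kappa| * phi 0 x)%:E)%E.
Proof.
by apply: ae_eq_integral_nomeas; apply: ae_mono rho0E => x -> _.
Qed.

Lemma local_entropy_solution_approx (M B eps : R) rho :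
  {ae pi, forall z : R * R, 0 <= z.1 -> `|rho z.1 z.2| <= M} -> 0 <= eps ->
  local_entropy_solution m v2 rho0 rho ->
  approx_entropy (v2 0) m B eps r0 (tame M rho).
Proof.
move=> rhoM eps0 [_ _ ent] kappa phi _ tphi _ _.
have := ent kappa phi tphi; rewrite /local_entropy_inequality initE.
rewrite (_ : (\int[mu]_(t in `[0%R, +oo[) _ = \int[mu]_(t in `[0%R, +oo[) \int[mu]_x
          (`|tame M rho t x - kappa| * derive1 (phi^~ x) t
           + fluxdist (v2 0) m (tame M rho t x) kappa * derive1 (phi t) x)%R%:E)%E).
  by move=> h; rewrite (le_trans h)// leeDl// lee_fin.
apply: ae_eq_integral_nomeas; apply: ae_mono (ae_tame rhoM) => t h.
rewrite /= in_itv/= andbT => /h {}h.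
by apply: ae_eq_integral_nomeas; apply: ae_mono h => x -> _; rewrite local_fluxE.
Qed.

(** A given pair of kappa and test function belongs to the class of some [B], so the error along the
    sequence is eventually below any e/2. Dominated convergence on the support of the test passes to
    the limit in the rest. *)
Lemma approx_entropy_limit (M : R) (U : nat -> R -> R -> R) (u : R -> R -> R) :
  (forall k, bmeas (fun z : R * R => U k z.1 z.2)) ->
  (forall k t x, `|U k t x| <= M) ->
  bmeas (fun z : R * R => u z.1 z.2) ->
  (forall t x, `|u t x| <= M) ->
  {ae pi, forall z : R * R, (fun k => U k z.1 z.2) @ \oo --> u z.1 z.2} ->
  (forall B eps : R, 0 < eps -> exists k0 : nat, forall k : nat, (k0 <= k)%N ->
     approx_entropy (v2 0) m B eps r0 (U k)) ->
  local_entropy_solution m v2 rho0 u.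
Proof.
move=> bU UM bu uM Uu aU; split.
- by apply: measurable_funS bu.1.
- by exists M; apply: aeW => z _.
move=> kappa phi tphi; rewrite /local_entropy_inequality initE.
have [Bp [Bp0 sphi bnd [st sx] _]] := test_function_box tphi.
pose B := Bp + `|kappa|.
have BB : Bp <= B by rewrite lerDl.
pose f (w : R -> R -> R) (z : R * R) := `|w z.1 z.2 - kappa| * derive1 (phi^~ z.2) z.1
   + fluxdist (v2 0) m (w z.1 z.2) kappa * derive1 (phi z.1) z.2.
have bt : bmeas (fun z : R * R => derive1 (phi^~ z.2) z.1).
  split; last by exists Bp => z; exact: (bnd z.1 z.2).2.1.
  by case: tphi => _ ct _ _ _; exact: continuous_measurable_plane.
have bx : bmeas (fun z : R * R => derive1 (phi z.1) z.2).
  split; last by exists Bp => z; exact: (bnd z.1 z.2).2.2.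
  by case: tphi => _ _ cx _ _; exact: continuous_measurable_plane.
have bf w : bmeas (fun z : R * R => w z.1 z.2) -> bmeas (f w).
  move=> bw; apply: bmeasD; apply: bmeasM => //.
    by apply: bmeas_norm; apply: bmeasB => //; exact: bmeas_cst.
  by apply: bmeas_fluxdist => //; exact: bmeas_cst.
have f0 w z : ~ box Bp z -> f w z = 0.
  by case: z => t x /not_boxP h; rewrite /f/= st// sx// !mulr0 addr0.
have Xe w : bmeas (fun z : R * R => w z.1 z.2) ->
    (\int[mu]_(t in `[0%R, +oo[) \int[mu]_x (f w (t, x))%:E =
     \int[pi]_z (\1_hline z.1 * f w z)%:E)%E.
  by move=> bw; apply: (iterated_half_plane (bf w bw)) => z; exact: f0.
have -> : (\int[mu]_(t in `[0%R, +oo[) \int[mu]_x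
   (`|u t x - kappa| * (phi^~ x)^`()%classic t +
    Num.sg (u t x - kappa) * (trunc m (u t x) - trunc m kappa) * v2 0 *
    (phi t)^`()%classic x)%:E = \int[pi]_z (\1_hline z.1 * f u z)%:E)%E.
  rewrite -Xe//; apply: eq_integral => t _; apply: eq_integral => x _.
  by rewrite local_fluxE.
have bHf w : bmeas (fun z : R * R => w z.1 z.2) -> bmeas (fun z => \1_hline z.1 * f w z).
  by move=> bw; apply: bmeasM; [exact: (bmeas_fst bmeas_hline)|exact: bf].
have Hf0 w z : ~ box Bp z -> \1_hline z.1 * f w z = 0 by move=> /f0 ->; rewrite mulr0.
have Xcvg : ((fun k => \int[pi]_z (\1_hline z.1 * f (U k) z)%:E) @ \oo -->
    \int[pi]_z (\1_hline z.1 * f u z)%:E)%E.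
  pose C := (M + `|kappa|) * Bp + v2 0 * (M + `|kappa|) * Bp.
  have fC k z : `|\1_hline z.1 * f (U k) z| <= C.
    have hl : `|\1_hline z.1 : R| <= 1 by rewrite indicE normr_nat lern1 leq_b1.
    have uk : `|U k z.1 z.2 - kappa| <= M + `|kappa|.
      by rewrite (le_trans (ler_normB _ _))// lerD2r.
    have fk : fluxdist (v2 0) m (U k z.1 z.2) kappa <= v2 0 * (M + `|kappa|).
      by rewrite (le_trans (fluxdist_le m c0 _ _))// ler_wpM2l.
    rewrite normrM -[leRHS]mul1r; apply: ler_pM => //.
    rewrite (le_trans (ler_normD _ _))//; apply: lerD; rewrite normrM.
      rewrite normr_id; apply: ler_pM => //.
      exact: (bnd z.1 z.2).2.1.
    rewrite (ger0_norm (fluxdist_ge0 m c0 _ _)); apply: ler_pM => //.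
      exact: fluxdist_ge0.
    exact: (bnd z.1 z.2).2.2.
  have C0 : 0 <= C by rewrite (le_trans _ (fC 0%N (0, 0))).
  have iG : pi.-integrable setT (EFin \o (fun z => C * \1_(box Bp) z)).
    apply: (@bmeas_integrable_box _ Bp).
      apply: bmeasM; first exact: bmeas_cst.
      split; first exact: measurable_indic (measurable_box Bp).
      by exists 1 => z; rewrite indicE normr_nat lern1 leq_b1.
    by move=> z zB; rewrite indicE memNset// mulr0.
  have mfk k : measurable_fun setT (fun z => (\1_hline z.1 * f (U k) z)%:E).
    by apply/measurable_EFinP; exact: (bHf _ (bU k)).1.
  have mfu : measurable_fun setT (fun z => (\1_hline z.1 * f u z)%:E).
    by apply/measurable_EFinP; exact: (bHf _ bu).1.
  have cv : {ae pi, forall z, setT z -> (fun k => (\1_hline z.1 * f (U k) z)%:E) @ \oo --> (\1_hline z.1 * f u z)%:E}.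
    apply: ae_mono Uu => z Uz _; apply: cvg_EFin; first by apply: nearW.
    apply: cvgM; first exact: cvg_cst.
    have nc : `|U k z.1 z.2 - kappa| @[k --> \oo] --> `|u z.1 z.2 - kappa|.
      by apply: cvg_norm; apply: cvgB => //; exact: cvg_cst.
    apply: cvgD; first by apply: cvgM => //; exact: cvg_cst.
    apply: cvgM; last exact: cvg_cst.
    apply: cvgM; first exact: cvg_cst.
    apply: cvg_norm; apply: cvgB; last exact: cvg_cst.
    have ct : {for u z.1 z.2, continuous (trunc m)}.
      by apply: (@continuous_min _ _ id (cst m)); [exact: cvg_id|exact: cvg_cst].
    exact: (cvg_comp _ _ Uz ct).
  have dom : {ae pi, forall z, forall k, setT z -> (`|(\1_hline z.1 * f (U k) z)%:E| <= (C * \1_(box Bp) z)%:E)%E}.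
    apply: aeW => z k _; rewrite abse_EFin lee_fin [X in _ <= _ * X]indicE.
    have [zB|zB] := pselect (box Bp z); first by rewrite mem_set// mulr1.
    by rewrite Hf0// normr0 mulr_ge0.
  by have [_ _] := @dominated_convergence _ _ R pi setT measurableT _ _ _ mfk mfu cv iG dom.
have fX : (\int[pi]_z (\1_hline z.1 * f u z)%:E \is a fin_num)%E.
  by apply: integrable_fin_num => //; exact: (bmeas_integrable_box (bHf _ bu) (Hf0 u)).
apply/lee_addgt0Pr => e e0.
have e2 : 0 < e / 2 by rewrite divr_gt0.
have lt : (\int[pi]_z (\1_hline z.1 * f u z)%:E < \int[pi]_z (\1_hline z.1 * f u z)%:E + (e / 2)%:E)%E.
  by rewrite lteDl// lte_fin.
have [k1 _ hk1] := cvge_eventually_lt Xcvg lt.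
have [k0 hk0] := aU B _ e2.
have kB : `|kappa| <= B by rewrite lerDr.
have sB : box_supported B phi.
  by move=> t x h; apply: sphi; case: h => h; [left|right]; exact: le_lt_trans h.
have pB t x : 0 <= t -> `|phi t x| <= B /\ `|derive1 (phi t) x| <= B.
  by move=> _; split; apply: le_trans BB; [exact: (bnd t x).1|exact: (bnd t x).2.2].
have := hk0 (maxn k0 k1) (leq_maxl _ _) kappa phi kB tphi sB pB.
have := ltW (hk1 (maxn k0 k1) (leq_maxr _ _)).
rewrite (Xe _ (bU _)) => h1 h2; apply: (le_trans h2).
(* The initial term is not known to be finite here, so it is carried along on both sides and never
   subtracted. *)
move: h1 => {h2 lt fX Xcvg hk1}.
move: (integral pi setT _) => Xk; move: (integral pi setT _) => X.
move: (integral mu setT _) => I h1.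
rewrite [in leRHS](splitr e) EFinD addeA; apply: leeD => //.
by rewrite [leRHS]addeAC; exact: leeD.
Qed.

End entropy_solutions_and_approximation.

(** * Velocities and kernels *)

Section nonlocal_ingredients.
Context {R : realType}.
Local Notation mu := (@lebesgue_measure R).
Implicit Types (v w : R -> R).

Lemma C1_itv_lipschitz (a b : R) f f' : a <= b -> C1_itv a b f f' ->
  exists2 K : R, 0 <= K & forall r s, r \in `[a, b] -> s \in `[a, b] ->
    `|f r - f s| <= K * `|r - s|.
Proof.
move=> ab [df df' cf'].
have cf := derivable_oo_LRcontinuous_within df.
have /compact_bounded[K0 [_ hK]] : compact (f' @` `[a, b]).
  by apply: continuous_compact => //; exact: segment_compact.
have KK : K0 < `|K0| + 1 by rewrite (le_lt_trans (ler_norm K0))// ltrDl.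
have K1 : 0 <= `|K0| + 1 by rewrite addr_ge0.
have f'K z : z \in `[a, b] -> `|f' z| <= `|K0| + 1.
  by move=> zab; apply: (hK _ KK); exists z.
exists (`|K0| + 1) => // r s; wlog rs : r s / r <= s.
  by move=> W hr hs; have [h|/ltW h] := leP r s; [|rewrite distrC (distrC r)]; exact: W.
rewrite !in_itv/= => /andP[ar rb] /andP[as_ sb].
have cfrs : {within `[r, s], continuous f}.
  apply: continuous_subspaceW cf => z /=; rewrite !in_itv/= => /andP[rz zs].
  by rewrite (le_trans ar)// (le_trans zs).
have sub z : z \in `]r, s[ -> z \in `]a, b[.
  rewrite !in_itv/= => /andP[rz zs].
  by rewrite (le_lt_trans ar)// (lt_le_trans zs).
have der z : z \in `]r, s[ -> is_derive z 1 f (f' z).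
  move=> /sub zab; rewrite -df'//; apply: is_derive_derive1.
  by case: df => + _ _; apply.
have [z zrs e] := MVT_segment rs der cfrs.
rewrite distrC e normrM (distrC r) ler_wpM2r// f'K//.
move: zrs; rewrite !in_itv/= => /andP[rz zs].
by rewrite (le_trans ar)// (le_trans zs).
Qed.

Lemma C1_itv_nonincreasing (a b : R) f f' : C1_itv a b f f' ->
  {in `[a, b], forall z, f' z <= 0} ->
  forall r s, a <= r -> r <= s -> s <= b -> f s <= f r.
Proof.
move=> [df df' cf'] f'0.
have cf := derivable_oo_LRcontinuous_within df.
apply: ler0_derive1_nincr => // z zab.
  by case: df => + _ _; apply.
by rewrite df'// f'0//; exact: subset_itv_oo_cc.
Qed.

Lemma admissible_velocityP (rmax : R) v : 0 < rmax -> admissible_velocity rmax v ->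
  exists2 K : R, 0 <= K & (forall r s, 0 <= r <= rmax -> 0 <= s <= rmax ->
    `|v r - v s| <= K * `|r - s|) /\ (forall r, 0 <= r <= rmax -> 0 <= v r <= v 0) /\
    (forall r s, 0 <= r -> r <= s -> s <= rmax -> v s <= v r).
Proof.
move=> rmax0 [v' [v'' [[C1 _] v0 v'0 _]]].
have [K K0 lip] := C1_itv_lipschitz (ltW rmax0) C1.
exists K => //; split=> [r s hr hs|]; first by apply: lip; rewrite in_itv.
have ninc := C1_itv_nonincreasing C1 v'0; split=> // r hr.
have /andP[r0 rm] := hr.
by rewrite v0 ?in_itv//= ninc.
Qed.

(** Extension by 0 makes the nonlocal velocities averages over the whole line, and keeps the kernel
    nonincreasing on the nonnegative half-line. *)
Definition extended_kernel (eta : R) w : R -> R := w \_ `[0, eta]%classic.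

Lemma extended_kernelE (eta : R) w y :
  extended_kernel eta w y = if 0 <= y <= eta then w y else 0.
Proof. by rewrite /extended_kernel patchE mem_setE in_itv. Qed.

Lemma admissible_kernelP (eta : R) w : 0 < eta -> admissible_kernel eta w ->
  let W := extended_kernel eta w in
  [/\ measurable_fun setT W, forall y, 0 <= W y <= w 0,
      forall y y', 0 <= y -> y <= y' -> W y' <= W y &
      (\int[mu]_y (W y)%:E = 1)%E].
Proof.
move=> eta0 [w' [C1 w0 w'0 iw]] W.
have ninc := C1_itv_nonincreasing C1 w'0.
have WE y : W y = if 0 <= y <= eta then w y else 0 := extended_kernelE eta w y.
have Wge y : 0 <= W y by rewrite WE; case: ifP => // h; apply: w0; rewrite in_itv.
split=> //.
- apply: (measurable_restrictT _ _).1; first exact: measurable_itv.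
  apply: subspace_continuous_measurable_fun; first exact: measurable_itv.
  by case: C1 => df _ _; exact: (derivable_oo_LRcontinuous_within df).
- move=> y; rewrite Wge/= WE; case: ifP => [/andP[y0 yeta]|_]; first exact: ninc.
  by apply: w0; rewrite in_itv/= lexx ltW.
- move=> y y' y0 yy'; have [y'e|y'e] := leP y' eta.
    by rewrite !WE y0 y'e (le_trans y0 yy') (le_trans yy' y'e)/=; exact: ninc.
  by rewrite [X in X <= _]WE (leNgt y') y'e andbF.
have e : (\int[mu]_y (W y)%:E = \int[mu]_(y in `[0%R, eta]) (w y)%:E)%E.
  rewrite [RHS]integral_mkcond; apply: eq_integral => y _.
  by rewrite WE patchE mem_setE in_itv/=; case: ifP.
(* [fine] sends infinite values to 0, so a real integral equal to 1 excludes them. *)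
move: iw; rewrite e /Rintegral; case: integral => [r /= ->//| |] /=.
  by move=> /eqP; rewrite eq_sym oner_eq0.
by move=> /eqP; rewrite eq_sym oner_eq0.
Qed.

(** Valid at every point: where the difference quotient diverges, [derive1] takes the default value
    0. Almost everywhere differentiability of the velocities is thus bypassed. *)
Lemma derive1_lipschitz (g : R -> R) (K x : R) :
  (forall y z, `|g y - g z| <= K * `|y - z|) -> `|derive1 g x| <= K.
Proof.
move=> lip; have K0 : 0 <= K.
  by have := lip 1 0; rewrite subr0 normr1 mulr1; apply: le_trans.
rewrite /derive1; have [cv|ncv] := pselect (cvg (h^-1 *: (g (h + x) - g x) @[h --> 0^'])); last first.
  by rewrite dvgP// normr0.
have h1 : `|h^-1 *: (g (h + x) - g x)| @[h --> 0^'] --> `|lim (h^-1 *: (g (h + x) - g x) @[h --> 0^'])|.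
  exact: cvg_norm.
apply: (cvgr_to_le h1); near=> h.
have h0 : h != 0 by near: h; exact: nbhs_dnbhs_neq.
rewrite normrM normfV ler_pdivrMl ?normr_gt0// mulrC (le_trans (lip _ _))//.
by rewrite addrK.
Unshelve. all: by end_near. Qed.

End nonlocal_ingredients.

(** * Averages against a nonincreasing kernel on a moving window *)

Section window_averages.
Context {R : realType}.
Local Notation mu := (@lebesgue_measure R).
Variables (W : R -> R) (w0 eta : R).
Hypothesis mW : measurable_fun setT W.
Hypothesis W_bound : forall y, 0 <= W y <= w0.
Hypothesis W_neg : forall y, y < 0 -> W y = 0.
Hypothesis W_far : forall y, eta < y -> W y = 0.
Hypothesis W_ninc : forall y y', 0 <= y -> y <= y' -> W y' <= W y.
Hypothesis W_int : (\int[mu]_y (W y)%:E = 1)%E.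

Definition window_average (f : R -> R) (x : R) : R := \int[mu]_y (f y * W (y - x)).

Let W0 y : 0 <= W y. Proof. by case/andP: (W_bound y). Qed.
Let Ww y : W y <= w0. Proof. by case/andP: (W_bound y). Qed.
Let w00 : 0 <= w0. Proof. exact: le_trans (W0 0) (Ww 0). Qed.

Let bW x : bmeas (fun y : R => W (y - x)).
Proof.
split; last by exists w0 => y; rewrite ger0_norm.
by apply: (measurableT_comp mW); exact: measurable_funB.
Qed.

Let W_supp x y : ~ `[x, x + eta]%classic y -> W (y - x) = 0.
Proof.
rewrite /= in_itv/= => /negP; rewrite negb_and -!ltNge => /orP[h|h].
  by rewrite W_neg// subr_lt0.
by rewrite W_far// ltrBrDl.
Qed.

Let itv_fin' (p q : R) : (mu `[p, q]%classic < +oo)%E.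
Proof. by rewrite lebesgue_measure_itv/=; case: ifP => // _; rewrite -EFinB ltry. Qed.

Lemma window_integrable f x : bmeas f -> mu.-integrable setT (EFin \o (fun y : R => f y * W (y - x))).
Proof.
move=> bf; apply: (@bmeas_integrable _ _ _ mu _ _ (measurable_itv _) (itv_fin' x (x + eta)) (bmeasM bf (bW x))).
by move=> y /W_supp ->; rewrite mulr0.
Qed.

Lemma window_integrable1 x : mu.-integrable setT (EFin \o (fun y : R => W (y - x))).
Proof.
apply: (@bmeas_integrable _ _ _ mu _ _ (measurable_itv _) (itv_fin' x (x + eta)) (bW x)).
by move=> y; exact: W_supp.
Qed.

Lemma window_total x : \int[mu]_y W (y - x) = 1.
Proof.
rewrite /Rintegral (ge0_integral_shift (f := fun y => (W y)%:E)) ?W_int//.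
exact/measurable_EFinP.
Qed.

Lemma window_average_ge0 f x : (forall y, 0 <= f y) -> 0 <= window_average f x.
Proof. by move=> f0; apply: Rintegral_ge0 => y _; rewrite mulr_ge0. Qed.

Lemma window_average_le (f : R -> R) x (F : R) : bmeas f -> (forall y, f y <= F) ->
  window_average f x <= F.
Proof.
move=> bf fF; apply: (@le_trans _ _ (\int[mu]_y (F * W (y - x)))).
  apply: le_Rintegral => //; [exact: window_integrable| |].
    exact: (window_integrable x (bmeas_cst _ F)).
  by move=> y _; rewrite ler_wpM2r.
by rewrite RintegralZl ?window_total ?mulr1//; exact: window_integrable1.
Qed.

Lemma Rintegral_indic_itv (p q k : R) : p <= q ->
  mu.-integrable setT (EFin \o (fun y : R => k * \1_(`[p, q]%classic) y)) /\
  \int[mu]_y (k * \1_(`[p, q]%classic) y) = k * (q - p).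
Proof.
move=> pq; have mI : measurable (`[p, q]%classic : set R) by exact: measurable_itv.
have b1 : bmeas (\1_(`[p, q]%classic) : R -> R).
  split; first exact: measurable_indic.
  by exists 1 => z; rewrite indicE normr_nat lern1 leq_b1.
have i1 : mu.-integrable setT (EFin \o (\1_(`[p, q]%classic) : R -> R)).
  apply: (@bmeas_integrable _ _ _ mu _ _ mI (itv_fin' p q) b1) => z zI.
  by rewrite indicE memNset.
split.
  apply: (@bmeas_integrable _ _ _ mu _ _ mI (itv_fin' p q)) => [|z zI].
    by apply: bmeasM => //; exact: bmeas_cst.
  by rewrite indicE memNset// mulr0.
rewrite RintegralZl// /Rintegral integral_indic// setIT.
have muI : (mu `[p, q]%classic = (q - p)%:E)%E.
  rewrite lebesgue_measure_itv/= lte_fin; case: ltP => h; first by rewrite -EFinB.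
  by have -> : q - p = 0 by lra.
by congr (_ * _); exact: (congr1 fine muI).
Qed.

(** Moving the window right from x to x' raises the kernel beyond x' by monotonicity and loses at
    most w0 on [x, x']. So the difference d of the two kernels satisfies |d| <= d + 2 w0 on [x, x']
    and |d| <= d elsewhere; since d has integral 0, its L^1 norm is at most 2 w0 |x' - x|. *)
Lemma window_average_lipschitz (f : R -> R) (F : R) x x' : bmeas f -> (forall y, 0 <= f y <= F) ->
  `|window_average f x' - window_average f x| <= 2 * F * w0 * `|x' - x|.
Proof.
move=> bf fF; wlog xx' : x x' / x <= x'.
  by move=> H; have [h|/ltW h] := leP x x'; [|rewrite distrC (distrC x')]; exact: H.
have F0 : 0 <= F by case/andP: (fF 0) => h1 h2; exact: le_trans h1 h2.
have [i1 e1] := Rintegral_indic_itv (2 * w0) xx'.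
have bd : bmeas (fun y : R => W (y - x') - W (y - x)) by exact: bmeasB.
have iB : mu.-integrable setT (EFin \o (fun y : R => W (y - x') - W (y - x))).
  by apply: (integrableB measurableT (window_integrable1 x') (window_integrable1 x)).
have key y : `|W (y - x') - W (y - x)| <= W (y - x') - W (y - x) + 2 * w0 * \1_(`[x, x']%classic) y.
  have [yx'|yx'] := leP x' y.
    rewrite ger0_norm ?lerDl ?mulr_ge0//.
    by rewrite subr_ge0; apply: W_ninc; rewrite ?subr_ge0// lerD2l lerN2.
  rewrite (W_neg (_ : y - x' < 0)) ?subr_lt0// sub0r normrN ger0_norm//.
  have [xy|yx] := leP x y; last first.
    by rewrite (W_neg (_ : y - x < 0)) ?subr_lt0// oppr0 add0r !mulr_ge0.
  rewrite indicE mem_set ?mulr1; last by rewrite /= in_itv/= xy ltW.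
  by have := Ww (y - x); lra.
rewrite /window_average -RintegralB//; [|exact: window_integrable|exact: window_integrable].
have ifd : mu.-integrable setT (EFin \o (fun y : R => f y * W (y - x') - f y * W (y - x))).
  by apply: (integrableB measurableT (window_integrable x' bf) (window_integrable x bf)).
apply: (le_trans (le_normr_Rintegral _ ifd)) => //.
apply: (@le_trans _ _ (\int[mu]_y (F * (W (y - x') - W (y - x) + 2 * w0 * \1_(`[x, x']%classic) y)))).
  apply: le_Rintegral => //.
  - exact: integrable_norm.
  - exact: (integrableZl measurableT F (integrableD measurableT iB i1)).
  - move=> y _; rewrite -mulrBr normrM; case/andP: (fF y) => f0 f1.
    by rewrite (ger0_norm f0); apply: ler_pM.
rewrite RintegralZl//; last exact: (integrableD measurableT iB i1).
rewrite RintegralD// e1 RintegralB ?window_total ?subrr ?add0r//; try exact: window_integrable1.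
by rewrite (ger0_norm (_ : 0 <= x' - x)) ?subr_ge0//; lra.
Qed.

Lemma window_average_derive1 (f : R -> R) (F x : R) : bmeas f -> (forall y, 0 <= f y <= F) ->
  `|derive1 (window_average f) x| <= 2 * F * w0.
Proof.
by move=> bf fF; apply: derive1_lipschitz => y z; exact: window_average_lipschitz.
Qed.

(** The kernel needs y >= x >= -B and [f] needs y < 0, so the overlap has length at most B. *)
Lemma window_average_left (f : R -> R) (F B x : R) : bmeas f -> (forall y, 0 <= f y <= F) ->
  (forall y, 0 <= y -> f y = 0) -> `|x| <= B -> window_average f x <= F * w0 * B.
Proof.
move=> bf fF f0 xB; have B0 : 0 <= B by rewrite (le_trans _ xB).
have NB : - B <= 0 by rewrite oppr_le0.
have F0 : 0 <= F by case/andP: (fF 0) => h1 h2; exact: le_trans h1 h2.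
have [i1 e1] := Rintegral_indic_itv (F * w0) NB.
rewrite (_ : F * w0 * B = F * w0 * (0 - - B)); last by rewrite sub0r opprK.
rewrite -e1; apply: le_Rintegral => //; first exact: window_integrable.
move=> y _; have [y0|y0] := leP 0 y; first by rewrite f0// mul0r !mulr_ge0.
have [yx|xy] := ltP y x; first by rewrite W_neg ?subr_lt0// mulr0 !mulr_ge0.
rewrite indicE mem_set ?mulr1; last first.
  by rewrite /= in_itv/= (ltW y0) andbT; move: xB; rewrite ler_norml => /andP[]; lra.
by case/andP: (fF y) => f1 f2; exact: ler_pM.
Qed.

(** The constant [c] is its own average. The deviation is [c] on the part of the window left of 0,
    of length at most B, and at most [K * g] on the rest; the kernel is bounded by w0 on both. Since
    |x| <= B <= eta, the window stays in [-2 eta, 2 eta]. *)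
Lemma window_average_right (f g : R -> R) (c K B x : R) : bmeas f -> bmeas g ->
  0 <= c -> 0 <= K -> `|x| <= B -> B <= eta ->
  (forall y, y <= 0 -> f y = 0) -> (forall y, 0 <= g y) ->
  (forall y, ~ `[- (2 * eta), 2 * eta]%classic y -> g y = 0) ->
  (forall y, 0 < y -> y <= 2 * eta -> `|f y - c| <= K * g y) ->
  `|window_average f x - c| <= w0 * (c * B + K * \int[mu]_y g y).
Proof.
move=> bf bg c0 K0 xB Be f0 g0 gsupp fg; have B0 : 0 <= B by rewrite (le_trans _ xB).
have NB : - B <= 0 by rewrite oppr_le0.
have [i1 e1] := Rintegral_indic_itv (c * w0) NB.
have ig : mu.-integrable setT (EFin \o g).
  exact: (@bmeas_integrable _ _ _ mu _ _ (measurable_itv _) (itv_fin' _ _) bg gsupp).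
have igK : mu.-integrable setT (EFin \o (fun y : R => K * w0 * g y)).
  exact: (integrableZl measurableT (K * w0) ig).
have ic := window_integrable x (bmeas_cst _ c).
have ce : c = \int[mu]_y (c * W (y - x)).
  by rewrite RintegralZl ?window_total ?mulr1//; exact: window_integrable1.
rewrite [X in `|_ - X| <= _]ce /window_average -RintegralB//; last exact: window_integrable.
have ifd : mu.-integrable setT (EFin \o (fun y : R => f y * W (y - x) - c * W (y - x))).
  by apply: (integrableB measurableT (window_integrable x bf) ic).
apply: (le_trans (le_normr_Rintegral _ ifd)) => //.
apply: (@le_trans _ _ (\int[mu]_y (c * w0 * \1_(`[- B, 0]%classic) y + K * w0 * g y))).
  apply: le_Rintegral => //.
  - exact: integrable_norm.
  - exact: (integrableD measurableT i1 igK).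
  move=> y _; rewrite -mulrBl normrM (ger0_norm (W0 _)).
  have [yW|yW] := pselect (`[x, x + eta]%classic y); last first.
    by rewrite W_supp// mulr0 addr_ge0// !mulr_ge0.
  move: yW; rewrite /= in_itv/= => /andP[xy yx].
  move: xB; rewrite ler_norml => /andP[x1 x2].
  have [y0|y0] := leP y 0.
    rewrite f0// sub0r normrN (ger0_norm c0) indicE mem_set ?mulr1; last first.
      by rewrite /= in_itv/= y0 andbT; lra.
    by rewrite (@le_trans _ _ (c * w0))// ?lerDl ?mulr_ge0// ler_wpM2l.
  rewrite (@le_trans _ _ (K * g y * w0))//.
    by apply: ler_pM => //; apply: fg => //; lra.
  by rewrite mulrAC lerDr !mulr_ge0.
by rewrite RintegralD// e1 RintegralZl//; lra.
Qed.

End window_averages.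

(** * Nonlocal solutions as approximate entropy solutions *)

Lemma prod3_le (R : realType) (a b d A B D : R) : `|a| <= A -> `|b| <= B -> `|d| <= D ->
  a * b * d <= A * B * D.
Proof.
move=> aA bB dD; apply: (le_trans (ler_norm _)); rewrite !normrM.
by apply: ler_pM => //; exact: ler_pM.
Qed.

Section nonlocal.
Context {R : realType}.
Local Notation mu := (@lebesgue_measure R).
Local Notation pi := (@lebesgue_plane R).

Lemma integral_le_cst_itv (f : R -> R) (a b C : R) : a <= b ->
  (forall x, `[a, b]%classic x -> f x <= C) -> (forall x, ~ `[a, b]%classic x -> f x <= 0) ->
  (\int[mu]_x (f x)%:E <= (C * (b - a))%:E)%E.
Proof.
move=> ab fC f0; have <- : (C%:E * mu `[a, b]%classic = (C * (b - a))%:E)%E.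
  rewrite lebesgue_measure_itv/= lte_fin; case: ltP => h; first by rewrite -EFinD -EFinM.
  by have -> : a = b; [apply/eqP; rewrite eq_le ab|rewrite subrr mulr0 mule0].
exact: (integral_le_cst_supp mu (measurable_itv _)).
Qed.

Lemma bmeas_integrable_itv (f : R -> R) (a b : R) : bmeas f ->
  (forall x, ~ `[a, b]%classic x -> f x = 0) -> mu.-integrable setT (EFin \o f).
Proof.
move=> bf f0; have fin : (mu `[a, b]%classic < +oo)%E.
  by rewrite lebesgue_measure_itv/=; case: ifP => // _; rewrite -EFinB ltry.
exact: (@bmeas_integrable _ _ _ mu _ _ (measurable_itv _) fin bf f0).
Qed.

Section velocity.
Variables (rmax : R) (v : R -> R).
Hypotheses (rmax0 : 0 < rmax) (hv : admissible_velocity rmax v).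

Definition clip (r : R) : R := Num.min (Num.max r 0) rmax.

Lemma clip_range r : 0 <= clip r <= rmax.
Proof. by rewrite /clip le_min ge_min lexx orbT andbT le_max lexx orbT/= ltW. Qed.

Lemma clip_id r : 0 <= r <= rmax -> clip r = r.
Proof. by move=> /andP[h1 h2]; rewrite /clip (max_l h1) (min_l h2). Qed.

(** Nothing is known of [v] outside [0, rmax]; after clipping it is nonincreasing on the whole line,
    hence measurable. *)
Lemma measurable_velocity_clip : measurable_fun setT (fun r => v (clip r)).
Proof.
have [K K0 [_ [_ ninc]]] := admissible_velocityP rmax0 hv.
apply: nonincreasing_measurable => // r s rs.
have /andP[c1 c2] := clip_range r; have /andP[c3 c4] := clip_range s.
apply: ninc => //; rewrite /clip le_min !ge_min lexx orbT andbT.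
by apply/orP; left; rewrite ge_max !le_max rs lexx !orbT.
Qed.

Lemma velocity_clip_range r : 0 <= v (clip r) <= v 0.
Proof.
by have [K K0 [_ [vb _]]] := admissible_velocityP rmax0 hv; exact/vb/clip_range.
Qed.

End velocity.

Variables (rmax1 rmax2 eta : R) (v1 v2 w : R -> R) (rho : R -> R -> R).
Hypotheses (rmax10 : 0 < rmax1) (rmax20 : 0 < rmax2).
Hypotheses (hv1 : admissible_velocity rmax1 v1) (hv2 : admissible_velocity rmax2 v2).
Hypotheses (eta1 : 1 <= eta) (hw : admissible_kernel eta w).

Let eta0 : 0 < eta. Proof. exact: lt_le_trans eta1. Qed.
Let W := extended_kernel eta w.

Definition in_range (t : R) := {ae mu, forall y,
  (y < 0 -> 0 <= rho t y <= rmax1) /\ (0 < y -> 0 <= rho t y <= rmax2)}.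

Definition left_speed (u : R -> R -> R) t y : R :=
  \1_(`]-oo, 0[%classic : set R) y * v1 (clip rmax1 (u t y)).
Definition right_speed (u : R -> R -> R) t y : R :=
  \1_(`]0, +oo[%classic : set R) y * v2 (clip rmax2 (u t y)).

Let M := rmax1 + rmax2.
Let u := tame M rho.
Let M0 : 0 <= M. Proof. by rewrite addr_ge0// ltW. Qed.

Lemma ae_neq0 : {ae mu, forall y : R, y != 0}.
Proof.
exists [set 0]; split; [exact: measurable_set1|exact: lebesgue_measure_set1|].
by move=> y /= /negP; rewrite negbK => /eqP.
Qed.

Lemma in_range_tame t : 0 <= t -> in_range t ->
  {ae mu, forall y, [/\ y != 0, rho t y = u t y,
    y < 0 -> 0 <= u t y <= rmax1, 0 < y -> 0 <= u t y <= rmax2 & 0 <= u t y]}.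
Proof.
move=> t0 h; apply: ae_mono (ae_and ae_neq0 h) => y [y0 [yl yr]].
have : `|rho t y| <= M /\ 0 <= rho t y.
  have [yn|yp|/eqP] := ltgtP y 0; last by rewrite (negbTE y0).
    by have /andP[h1 h2] := yl yn; rewrite ger0_norm// /M; split=> //; have := rmax20; lra.
  by have /andP[h1 h2] := yr yp; rewrite ger0_norm// /M; split=> //; have := rmax10; lra.
by move=> [rM r0]; rewrite /u tameE.
Qed.

Lemma V1_window t x : 0 <= t -> in_range t ->
  V1 eta v1 w rho t x = window_average W (left_speed u t) x.
Proof.
move=> t0 /(in_range_tame t0) h; rewrite /V1 /window_average /Rintegral; congr fine.
rewrite integral_mkcond; apply: ae_eq_integral_nomeas; apply: ae_mono h => y [y0 e yl yr _] _.
rewrite patchE mem_setE in_itv/= /left_speed /W extended_kernelE indicE mem_setE in_itv/=.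
have [yn|yp] := ltP y 0; last first.
  rewrite mul0r mul0r; case: ifP => // /andP[_]; rewrite le_min => /andP[_ y0'].
  by exfalso; move/eqP: y0; apply; apply/eqP; rewrite eq_le y0'.
rewrite mul1r clip_id ?yl// e.
rewrite ge_min le_min (ltW yn) andbT (leNgt 0) yn orbF.
have -> : (0 <= y - x <= eta) = (x <= y <= x + eta) by rewrite subr_ge0 lerBlDl.
by case: ifP; rewrite ?mulr0.
Qed.

Lemma V2_window t x : 0 <= t -> in_range t ->
  V2 eta v2 w rho t x = window_average W (right_speed u t) x.
Proof.
move=> t0 /(in_range_tame t0) h; rewrite /V2 /window_average /Rintegral; congr fine.
rewrite integral_mkcond; apply: ae_eq_integral_nomeas; apply: ae_mono h => y [y0 e yl yr _] _.
rewrite patchE mem_setE in_itv/= /right_speed /W extended_kernelE indicE mem_setE in_itv/= andbT.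
have [yp|yn] := ltP 0 y; last first.
  rewrite mul0r mul0r; case: ifP => // /andP[]; rewrite ge_max => /andP[_ y0'].
  by exfalso; move/eqP: y0; apply; apply/eqP; rewrite eq_le yn.
rewrite mul1r clip_id ?yr// e.
rewrite ge_max le_max (ltW yp) andbT (leNgt y 0) yp orbF.
have -> : (0 <= y - x <= eta) = (x <= y <= x + eta) by rewrite subr_ge0 lerBlDl.
by case: ifP; rewrite ?mulr0.
Qed.

Variables (rho0 : R -> R).
Hypothesis irho0 : mu.-integrable setT (EFin \o rho0).
Hypothesis hsol : nonlocal_entropy_solution rmax1 rmax2 eta v1 v2 w rho0 rho.

Let bu : bmeas (fun z : R * R => u z.1 z.2).
Proof. by case: hsol => mrho _ _ _; exact: bmeas_tame. Qed.

Let uM t x : `|u t x| <= M. Proof. exact: tame_le. Qed.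

Let but t : bmeas (u t).
Proof.
have mt : measurable_fun setT (fun x : R => (t, x)) by exact: measurable_fun_pair.
exact: (bmeas_comp mt bu).
Qed.

Lemma ae_in_range : {ae mu, forall t, 0 <= t -> in_range t}.
Proof.
case: hsol => _ /ae_xsection h _ _; apply: ae_mono h => t h t0.
by apply: ae_mono h => y /= /(_ t0).
Qed.

Let bmeas_indicator (I : set R) : measurable I -> bmeas (\1_I : R -> R).
Proof.
move=> mI; split; first exact: measurable_indic.
by exists 1 => z; rewrite indicE normr_nat lern1 leq_b1.
Qed.

Lemma left_speedP t : [/\ bmeas (left_speed u t), forall y, 0 <= left_speed u t y <= v1 0 &
  forall y, 0 <= y -> left_speed u t y = 0].
Proof.
have vr r := velocity_clip_range rmax10 hv1 r.
have v0 : 0 <= v1 0 by case/andP: (vr 0); exact: le_trans.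
split=> [|y|y y0].
- apply: bmeasM; first by apply: bmeas_indicator; exact: measurable_itv.
  split; first exact: measurableT_comp (measurable_velocity_clip rmax10 hv1) (but t).1.
  by exists (v1 0) => y; have /andP[h1 h2] := vr (u t y); rewrite ger0_norm.
- by rewrite /left_speed indicE; case: (_ \in _); rewrite ?mul1r ?mul0r ?lexx.
- by rewrite /left_speed indicE memNset ?mul0r//= in_itv/= ltNge y0.
Qed.

Lemma right_speedP t : [/\ bmeas (right_speed u t), forall y, 0 <= right_speed u t y <= v2 0 &
  forall y, y <= 0 -> right_speed u t y = 0].
Proof.
have vr r := velocity_clip_range rmax20 hv2 r.
have v0 : 0 <= v2 0 by case/andP: (vr 0); exact: le_trans.
split=> [|y|y y0].
- apply: bmeasM; first by apply: bmeas_indicator; exact: measurable_itv.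
  split; first exact: measurableT_comp (measurable_velocity_clip rmax20 hv2) (but t).1.
  by exists (v2 0) => y; have /andP[h1 h2] := vr (u t y); rewrite ger0_norm.
- by rewrite /right_speed indicE; case: (_ \in _); rewrite ?mul1r ?mul0r ?lexx.
- by rewrite /right_speed indicE memNset ?mul0r//= in_itv/= andbT ltNge y0.
Qed.

Let F1_ge0 : 0 <= v1 0.
Proof. by have /andP[] := velocity_clip_range rmax10 hv1 0; exact: le_trans. Qed.

Let F2_ge0 : 0 <= v2 0.
Proof. by have /andP[] := velocity_clip_range rmax20 hv2 0; exact: le_trans. Qed.

(** The interval [-2 eta, 2 eta] contains every window [x, x + eta] with |x| <= B <= eta. *)
Definition local_mass (B : R) (z : R * R) : R :=
  \1_(`[0, B]%classic : set R) z.1 *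
    (\1_(`[- (2 * eta), 2 * eta]%classic : set R) z.2 * `|u z.1 z.2|).

Lemma bmeas_local_mass B : bmeas (local_mass B).
Proof.
apply: bmeasM; first by apply: bmeas_fst; apply: bmeas_indicator; exact: measurable_itv.
apply: bmeasM; first by apply: bmeas_snd; apply: bmeas_indicator; exact: measurable_itv.
exact: bmeas_norm.
Qed.

Lemma local_mass_supp B z : ~ box (`|B| + 2 * eta) z -> local_mass B z = 0.
Proof.
case: z => t y /not_boxP h; rewrite /local_mass/=; case: h => h.
  rewrite indicE memNset ?mul0r//= in_itv/= => /andP[t0 tB].
  by move: h; rewrite (ger0_norm t0); have := ler_norm B; have := eta0; lra.
rewrite [X in _ * (X * _)]indicE memNset ?mul0r ?mulr0//= in_itv/= -ler_norml.
by move: h; have := normr_ge0 B; lra.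
Qed.

Lemma L1_bound B : (4%:E * \int[pi]_z (local_mass B z)%:E <=
  ((cone_radius (v1 0 + v2 0) (Num.max B 1) ^+ 2) ^+ 2)%:E * \int[mu]_x `|(rho0 x)%:E|)%E.
Proof.
(* For kappa = 0 the terms in d_x V vanish; the cone is as wide as the window. *)
pose V := v1 0 + v2 0; pose N := Num.max B 1; pose l := (2 * eta)^-1.
have V0 : 0 <= V by rewrite addr_ge0.
have N0 : 0 <= N by rewrite le_max ler01 orbT.
have e20 : 0 < 2 * eta by rewrite mulr_gt0.
have l0 : 0 < l by rewrite invr_gt0.
have l1 : l <= 1 by rewrite invf_le1//; have := eta1; lra.
have [tphi et ex] := C1plane_test_function (C1plane_cone V N l)
  (@cone_fun_supp R V N l V0 l0 l1) (fun t x _ => cone_fun_ge0 V N l t x).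
have := hsol; case=> mrho _ _ /(_ 0 _ tphi).
rewrite /nonlocal_entropy_inequality => ineq.
have bmass := bmeas_local_mass B; have mass_supp := local_mass_supp (B := B).
pose D := `|B| + 2 * eta.
have le1 : (\int[mu]_(t in `[0%R, +oo[) \int[mu]_x
     (`|rho t x - 0| * derive1 ((cone_fun V N l)^~ x) t
      + `|rho t x - 0| * V1 eta v1 w rho t x * derive1 (cone_fun V N l t) x
      + Num.sg (rho t x - 0) * (trunc rmax2 (rho t x) - trunc rmax2 0)
          * V2 eta v2 w rho t x * derive1 (cone_fun V N l t) x
      - Num.sg (rho t x - 0) * 0 * derive1 (V1 eta v1 w rho t) x * cone_fun V N l t x
      - Num.sg (rho t x - 0) * trunc rmax2 0 * derive1 (V2 eta v2 w rho t) x * cone_fun V N l t x)%:E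
   <= \int[mu]_(t in `[0%R, +oo[) \int[mu]_x (- 4 * local_mass B (t, x))%:E)%E.
  apply: ae_le_integral_nomeas; apply: ae_mono ae_in_range => t ht.
  rewrite /= in_itv/= andbT => t0; have {}ht := ht t0.
  apply: ae_le_integral_nomeas; apply: ae_mono (in_range_tame t0 ht) => x [x0 e ul ur u0] _.
  rewrite lee_fin e et ex (V1_window x t0 ht) (V2_window x t0 ht).
  have [Wm Wb Wn Wi] := admissible_kernelP eta0 hw.
  have [bl lb _] := left_speedP t; have [br rb _] := right_speedP t.
  have Wneg y : y < 0 -> W y = 0 by rewrite /W extended_kernelE ltNge => /negbTE ->.
  have Wfar y : eta < y -> W y = 0.
    by rewrite /W extended_kernelE ltNge => /negbTE ->; rewrite andbF.
  have s1 : 0 <= window_average W (left_speed u t) x <= v1 0.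
    rewrite (window_average_ge0 Wb)/=; last by move=> y; case/andP: (lb y).
    by apply: (window_average_le (eta := eta) Wm Wb Wneg Wfar Wi) => // y; case/andP: (lb y).
  have s2 : 0 <= window_average W (right_speed u t) x <= v2 0.
    rewrite (window_average_ge0 Wb)/=; last by move=> y; case/andP: (rb y).
    by apply: (window_average_le (eta := eta) Wm Wb Wneg Wfar Wi) => // y; case/andP: (rb y).
  move: s1 s2; set S1 := window_average _ _ _; set S2 := window_average _ _ _ => /andP[s10 s11] /andP[s20 s21].
  have -> : trunc rmax2 0 = 0 by rewrite /trunc min_l// ltW.
  have q1 := trunc_lip rmax2 (u t x) 0.
  have q2 := sg_trunc rmax2 (u t x) 0.
  have t00 : trunc rmax2 0 = 0 by rewrite /trunc min_l// ltW.
  move: q1 q2; rewrite t00 subr0 !subr0 => q1 ->.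
  have q0 := normr_ge0 (trunc rmax2 (u t x)).
  move: q1 q0; rewrite (ger0_norm u0); set q := `|trunc _ _|; set r := u t x => q1 q0.
  have diss := @cone_dissipation R V N l V0 l0 l1 t x t0.
  have low := @cone_dissipation_low R V N l V0 N0 l0 l1 t x t0.
  have mx : 0 <= Num.max (cone_parab V N l t x) 0 by rewrite le_max lexx orbT.
  move: diss low; set ft := cone_dt _ _ _ _ _; set fx := cone_dx _ _ _ _ _ => diss low.
  have fx1 : fx <= `|fx| := ler_norm fx.
  have fx0 := normr_ge0 fx.
  have b1 : r * S1 * fx <= r * v1 0 * `|fx|.
    apply: (@le_trans _ _ (r * S1 * `|fx|)); first by rewrite ler_wpM2l// mulr_ge0.
    by rewrite ler_wpM2r// ler_wpM2l.
  have b2 : q * S2 * fx <= r * v2 0 * `|fx|.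
    apply: (@le_trans _ _ (q * S2 * `|fx|)); first by rewrite ler_wpM2l// mulr_ge0.
    by rewrite ler_wpM2r//; apply: ler_pM.
  have b3 : r * ft + r * V * `|fx| <= - 4 * local_mass B (t, x).
    have neg : 0 <= r * (- ft - V * `|fx|) by rewrite mulr_ge0//; lra.
    rewrite /local_mass/=.
    have [tB|tB] := leP t B; last first.
      by rewrite indicE memNset ?mul0r ?mulr0/=; [lra|by rewrite in_itv/= => /andP[_]; rewrite leNgt tB].
    rewrite indicE mem_set ?mul1r; last by rewrite /= in_itv/= t0.
    have [xe|xe] := leP `|x| (2 * eta); last first.
      rewrite indicE memNset ?mul0r ?mulr0/=; first by lra.
      by rewrite in_itv/= -ler_norml leNgt xe.
    rewrite indicE mem_set ?mul1r; last by rewrite /= in_itv/= -ler_norml.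
    rewrite (ger0_norm u0) -/r.
    (* With slope l = 1/(2 eta), the window |x| <= 2 eta becomes |l x| <= 1, and 1 <= N by the
       choice of N. *)
    have h4 : 4 <= - ft - V * `|fx|.
      apply: low; first by rewrite le_max tB.
      rewrite normrM (gtr0_norm l0) /l mulrC ler_pdivrMr//.
      apply: (le_trans xe); apply: ler_peMl; first exact: ltW.
      by rewrite /N le_max lexx orbT.
    have := ler_wpM2l u0 h4; rewrite -/r; lra.
  by move: b1 b2 b3; rewrite /V; lra.
have le2 : (\int[mu]_x (`|rho0 x - 0| * cone_fun V N l 0 x)%:E <=
    ((cone_radius V N ^+ 2) ^+ 2)%:E * \int[mu]_x `|(rho0 x)%:E|)%E.
  have mr : measurable_fun setT (fun x => `|(rho0 x)%:E|)%E.
    by apply: measurableT_comp => //; exact: measurable_int irho0.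
  rewrite -ge0_integralZl//; last by rewrite lee_fin sqr_ge0.
  apply: ae_le_integral_nomeas; apply: aeW => x _.
  rewrite subr0 abse_EFin -EFinM lee_fin mulrC ler_wpM2r//.
  exact: cone_fun_le.
move: (le_trans ineq (leeD le1 le2)).
rewrite (@iterated_half_plane _ D (fun z => - 4 * local_mass B z)); last first.
- by move=> z /mass_supp ->; rewrite mulr0.
- by apply: bmeasM => //; exact: bmeas_cst.
have imass := bmeas_integrable_box bmass mass_supp.
rewrite (_ : \int[pi]_z _ = (- 4)%:E * \int[pi]_z (local_mass B z)%:E)%E; last first.
  rewrite -integralZl//; apply: eq_integral => -[t x] _ /=; rewrite -EFinM; congr (_%:E).
  have [t0|t0] := ltP t 0; last by rewrite hline1// mul1r.
  rewrite hline0// mul0r /local_mass/= indicE memNset ?mul0r ?mulr0//=.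
  by rewrite in_itv/= leNgt t0.
have fm := integrable_fin_num measurableT imass.
rewrite -/V -/N; move: (_ * \int[mu]_x _)%E => X.
rewrite -(fineK fm); case: X => [X| |] //=; rewrite -?EFinM -?EFinD ?lee_fin ?leey//; lra.
Qed.

Definition mass_total (B t : R) : R := \int[mu]_y local_mass B (t, y).

Lemma mass_totalP B : [/\ bmeas (mass_total B), forall t, 0 <= mass_total B t,
  forall t, ~ `[0, B]%classic t -> mass_total B t = 0 &
  (\int[mu]_t (mass_total B t)%:E = \int[pi]_z (local_mass B z)%:E)%E].
Proof.
have bm := bmeas_local_mass B; have sm := local_mass_supp (B := B).
have [_ /measurable_int mJ _ eJ _] := bmeas_fubini2 bm (fun x y => sm (x, y)).
have ge0 t : 0 <= mass_total B t.
  by apply: Rintegral_ge0 => y _; rewrite /local_mass !indicE !mulr_ge0.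
have le1 t : (\int[mu]_y (local_mass B (t, y))%:E <= (M * (4 * eta))%:E)%E.
  have e4 : M * (4 * eta) = M * (2 * eta - - (2 * eta)) by ring.
  rewrite e4; apply: integral_le_cst_itv.
  - by have := eta0; lra.
  - move=> y _; rewrite /local_mass/= !indicE -[leRHS]mul1r ler_pM ?mulr_ge0//.
      by case: (_ \in _).
    by rewrite -[leRHS]mul1r ler_pM//; case: (_ \in _).
  - by move=> y ye; rewrite /local_mass/= [X in _ * (X * _)]indicE memNset// mul0r mulr0.
have e t : (mass_total B t)%:E = (\int[mu]_y (local_mass B (t, y))%:E)%E.
  rewrite /mass_total /Rintegral fineK// ge0_fin_numE; first exact: le_lt_trans (le1 t) (ltry _).
  by apply: integral_ge0 => y _; rewrite lee_fin /local_mass !indicE !mulr_ge0.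
split=> //.
- split; last by exists (M * (4 * eta)) => t; rewrite ger0_norm// -lee_fin e.
  by apply/measurable_EFinP; apply: eq_measurable_fun mJ => t _; rewrite /= e.
- move=> t tB; rewrite /mass_total /Rintegral integral0_eq// => y _.
  by rewrite /local_mass/= indicE memNset// mul0r.
- by under eq_integral => t _ do rewrite e.
Qed.

(* The four summands free of [J] come from V_1, the part of V_2 - v_2(0) lost at
   the junction, d_x V_1 and d_x V_2; the mass [J] enters through the Lipschitz
   bound |v_2(rho) - v_2(0)| <= K rho. *)
Definition flux_error (K B w0 J : R) : R :=
  w0 * (((M + B) * (v1 0 * B) * B + (M + B) * (v2 0 * B) * B
         + B * (2 * v1 0) * B + (B + rmax2) * (2 * v2 0) * B)
        + (M + B) * K * B * J).

Lemma integrand_le K B kappa t x pt px ph :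
  (forall r s, 0 <= r <= rmax2 -> 0 <= s <= rmax2 -> `|v2 r - v2 s| <= K * `|r - s|) ->
  0 <= K -> 0 <= t <= B -> `|x| <= B -> B <= eta -> in_range t ->
  [/\ x != 0, rho t x = u t x & 0 <= u t x] ->
  `|kappa| <= B -> `|px| <= B -> 0 <= ph <= B ->
  `|rho t x - kappa| * pt
  + `|rho t x - kappa| * V1 eta v1 w rho t x * px
  + Num.sg (rho t x - kappa) * (trunc rmax2 (rho t x) - trunc rmax2 kappa)
      * V2 eta v2 w rho t x * px
  - Num.sg (rho t x - kappa) * kappa * derive1 (V1 eta v1 w rho t) x * ph
  - Num.sg (rho t x - kappa) * trunc rmax2 kappa * derive1 (V2 eta v2 w rho t) x * ph
  <= `|u t x - kappa| * pt + fluxdist (v2 0) rmax2 (u t x) kappa * px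
     + flux_error K B (w 0) (mass_total B t).
Proof.
move=> vK K0 /andP[t0 tB] xB Beta ht [x0 -> u0] kB pxB /andP[ph0 phB].
have [Wm Wb Wn Wi] := admissible_kernelP eta0 hw.
have [bl lb l0] := left_speedP t; have [br rb r0] := right_speedP t.
have Wneg y : y < 0 -> W y = 0 by rewrite /W extended_kernelE ltNge => /negbTE ->.
have Wfar y : eta < y -> W y = 0.
  by rewrite /W extended_kernelE ltNge => /negbTE ->; rewrite andbF.
have e1 : V1 eta v1 w rho t = window_average W (left_speed u t).
  by apply/funext => y; rewrite V1_window.
have e2 : V2 eta v2 w rho t = window_average W (right_speed u t).
  by apply/funext => y; rewrite V2_window.
have d1 : `|derive1 (V1 eta v1 w rho t) x| <= 2 * v1 0 * w 0.
  by rewrite e1; exact: (window_average_derive1 (eta := eta)).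
have d2 : `|derive1 (V2 eta v2 w rho t) x| <= 2 * v2 0 * w 0.
  by rewrite e2; exact: (window_average_derive1 (eta := eta)).
have s1 : `|V1 eta v1 w rho t x| <= v1 0 * w 0 * B.
  rewrite e1 ger0_norm; first exact: (window_average_left (eta := eta) Wm Wb Wneg Wfar bl lb l0 xB).
  by apply: (window_average_ge0 Wb) => y; case/andP: (lb y).
have s2 : `|V2 eta v2 w rho t x - v2 0| <= w 0 * (v2 0 * B + K * mass_total B t).
  have bg : bmeas (fun y => local_mass B (t, y)).
    rewrite /local_mass/=; apply: bmeasM; first exact: bmeas_cst.
    by apply: bmeasM; [apply: bmeas_indicator; exact: measurable_itv|exact: bmeas_norm].
  rewrite e2; apply: (window_average_right (eta := eta) Wm Wb Wneg Wfar Wi br bg F2_ge0 K0 xB Beta r0).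
  - by move=> y; rewrite /local_mass !indicE !mulr_ge0.
  - by move=> y /= ye; rewrite /local_mass/= [X in _ * (X * _)]indicE memNset ?mul0r ?mulr0.
  - move=> y y0 ye; rewrite /local_mass/= !indicE mem_set/=; last by rewrite in_itv/= t0.
    rewrite mem_set/=; last by rewrite in_itv/= ye andbT; have := eta0; lra.
    rewrite /right_speed indicE mem_set/=; last by rewrite in_itv/= y0.
    rewrite !mul1r (le_trans (vK _ _ (clip_range rmax20 _) _))//; first by rewrite lexx ltW.
    have /andP[q0 _] := clip_range rmax20 (u t y).
    rewrite subr0 ler_wpM2l// (ger0_norm q0) /clip ge_min; apply/orP; left.
    by rewrite ge_max normr_ge0 ler_norm.
have J0 : 0 <= mass_total B t.
  by apply: Rintegral_ge0 => y _; rewrite /local_mass !indicE !mulr_ge0.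
have sg1 : `|Num.sg (u t x - kappa)| <= 1 by rewrite normr_sg; case: (_ == _).
have B0 : 0 <= B by exact: le_trans t0 tB.
have w00 : 0 <= w 0 by have /andP[] := Wb 0; exact: le_trans.
have rB : `|u t x - kappa| <= M + B by rewrite (le_trans (ler_normB _ _))// lerD.
have gB : `|trunc rmax2 kappa| <= B + rmax2.
  rewrite /trunc; have [_|_] := leP kappa rmax2.
    by rewrite (le_trans kB)// lerDl ltW.
  by rewrite ger0_norm ?lerDr// ltW.
have gk : `| `|trunc rmax2 (u t x) - trunc rmax2 kappa| | <= M + B.
  by rewrite normr_id (le_trans (trunc_lip _ _ _)).
rewrite sg_trunc /fluxdist.
have b1 : `|u t x - kappa| * V1 eta v1 w rho t x * px <= (M + B) * (v1 0 * w 0 * B) * B.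
  by apply: prod3_le => //; rewrite normr_id.
have b2 : `|trunc rmax2 (u t x) - trunc rmax2 kappa| * (V2 eta v2 w rho t x - v2 0) * px
    <= (M + B) * (w 0 * (v2 0 * B + K * mass_total B t)) * B by exact: prod3_le.
have b3 : (Num.sg (u t x - kappa) * (- kappa)) * derive1 (V1 eta v1 w rho t) x * ph
    <= B * (2 * v1 0 * w 0) * B.
  apply: prod3_le => //; last by rewrite ger0_norm.
  by rewrite normrM normrN -[leRHS]mul1r; apply: ler_pM.
have b4 : (Num.sg (u t x - kappa) * (- trunc rmax2 kappa)) * derive1 (V2 eta v2 w rho t) x * ph
    <= (B + rmax2) * (2 * v2 0 * w 0) * B.
  apply: prod3_le => //; last by rewrite ger0_norm.
  by rewrite normrM normrN -[leRHS]mul1r; apply: ler_pM.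
rewrite /flux_error; move: b1 b2 b3 b4; lra.
Qed.

(** Free of [eta]: widening the cone changes its slope [l], and [cone_radius] does not involve the
    slope. *)
Definition mass_bound (B : R) : R :=
  (cone_radius (v1 0 + v2 0) (Num.max B 1) ^+ 2) ^+ 2 * fine (\int[mu]_x `|(rho0 x)%:E|)%E.

(** The error is affine in the mass, so its time integral involves the mass only through
    [mass_bound]; the crude bound on a window of length 4 eta would grow with eta. *)
Lemma flux_errorE K B w0 J :
  flux_error K B w0 J = flux_error K B w0 0 + w0 * ((M + B) * K * B) * J.
Proof. by rewrite /flux_error; ring. Qed.

Lemma mass_le B : (\int[pi]_z (local_mass B z)%:E <= (mass_bound B)%:E)%E.
Proof.
have fm := integrable_fin_num measurableT (bmeas_integrable_box (bmeas_local_mass B) (@local_mass_supp B)).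
have f0 : (\int[mu]_x `|(rho0 x)%:E|)%E \is a fin_num.
  rewrite ge0_fin_numE; last by apply: integral_ge0.
  by have /integrableP[] := irho0.
have := L1_bound B; rewrite -(fineK f0) -(fineK fm) -!EFinM !lee_fin -/(mass_bound B).
have : 0 <= fine (\int[pi]_z (local_mass B z)%:E).
  by apply: fine_ge0; apply: integral_ge0 => z _; rewrite lee_fin /local_mass !indicE !mulr_ge0.
lra.
Qed.

(** The pointwise error of [integrand_le] is charged on [0, B] x [-B, B], where the test function
    lives. The width in x gives 2B, and integration in time gives B for the part free of the mass
    and [mass_bound B] for the rest. Everything is proportional to w(0). *)
Lemma nonlocal_entropy_solution_approx K B r0 :
  (forall r s, 0 <= r <= rmax2 -> 0 <= s <= rmax2 -> `|v2 r - v2 s| <= K * `|r - s|) ->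
  0 <= K -> B <= eta -> {ae mu, forall x, rho0 x = r0 x} ->
  approx_entropy (v2 0) rmax2 B (2 * B * (flux_error K B (w 0) 0 * B
    + w 0 * ((M + B) * K * B) * mass_bound B)) r0 u.
Proof.
move=> vK K0 Beta rE kappa phi kB tphi sB phiB.
have B0 : 0 <= B by exact: le_trans kB.
have w00 : 0 <= w 0.
  by have [_ Wb _ _] := admissible_kernelP eta0 hw; have /andP[] := Wb 0; exact: le_trans.
have [st sx] := box_supported_derive1 sB.
have [Bp [_ _ bnd _ _]] := test_function_box tphi.
have bt : bmeas (fun z : R * R => derive1 (phi^~ z.2) z.1).
  split; last by exists Bp => z; exact: (bnd z.1 z.2).2.1.
  by case: tphi => _ ct _ _ _; exact: continuous_measurable_plane.
have bx : bmeas (fun z : R * R => derive1 (phi z.1) z.2).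
  split; last by exists Bp => z; exact: (bnd z.1 z.2).2.2.
  by case: tphi => _ _ cx _ _; exact: continuous_measurable_plane.
pose loc (z : R * R) := `|u z.1 z.2 - kappa| * derive1 (phi^~ z.2) z.1
  + fluxdist (v2 0) rmax2 (u z.1 z.2) kappa * derive1 (phi z.1) z.2.
have bloc : bmeas loc.
  apply: bmeasD; apply: bmeasM => //.
    by apply: bmeas_norm; apply: bmeasB => //; exact: bmeas_cst.
  by apply: bmeas_fluxdist => //; exact: bmeas_cst.
have loc0 z : ~ box B z -> loc z = 0.
  by case: z => t x /not_boxP h; rewrite /loc/= st// sx// !mulr0 addr0.
have [bJ J0 JB iJ] := mass_totalP B.
have feJ J : 0 <= J -> 0 <= flux_error K B (w 0) J.
  move=> J_ge0; rewrite /flux_error; have := F1_ge0; have := F2_ge0; have := rmax20; have := M0 => *.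
  by rewrite mulr_ge0// !addr_ge0// !mulr_ge0 ?addr_ge0// ltW.
pose err (z : R * R) := \1_(`[- B, B]%classic : set R) z.2 *
  (\1_(`[0, B]%classic : set R) z.1 * flux_error K B (w 0) (mass_total B z.1)).
have berr : bmeas err.
  apply: bmeasM; first by apply: bmeas_snd; apply: bmeas_indicator; exact: measurable_itv.
  apply: (bmeas_fst (f := fun t => \1_(`[0, B]%classic : set R) t * flux_error K B (w 0) (mass_total B t))).
  apply: bmeasM; first by apply: bmeas_indicator; exact: measurable_itv.
  apply: bmeasM; first exact: bmeas_cst.
  by apply: bmeasD; [exact: bmeas_cst|apply: bmeasM => //; exact: bmeas_cst].
have err0 z : ~ box B z -> err z = 0.
  case: z => t x /not_boxP h; rewrite /err/=; case: h => h.
    rewrite [X in _ * (X * _)]indicE memNset ?mul0r ?mulr0//= in_itv/= => /andP[t0 tB].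
    by move: h; rewrite ger0_norm// ltNge tB.
  by rewrite indicE memNset ?mul0r//= in_itv/= -ler_norml leNgt h.
have err_ge0 z : 0 <= err z by rewrite /err !indicE mulr_ge0// mulr_ge0// feJ.
have ierr : (\int[pi]_z (err z)%:E <= (2 * B * (flux_error K B (w 0) 0 * B
    + w 0 * ((M + B) * K * B) * mass_bound B))%:E)%E.
  have [_ _ _ <- _] := bmeas_fubini2 berr (fun x y => err0 (x, y)).
  pose a := 2 * B * flux_error K B (w 0) 0.
  pose b := 2 * B * (w 0 * ((M + B) * K * B)).
  have b0 : 0 <= b by rewrite /b !mulr_ge0 ?addr_ge0 // ltW.
  have a0 : 0 <= a by rewrite /a mulr_ge0 ?feJ// mulr_ge0.
  apply: (@le_trans _ _ (\int[mu]_t (a * \1_(`[0, B]%classic : set R) t + b * mass_total B t)%:E)%E).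
    apply: ae_le_integral_nomeas; apply: aeW => t _.
    apply: le_trans; first apply: (@integral_le_cst_itv _ (- B) B
      (\1_(`[0, B]%classic : set R) t * flux_error K B (w 0) (mass_total B t))).
    - by lra.
    - by move=> x xB; rewrite /err/= [X in X * _]indicE mem_set// mul1r.
    - by move=> x xB; rewrite /err/= [X in X * _]indicE memNset// mul0r.
    rewrite lee_fin flux_errorE /a /b indicE; have := J0 t.
    set J := mass_total B t => hJ; have := mulr_ge0 b0 hJ; rewrite /b.
    by case: (_ \in _) => /=; rewrite ?mulr1n ?mulr0n; lra.
  have i1 : mu.-integrable setT (EFin \o (fun t => a * \1_(`[0, B]%classic : set R) t)).
    apply: (@bmeas_integrable_itv _ 0 B).
      by apply: bmeasM; [exact: bmeas_cst|apply: bmeas_indicator; exact: measurable_itv].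
    by move=> t tB; rewrite indicE memNset// mulr0.
  have i2 : mu.-integrable setT (EFin \o mass_total B) by exact: (@bmeas_integrable_itv _ 0 B).
  have i3 : mu.-integrable setT (fun t => b%:E * (mass_total B t)%:E)%E.
    exact: integrableZl.
  under eq_integral => t _ do rewrite EFinD (EFinM b).
  rewrite integralD//= (integralZl _ i2)// iJ.
  rewrite (_ : (2 * B * _) = a * B + b * mass_bound B); last by rewrite /a /b; ring.
  rewrite EFinD leeD//; last by rewrite (EFinM b) lee_wpmul2l ?lee_fin// mass_le.
  rewrite -[X in (_ <= (_ * X)%:E)%E]subr0; apply: integral_le_cst_itv => //.
  - by move=> t tB; rewrite indicE mem_set// mulr1.
  - by move=> t tB; rewrite indicE memNset// mulr0.
have := hsol; case=> _ _ _ /(_ kappa _ tphi); rewrite /nonlocal_entropy_inequality (initE rE) => ineq.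
set I := (X in (_ <= _ + X + _)%E) in ineq *.
apply: (le_trans ineq); rewrite -/I addeAC leeD2r//.
have ploc := @iterated_half_plane _ B loc bloc loc0.
rewrite [X in (_ <= X + _)%E](_ : _ = \int[pi]_z (\1_hline z.1 * loc z)%:E)%E//.
have iloc : pi.-integrable setT (EFin \o (fun z => \1_hline z.1 * loc z)).
  apply: (@bmeas_integrable_box _ B); first by apply: bmeasM => //; apply: bmeas_fst; exact: bmeas_hline.
  by move=> z /loc0 ->; rewrite mulr0.
apply: (@le_trans _ _ (\int[mu]_(t in `[0%R, +oo[) \int[mu]_x (loc (t, x) + err (t, x))%:E)%E).
  apply: ae_le_integral_nomeas; apply: ae_mono ae_in_range => t ht.
  rewrite /= in_itv/= andbT => t0; have {}ht := ht t0.
  apply: ae_le_integral_nomeas; apply: ae_mono (in_range_tame t0 ht) => x [x0 e ul ur u0] _.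
  rewrite lee_fin.
  have [/boxP[tB xB]|nb] := pselect (box B (t, x)); last first.
    rewrite err0// loc0//; move/not_boxP: nb => nb.
    by rewrite (sB _ _ nb) (st _ _ nb) (sx _ _ nb) !mulr0 !(subr0, addr0).
  rewrite ger0_norm// in tB.
  have := @integrand_le K B kappa t x (derive1 (phi^~ x) t) (derive1 (phi t) x) (phi t x) vK K0.
  rewrite t0 tB => /(_ isT xB Beta ht) h; apply: (le_trans (h _ _ _ _)) => //.
  - exact: (phiB t x t0).2.
  - by case: tphi => _ _ _ _ /(_ t x t0) ->; rewrite (le_trans (ler_norm _))//; exact: (phiB t x t0).1.
  - rewrite lerD2l /err/= !indicE mem_set/=; last by rewrite in_itv/= -ler_norml.
    by rewrite mem_set/= ?in_itv/= ?t0// !mul1r.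
rewrite (@iterated_half_plane _ B (fun z => loc z + err z)); first last.
- by move=> z nb; rewrite loc0// err0// addr0.
- exact: bmeasD.
have ierr' : pi.-integrable setT (EFin \o (fun z => \1_hline z.1 * err z)).
  apply: (@bmeas_integrable_box _ B); first by apply: bmeasM => //; apply: bmeas_fst; exact: bmeas_hline.
  by move=> z /err0 ->; rewrite mulr0.
under eq_integral => z _ do rewrite mulrDr EFinD.
rewrite integralD//= leeD2l//; apply: le_trans ierr.
apply: ae_le_integral_nomeas; apply: aeW => z _; rewrite lee_fin.
by rewrite /hline indicE ler_piMl//; case: (_ \in _).
Qed.

End nonlocal.

(** * Convergence *)

Section convergence.
Context {R : realType}.
Local Notation mu := (@lebesgue_measure R).
Local Notation pi := (@lebesgue_plane R).

Definition half_box (N : R) : set (R * R) := `[0, N]%classic `*` `[- N, N]%classic.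

Lemma measurable_half_box N : measurable (half_box N).
Proof. by apply: measurableX; exact: measurable_itv. Qed.

Lemma half_boxP N t x : half_box N (t, x) <-> (0 <= t <= N) /\ `|x| <= N.
Proof. by rewrite /half_box /= !in_itv/= ler_norml. Qed.

Lemma half_box_exhausts (z : R * R) : 0 <= z.1 ->
  exists N : nat, forall k, (N <= k)%N -> half_box k%:R z.
Proof.
case: z => t x /= t0; exists (Num.truncn (t + `|x|)).+1 => k Nk; apply/half_boxP.
have : t + `|x| <= k%:R.
  by rewrite (le_trans (ltW (truncnS_gt _)))// ler_nat.
by rewrite t0/=; have := normr_ge0 x; split; lra.
Qed.

(** The increments, each cut off to its own box, have a summable L^1 norm, so their sum is finite
    almost everywhere. A fixed point lies in all late boxes, hence its increments are eventually the
    full ones. *)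
Lemma fast_cauchy_ae (V : nat -> R * R -> R) : (forall k, bmeas (V k)) ->
  (forall k, \int[pi]_(z in half_box k%:R) `|V k z - V k.+1 z|%:E <=
     (1 / (2 ^ k.+1)%:R)%:E)%E ->
  {ae pi, forall z, 0 <= z.1 -> cvgn (fun k => V k z)}.
Proof.
move=> bV hV; pose f k z := \1_(half_box k%:R) z * `|V k z - V k.+1 z|.
have f0 k z : 0 <= f k z by rewrite /f indicE mulr_ge0.
have mf k : measurable_fun setT (EFin \o f k).
  apply/measurable_EFinP; apply: measurable_funM.
    by apply: measurable_indic; exact: measurable_half_box.
  by apply: (bmeas_norm _).1; exact: bmeasB.
have mS : measurable_fun setT (fun z => \sum_(k <oo) (f k z)%:E)%E.
  apply: (@ge0_emeasurable_sum _ _ R setT (fun k z => (f k z)%:E) xpredT) => k *; last exact: mf.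
  by rewrite lee_fin.
have S0 z : (0 <= \sum_(k <oo) (f k z)%:E)%E.
  by apply: nneseries_ge0 => k _ _; rewrite lee_fin.
have iS : pi.-integrable setT (fun z => \sum_(k <oo) (f k z)%:E)%E.
  apply/integrableP; split=> //.
  under eq_integral => z _ do rewrite gee0_abs//.
  rewrite integral_nneseries//; last by move=> n z _; rewrite lee_fin.
  apply: (@le_lt_trans _ _ (\sum_(k <oo) (1 / (2 ^ k.+1)%:R)%:E)%E).
    apply: lee_nneseries => k _; first by move=> *; apply: integral_ge0 => z _; rewrite lee_fin.
    apply: le_trans (hV k); rewrite [leRHS]integral_mkcond.
    apply: ae_le_integral_nomeas; apply: aeW => z _; rewrite patchE /f indicE.
    by case: (_ \in _); rewrite ?mul1r ?mul0r.
  by apply: le_lt_trans (epsilon_trick0 _ _) _; rewrite ?ltry.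
apply: ae_mono (integrable_ae measurableT iS) => z /(_ I) fin t0.
have [N hN] := half_box_exhausts t0.
pose d k := \1_(half_box k%:R) z * (V k.+1 z - V k z).
have cd : cvgn (series d).
  apply: normed_cvg; apply: nondecreasing_is_cvgn.
    by apply: nondecreasing_series => *; exact: normr_ge0.
  exists (fine (\sum_(k <oo) (f k z)%:E)%E) => _ [n _ <-] /=.
  rewrite -lee_fin fineK//; apply: le_trans (nneseries_lim_ge n _); last by move=> *; rewrite lee_fin.
  rewrite -sumEFin; apply: lee_sum => k _; rewrite lee_fin /d /f normrM distrC.
  by rewrite indicE normr_nat.
have -> : (fun k => V k z) = (fun k => (V k z - series d k) + series d k).
  by apply/funext => k; rewrite subrK.
apply: is_cvgD => //; apply/cvg_ex; exists (V N z - series d N).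
apply: cvg_near_cst; exists N => // k /= Nk.
have e : series d k = series d N + (V k z - V N z).
  rewrite /series/= (big_cat_nat (n := N) (p := k))//=; congr (_ + _).
  rewrite -(@telescope_sumr _ N k (fun i => V i z))//; apply: eq_big_nat => i /andP[Ni _].
  by rewrite /d indicE mem_set ?mul1r//; exact: hN.
by rewrite e; ring.
Qed.

Lemma limn_bound (M : R) (a : R^nat) : (forall k, `|a k| <= M) -> cvgn a -> `|limn a| <= M.
Proof.
move=> aM ca; rewrite ler_norml; apply/andP; split.
  by apply: limr_ge => //; apply: nearW => k; have := aM k; rewrite ler_norml => /andP[].
by apply: limr_le => //; apply: nearW => k; have := aM k; rewrite ler_norml => /andP[].
Qed.

Lemma approx_entropy_precompact (c m M : R) (r0 : R -> R) (U : R -> R -> R -> R) :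
  0 <= c -> bmeas r0 -> (forall x, `|r0 x| <= M) ->
  (forall eta, 0 < eta -> bmeas (fun z : R * R => U eta z.1 z.2)) ->
  (forall eta t x, `|U eta t x| <= M) ->
  (forall eta eta' t x, t < 0 -> U eta t x = U eta' t x) ->
  (forall B eps : R, 0 < eps -> exists E : R, forall eta, E <= eta ->
     approx_entropy c m B eps r0 (U eta)) ->
  exists e : nat -> R, exists u : R -> R -> R,
    [/\ forall k, k.+1%:R <= e k, bmeas (fun z : R * R => u z.1 z.2),
        forall t x, `|u t x| <= M &
        {ae pi, forall z : R * R, (fun k => U (e k) z.1 z.2) @ \oo --> u z.1 z.2}].
Proof.
move=> c0 br0 r0M bU UM Uneg aU.
have M0 : 0 <= M by exact: le_trans (r0M 0).
have /choice[E hE] (k : nat) : exists E : R, forall eta eta', 0 < eta -> 0 < eta' ->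
    E <= eta -> E <= eta' ->
    (\int[pi]_(z in half_box k%:R) `|U eta z.1 z.2 - U eta' z.1 z.2|%:E <=
      (1 / (2 ^ k.+1)%:R)%:E)%E.
  have tol0 : 0 < 1 / (2 ^ k.+1)%:R :> R by rewrite divr_gt0// ltr0n expn_gt0.
  have [B [eps [eps0 hB]]] := approx_entropy_stability m c0 (ler0n R k) br0 r0M tol0.
  have [E hE] := aU B eps eps0; exists E => eta eta' p p' Ee Ee'.
  by apply: hB => //; [exact: bU|exact: bU|exact: hE|exact: hE].
(* Partial sums dominate all thresholds so far, so that e k and e (k + 1) are both beyond E k, and
   they exceed k + 1. *)
pose e k := \sum_(i < k.+1) (`|E i| + 1).
have eS k : e k.+1 = e k + (`|E k.+1| + 1) by rewrite /e big_ord_recr.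
have Ee k : E k <= e k.
  rewrite /e big_ord_recr/=; have : 0 <= \sum_(i < k) (`|E i| + 1).
    by apply: sumr_ge0 => i _; rewrite addr_ge0.
  by have := ler_norm (E k); lra.
have ke k : k.+1%:R <= e k.
  elim: k => [|k IH]; first by rewrite /e big_ord_recr big_ord0/= add0r lerDr.
  by rewrite eS -natr1; have := normr_ge0 (E k.+1); lra.
have e0 k : 0 < e k by rewrite (lt_le_trans _ (ke k)).
have bUk k : bmeas (fun z : R * R => U (e k) z.1 z.2) by exact: bU.
have cU : {ae pi, forall z : R * R, cvgn (fun k => U (e k) z.1 z.2)}.
  have h := @fast_cauchy_ae (fun k z => U (e k) z.1 z.2) bUk.
  have {}h : {ae pi, forall z : R * R, 0 <= z.1 -> cvgn (fun k => U (e k) z.1 z.2)}.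
    by apply: h => k; apply: hE => //; rewrite eS (le_trans (Ee k))// lerDl addr_ge0.
  (* At negative times the family does not depend on eta, so the sequence is constant. *)
  apply: ae_mono h => z h; have [/h//|t0] := leP 0 z.1.
  rewrite (_ : (fun k => _) = (fun k => U (e 0) z.1 z.2)); first exact: is_cvg_cst.
  by apply/funext => k; exact: Uneg.
(* The upper limit is measurable on the whole plane, including the null set where the sequence may
   diverge. *)
have mlim : measurable_fun setT (fun z : R * R => limn_sup (fun k => U (e k) z.1 z.2)).
  apply: (@measurable_fun_limn_sup _ _ _ setT (fun k z => U (e k) z.1 z.2)).
  - by move=> z _; exists M => _ [k _ <-]; exact: le_trans (ler_norm _) (UM _ _ _).
  - by move=> z _; exists (- M) => _ [k _ <-]; have := UM (e k) z.1 z.2; rewrite ler_norml => /andP[].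
  - by move=> k; exact: (bUk k).1.
exists e, (fun t x => clamp M (limn_sup (fun k => U (e k) t x))); split=> //.
- split; first exact: measurable_clamp.
  by exists M => z; exact: clamp_le.
- by move=> t x; exact: clamp_le.
- apply: ae_mono cU => z cz; rewrite cvg_limn_supE// clamp_id//.
  exact: limn_bound.
Qed.

End convergence.

(** * The nonlocal family, uniqueness and convergence on compact sets *)

Section assembly.
Context {R : realType}.
Local Notation mu := (@lebesgue_measure R).
Local Notation pi := (@lebesgue_plane R).

Lemma approx_entropy_le (c m B eps eps' : R) r0 (u : R -> R -> R) : eps <= eps' ->
  approx_entropy c m B eps r0 u -> approx_entropy c m B eps' r0 u.
Proof.
move=> ee h kappa phi kB tphi sB pB; apply: le_trans (h _ _ kB tphi sB pB) _.
by rewrite leeD2l// lee_fin.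
Qed.

Lemma nonlocal_family_approx (rmax1 rmax2 : R) (v1 v2 : R -> R) (omega : R -> R -> R)
    (rho0 r0 : R -> R) (rhoeta : R -> R -> R -> R) :
  0 < rmax1 -> 0 < rmax2 -> admissible_velocity rmax1 v1 -> admissible_velocity rmax2 v2 ->
  (forall eta, 0 < eta -> admissible_kernel eta (omega eta)) ->
  omega eta 0 @[eta --> +oo] --> 0 ->
  mu.-integrable setT (EFin \o rho0) -> {ae mu, forall x, rho0 x = r0 x} ->
  (forall eta, 0 < eta -> nonlocal_entropy_solution rmax1 rmax2 eta v1 v2 (omega eta) rho0
     (rhoeta eta)) ->
  forall B eps : R, 0 < eps -> exists E : R, forall eta, E <= eta ->
    approx_entropy (v2 0) rmax2 B eps r0 (tame (rmax1 + rmax2) (rhoeta eta)).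
Proof.
move=> r1 r2 hv1 hv2 hw w0 irho0 rE hsol B eps eps0.
have [K K0 [vK _]] := admissible_velocityP r2 hv2.
pose C := 2 * B * (flux_error rmax1 rmax2 v1 v2 K B 1 0 * B
  + ((rmax1 + rmax2 + B) * K * B) * mass_bound v1 v2 rho0 B).
have C1 : 0 < `|C| + 1 by rewrite ltr_wpDl.
have /cvgrPdist_lt/(_ (eps / (`|C| + 1)))[|E [Er hE]] := w0; first by rewrite divr_gt0.
exists (`|E| + `|B| + 1) => eta Eeta.
have E0 := normr_ge0 E; have B0 := normr_ge0 B; have EE := ler_norm E; have BB := ler_norm B.
have eta1 : 1 <= eta by lra.
have eta0 : 0 < eta by lra.
have /hE : E < eta by lra.
rewrite sub0r normrN => wsmall.
apply: (approx_entropy_le _ (nonlocal_entropy_solution_approx r1 r2 hv1 hv2 eta1 (hw _ eta0)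
  irho0 (hsol _ eta0) vK K0 _ rE)); last by lra.
(* The error is linear in omega_eta(0), with a factor [C] that does not depend on eta. *)
rewrite (_ : (2 * B * _) = omega eta 0 * C); last by rewrite /C /flux_error; ring.
rewrite (le_trans (ler_norm _))// normrM.
apply: (@le_trans _ _ (`|omega eta 0| * (`|C| + 1))).
  by rewrite ler_wpM2l// lerDl.
by rewrite -ler_pdivlMr// ltW.
Qed.

Lemma ae_eq_half_plane (u v : R -> R -> R) :
  bmeas (fun z : R * R => u z.1 z.2) -> bmeas (fun z : R * R => v z.1 z.2) ->
  (forall N tol : R, 0 <= N -> 0 < tol ->
     (\int[pi]_(z in half_box N) `|u z.1 z.2 - v z.1 z.2|%:E <= tol%:E)%E) ->
  {ae pi, forall z : R * R, 0 <= z.1 -> u z.1 z.2 = v z.1 z.2}.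
Proof.
move=> bu bv h.
have {}h (k : nat) : {ae pi, forall z : R * R, half_box k%:R z -> u z.1 z.2 = v z.1 z.2}.
  have md : measurable_fun (half_box k%:R) (fun z : R * R => (u z.1 z.2 - v z.1 z.2)%:E).
    by apply: (@measurable_funTS); apply/measurable_EFinP; exact: (bmeasB bu bv).1.
  have : (\int[pi]_(z in half_box k%:R) `|(u z.1 z.2 - v z.1 z.2)%:E| = 0)%E.
    apply/eqP; rewrite eq_le integral_ge0// andbT.
    by apply/lee_addgt0Pr => tol tol0; rewrite add0e; exact: (h k%:R).
  move=> /(ae_eq_integral_abs pi (measurable_half_box _) md); apply: ae_mono => z /= e zk.
  by have /= [/eqP] := e zk; rewrite subr_eq0 => /eqP.
apply: ae_mono (ae_foralln h) => z hz z0.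
have [N hN] := half_box_exhausts z0; exact: (hz N (hN N (leqnn N))).
Qed.

Lemma compact_half_box (K : set (R * R)) : compact K -> K `<=` @half_plane R ->
  exists2 N : R, 0 <= N & K `<=` half_box N.
Proof.
move=> /compact_bounded[M [_ hM]] Kh; exists (`|M| + 1); first by rewrite addr_ge0.
move=> [t x] Ktx; have MM : M < `|M| + 1 by rewrite (le_lt_trans (ler_norm M))// ltrDl.
have : Num.max `|t| `|x| <= `|M| + 1 by exact: (hM _ MM _ Ktx).
have t0 : 0 <= t := Kh _ Ktx.
by rewrite ge_max (ger0_norm t0) => /andP[h1 h2]; apply/half_boxP; rewrite t0.
Qed.

Lemma cvge0_eventually_le (f : R -> \bar R) : (forall x, (0 <= f x)%E) ->
  (forall tol : R, 0 < tol -> exists E : R, forall x, E <= x -> (f x <= tol%:E)%E) ->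
  f x @[x --> +oo] --> 0%E.
Proof.
move=> f0 hf; apply/fine_cvgP; split.
  have [E hE] := hf 1 ltr01; exists E; split; first exact: num_real.
  by move=> x /ltW/hE h; rewrite ge0_fin_numE// (le_lt_trans h)// ltry.
apply/cvgrPdist_le => tol tol0; have [E hE] := hf tol tol0.
exists E; split; first exact: num_real.
move=> x /ltW/hE h; rewrite sub0r normrN ger0_norm ?fine_ge0//.
by rewrite -lee_fin fineK// ge0_fin_numE// (le_lt_trans h)// ltry.
Qed.

Lemma ae_snd_neq0 : {ae pi, forall z : R * R, z.2 != 0}.
Proof.
exists (setT `*` [set 0]); split.
- by apply: measurableX => //; exact: measurable_set1.
- by rewrite /lebesgue_plane product_measure1E//= lebesgue_measure_set1 mule0.
- by move=> [t x] /= /negP; rewrite negbK => /eqP.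
Qed.

Lemma lerint_subset (K D : set (R * R)) (f : R * R -> R) : K `<=` D -> (forall z, 0 <= f z) ->
  (\int[pi]_(z in K) (f z)%:E <= \int[pi]_(z in D) (f z)%:E)%E.
Proof.
move=> KD f0; rewrite [leLHS]integral_mkcond [leRHS]integral_mkcond.
apply: ae_le_integral_nomeas; apply: aeW => z _; rewrite !patchE.
case: ifPn => [|_]; last by case: ifPn; rewrite ?lee_fin.
by rewrite inE => /KD Dz; rewrite mem_set.
Qed.

End assembly.

Theorem proposition4p2 (R : realType) (rhomax1 rhomax2 : R)
  (hmax1 : 0 < rhomax1) (hmax2 : 0 < rhomax2)
  (v1 v2 : R -> R)
  (hv1 : admissible_velocity rhomax1 v1)
  (hv2 : admissible_velocity rhomax2 v2)
  (omega : R -> R -> R)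
  (homega : forall eta : R, 0 < eta -> admissible_kernel eta (omega eta))
  (homega0 : omega eta 0 @[eta --> +oo] --> 0)
  (rho0 : R -> R)
  (hrho0_L1 : (@lebesgue_measure R).-integrable setT (EFin \o rho0))
  (hrho0_BV : BV_line rho0)
  (hrho0_val : {ae @lebesgue_measure R, forall x : R,
     (x < 0 -> 0 <= rho0 x <= rhomax1) /\ (0 < x -> 0 <= rho0 x <= rhomax2)})
  (rhoeta : R -> R -> R -> R)
  (hrhoeta : forall eta : R, 0 < eta ->
     nonlocal_entropy_solution rhomax1 rhomax2 eta v1 v2 (omega eta) rho0
       (rhoeta eta)) :
  exists rho : R -> R -> R,
    [/\ local_entropy_solution rhomax2 v2 rho0 rho,
        (forall rho' : R -> R -> R, local_entropy_solution rhomax2 v2 rho0 rho' ->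
           {ae (@lebesgue_measure R \x @lebesgue_measure R)%E,
              forall z : R * R, 0 <= z.1 -> rho' z.1 z.2 = rho z.1 z.2}) &
        L1loc_cvg rhoeta rho].
Proof.
pose M := rhomax1 + rhomax2; pose r0 x := clamp M (rho0 x).
have M0 : 0 <= M by rewrite addr_ge0// ltW.
have v20 : 0 <= v2 0.
  by have /andP[] := velocity_clip_range hmax2 hv2 0; exact: le_trans.
have rE : {ae @lebesgue_measure R, forall x, rho0 x = r0 x}.
  apply: ae_mono (ae_and ae_neq0 hrho0_val) => x [x0 [xl xr]]; rewrite /r0 clamp_id//.
  have [xn|xp|/eqP] := ltgtP x 0; last by rewrite (negbTE x0).
    by have /andP[h1 h2] := xl xn; rewrite ger0_norm// /M; lra.
  by have /andP[h1 h2] := xr xp; rewrite ger0_norm// /M; lra.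
have r0M x : `|r0 x| <= M by exact: clamp_le.
have br0 : bmeas r0.
  split; last by exists M.
  by apply: measurable_clamp; apply/measurable_EFinP; exact: measurable_int hrho0_L1.
pose U eta := tame M (rhoeta eta).
have bU eta : 0 < eta -> bmeas (fun z : R * R => U eta z.1 z.2).
  by move=> /hrhoeta[mrho _ _ _]; exact: bmeas_tame.
have UM eta t x : `|U eta t x| <= M by exact: tame_le.
have Uneg eta eta' t x : t < 0 -> U eta t x = U eta' t x.
  by move=> t0; rewrite /U /tame !patchE !ifF// memNset//= /half_plane/= leNgt t0.
have aU := nonlocal_family_approx hmax1 hmax2 hv1 hv2 homega homega0 hrho0_L1 rE hrhoeta.
have [e [rho [ke brho rhoM cvg_rho]]] :=
  approx_entropy_precompact v20 br0 r0M bU UM Uneg aU.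
have sol : local_entropy_solution rhomax2 v2 rho0 rho.
  apply: (approx_entropy_limit v20 rE (U := fun k => U (e k)) (M := M)) => //.
  - by move=> k; apply: bU; exact: lt_le_trans (ke k).
  - move=> B eps /(aU B)[E hE]; exists (Num.truncn `|E|) => k kE; apply: hE.
    rewrite (le_trans (ler_norm E))// (le_trans _ (ke k))//.
    by rewrite (le_trans (ltW (truncnS_gt _)))// ler_nat.
exists rho; split=> //.
- move=> rho' sol'; have [mrho' [M' rho'M'] _] := sol'.
  (* A competitor may have a larger bound than [M], so stability is applied with a common one. *)
  pose M'' := Num.max M M'.
  have M''0 : 0 <= M'' by rewrite le_max M0.
  have a1 : {ae (@lebesgue_plane R), forall z : R * R, 0 <= z.1 -> `|rho' z.1 z.2| <= M''}.
    by apply: ae_mono rho'M' => z h /h h'; rewrite le_max h' orbT.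
  have a2 : {ae (@lebesgue_plane R), forall z : R * R, 0 <= z.1 -> `|rho z.1 z.2| <= M''}.
    by apply: aeW => z _; rewrite le_max rhoM.
  have mrho : measurable_fun (@half_plane R) (fun z : R * R => rho z.1 z.2) by case: sol.
  have r0M'' x : `|r0 x| <= M'' by rewrite le_max r0M.
  have := @ae_eq_half_plane R (tame M'' rho') (tame M'' rho) (bmeas_tame M''0 mrho')
    (bmeas_tame M''0 mrho).
  move=> /(_ _)H; have {}H : {ae (@lebesgue_plane R), forall z : R * R, 0 <= z.1 ->
      tame M'' rho' z.1 z.2 = tame M'' rho z.1 z.2}.
    apply: H => N tol N0 tol0.
    have [B [eps [eps0 hB]]] := approx_entropy_stability rhomax2 v20 N0 br0 r0M'' tol0.
    apply: hB; try exact: bmeas_tame; try (by move=> t x; exact: tame_le).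
      exact: (local_entropy_solution_approx rE a1 (ltW eps0) sol').
    exact: (local_entropy_solution_approx rE a2 (ltW eps0) sol).
  apply: ae_mono (ae_and H a1) => z [h1 h2] z0.
  by have := h1 z0; rewrite (tameE z0 (h2 z0)) tameE// le_max rhoM.
- move=> K cK Kh; have [N N0 KN] := compact_half_box cK Kh.
  apply: cvge0_eventually_le => [eta|tol tol0]; first by apply: integral_ge0 => z _; rewrite lee_fin.
  have [B [eps [eps0 hB]]] := approx_entropy_stability rhomax2 v20 N0 br0 r0M tol0.
  have [E hE] := aU B eps eps0; exists (`|E| + 1) => eta Eeta.
  have eta0 : 0 < eta by have := normr_ge0 E; lra.
  have Ee : E <= eta by have := ler_norm E; lra.
  have arho : {ae (@lebesgue_plane R), forall z : R * R, 0 <= z.1 -> `|rho z.1 z.2| <= M}.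
    exact: aeW.
  have le := hB (U eta) (tame M rho) (bU _ eta0) (bmeas_tame M0 (let: And3 m _ _ := sol in m))
    (UM eta) (fun t x => tame_le _ _ _ M0) (hE _ Ee)
    (local_entropy_solution_approx rE arho (ltW eps0) sol).
  apply: le_trans le; apply: le_trans (lerint_subset KN _); last by move=> z.
  have [_ rng _ _] := hrhoeta _ eta0.
  (* Back from the tame representative to [rhoeta]: the two agree almost everywhere on t >= 0, the
     axis x = 0 being negligible. *)
  apply: ae_le_integral_nomeas; apply: ae_mono (ae_and ae_snd_neq0 rng) => -[t x] /= [x0 rngE] Kz.
  have t0 : 0 <= t := Kh _ Kz.
  rewrite lee_fin (tameE t0 (rhoM t x)) /U tameE//.
  have [rl rr] := rngE t0; have [xn|xp|/eqP] := ltgtP x 0; last by rewrite (negbTE x0).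
    by have /andP[h1 h2] := rl xn; rewrite ger0_norm// /M; lra.
  by have /andP[h1 h2] := rr xp; rewrite ger0_norm// /M; lra.
Qed.
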